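(* Let $(\Sigma,g)$ and $(\Pi,h)$ be Riemannian surfaces with Gaussian curvatures $K$ and $c$, respectively, where $c$ is constant, and let $\varphi:\Sigma\to\mathbb{R}\smallsetminus\{0\}$ be a smooth function. With $\Delta$ and $\nabla$ referring to the metric $g$, suppose that on $\Sigma$ either (i) $\Delta\varphi^{-1}=0$ and $2g(\nabla\varphi,\nabla\varphi)=(c-K)\varphi^2$, or (ii) $2\nabla d\varphi=(\Delta\varphi)g$ and $(K+c)\varphi^2+\varphi\Delta\varphi=2g(\nabla\varphi,\nabla\varphi)$. Then the metric $\bar g=(g+h)/\varphi^2$ on $\Sigma\times\Pi$ is weakly Einstein. Also, $\bar g$ is (iii) in case (i), Einstein if and only if $2\nabla d\varphi=(\Delta\varphi)g$; (iv) in case (ii), Einstein if and only if $g(\nabla\varphi,\nabla\varphi)=c\,\varphi^2$; (v) conformally flat if and only if $K=-c$. More precisely, the equalities in (iii), (iv) (in the respective cases) and (v) characterize the points at which the Einstein tensor, or respectively the Weyl tensor, of $\bar g$ vanishes. At every point at which both of these tensors are nonzero, the scalar curvature $\bar{\mathrm{s}}$ of $\bar g$ is nonzero and, for some parameter $\lambda\ne0$, the local-homothety invariant of $\bar g$ (defined in the context) is given by $$\bar{\mathrm{s}},\quad(-\lambda,0,0,\lambda),\quad(-\bar{\mathrm{s}}/12,-\bar{\mathrm{s}}/12,\bar{\mathrm{s}}/6),\quad(-\bar{\mathrm{s}}/12,-\bar{\mathrm{s}}/12,\bar{\mathrm{s}}/6)\quad\text{in case (i)},$$ $$\bar{\mathrm{s}},\quad(-\lambda,-\lambda,\lambda,\lambda),\quad(-\bar{\mathrm{s}}/12,\bar{\mathrm{s}}/24,\bar{\mathrm{s}}/24),\quad(-\bar{\mathrm{s}}/12,\bar{\mathrm{s}}/24,\bar{\mathrm{s}}/24)\quad\text{in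 case (ii)}.$$
   Context: Manifolds are connected; all manifolds, metrics and functions are smooth. The symbols $g,h,\varphi$ also denote their pullbacks to $\Sigma\times\Pi$. A Riemannian four-manifold $(M,g)$ with curvature tensor $R$ is weakly Einstein if, for some function $\phi$ on $M$, $R_{ikpq}R_j{}^{kpq}=\phi g_{ij}$. The sign of $R$ is such that the Ricci tensor is $\mathrm{r}_{ij}=g^{pq}R_{ipjq}$; $\mathrm{s}$ is the scalar curvature, the Einstein tensor in dimension $n$ is $\mathrm{e}=\mathrm{r}-\mathrm{s}g/n$, and $W$ is the Weyl tensor. $W$ acts on bivectors by $(W\zeta)_{ij}=\frac12W_{ijkl}\zeta^{kl}$ (so that, for example, a Kähler form on a Kähler surface is an eigenbivector with eigenvalue $\mathrm{s}/6$), and $W^\pm:\Lambda^\pm\to\Lambda^\pm$ are its restrictions to self-dual and anti-self-dual bivectors, for a fixed orientation. $\nabla d\varphi$ is the Hessian and $\Delta\varphi=\mathrm{tr}_g\nabla d\varphi$. Saying that the local-homothety invariant at a point $x$ of an oriented weakly Einstein four-manifold is given by ''$\mathrm{s},\ (a_1,a_2,a_3,a_4),\ (b_1^+,b_2^+,b_3^+),\ (b_1^-,b_2^-,b_3^-)$'' means: $\mathrm{s}$ is the scalar curvature at $x$, and there is a positive orthonormal basis $u_1,\dots,u_4$ of the tangent space at $x$ (orthonormal for the metric in question) consisting of eigenvectors of the Einstein tensor with the respective eigenvalues $a_1,\dots,a_4$, such that the bivectors $$u_1\wedge u_2\pm u_3\wedge u_4,\quad u_1\wedge u_3\pm u_4\wedge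 u_2,\quad u_1\wedge u_4\pm u_2\wedge u_3,$$ which form orthogonal bases of $\Lambda^\pm$, are eigenvectors of $W^\pm$ with the respective eigenvalues $b_1^\pm,b_2^\pm,b_3^\pm$. *)

(* Defs.v *)
From mathcomp Require Import all_boot all_order all_algebra.
From mathcomp Require Import all_classical all_reals all_analysis.

Set Implicit Arguments.
Unset Strict Implicit.
Unset Printing Implicit Defensive.
Import Order.TTheory GRing.Theory Num.Theory.
Import numFieldNormedType.Exports.
Local Open Scope classical_set_scope.
Local Open Scope ring_scope.

(* MathComp-Analysis has no manifolds, so the file sets up smooth manifolds by
   atlases.  A tensor field is given by its components in each chart of the
   atlas, as functions on the coordinate space 'rV[R]_n; such functions only
   matter on the (open) image of the chart. *)

Section Coordinates.
Context {R : realType} {n : nat}.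
Implicit Types (f : 'rV[R]_n -> R) (U : set 'rV[R]_n).

Definition partial (i : 'I_n) f : 'rV[R]_n -> R :=
  fun y => 'D_('e_i) f y.

Fixpoint Ck (k : nat) U f : Prop :=
  match k with
  | 0 => forall y, U y -> {for y, continuous f}
  | k'.+1 => (forall y i, U y -> derivable f y 'e_i) /\
             (forall i, Ck k' U (partial i f))
  end.

(* Used for open U only. *)
Definition smooth_on U f : Prop := forall k, Ck k U f.

End Coordinates.

Section Curvature.
Context {R : realType} {n : nat}.
Variables (G : 'rV[R]_n -> 'M[R]_n) (y : 'rV[R]_n).

(* Gamma^k_ij *)
Definition christoffel (k i j : 'I_n) (z : 'rV[R]_n) : R :=
  2^-1 * \sum_l invmx (G z) k l *
    (partial i (fun w => G w j l) z + partial j (fun w => G w i l) z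
     - partial l (fun w => G w i j) z).

(* R_ijkl = g(Rm(d_i, d_j) d_l, d_k), where
   Rm(X, Y) Z = D_X D_Y Z - D_Y D_X Z - D_[X,Y] Z; with this order of the
   arguments r_ij = g^pq R_ipjq and R_ijij > 0 on round spheres. *)
Definition riemann (i j k l : 'I_n) : R :=
  \sum_m G y k m *
    (partial i (christoffel m j l) y - partial j (christoffel m i l) y
     + \sum_p (christoffel m i p y * christoffel p j l y
               - christoffel m j p y * christoffel p i l y)).

Definition ricci : 'M[R]_n :=
  \matrix_(i, j) \sum_p \sum_q invmx (G y) p q * riemann i p j q.

Definition scalar_curvature : R :=
  \sum_i \sum_j invmx (G y) i j * ricci i j.

Definition einstein_tensor : 'M[R]_n :=
  ricci - (scalar_curvature / n%:R) *: G y.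

Definition weyl (i j k l : 'I_n) : R :=
  riemann i j k l
  - (n%:R - 2)^-1 * (G y i k * ricci j l - G y i l * ricci j k
                     + G y j l * ricci i k - G y j k * ricci i l)
  + scalar_curvature / ((n%:R - 1) * (n%:R - 2))
    * (G y i k * G y j l - G y i l * G y j k).

(* R_j^kpq *)
Definition riemann_up (j k p q : 'I_n) : R :=
  \sum_k' \sum_p' \sum_q' invmx (G y) k k' * invmx (G y) p p'
    * invmx (G y) q q' * riemann j k' p' q'.

Definition inner (v w : 'rV[R]_n) : R := (v *m G y *m w^T) 0 0.

Definition gradient (f : 'rV[R]_n -> R) : 'rV[R]_n :=
  \row_k \sum_l invmx (G y) k l * partial l f y.

Definition hessian (f : 'rV[R]_n -> R) : 'M[R]_n :=
  \matrix_(i, j) (partial i (partial j f) y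
                  - \sum_k christoffel k i j y * partial k f y).

Definition laplacian (f : 'rV[R]_n -> R) : R :=
  \sum_i \sum_j invmx (G y) i j * hessian f i j.

End Curvature.

(* Sectional curvature of the tangent plane. *)
Definition gauss_curvature {R : realType} (G : 'rV[R]_2 -> 'M[R]_2)
    (y : 'rV[R]_2) : R :=
  riemann G y 0 1 0 1 / \det (G y).

Section Manifolds.
Context {R : realType}.

Record chart (M : topologicalType) (n : nat) := Chart {
  cdom : set M;
  cmap : M -> 'rV[R]_n;
  cinv : 'rV[R]_n -> M }.

Record atlas (M : topologicalType) (n : nat) := Atlas {
  aidx : Type;
  achart :> aidx -> chart M n }.

Section OneManifold.
Context {M : topologicalType} {n : nat}.
Implicit Types (A : atlas M n).

Definition cimg (x : chart M n) : set 'rV[R]_n := cmap x @` cdom x.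

Definition is_chart (x : chart M n) : Prop :=
  [/\ open (cdom x), open (cimg x),
      forall p, cdom x p -> cinv x (cmap x p) = p,
      forall p, cdom x p -> {for p, continuous (cmap x)} &
      forall y, cimg x y -> {for y, continuous (cinv x)}].

Definition overlap (x x' : chart M n) : set 'rV[R]_n :=
  cimg x `&` cinv x @^-1` cdom x'.

Definition transition (x x' : chart M n) : 'rV[R]_n -> 'rV[R]_n :=
  cmap x' \o cinv x.

Record connected_manifold A : Prop := ConnectedManifold {
  mfd_nonempty : [set: M] !=set0;
  mfd_hausdorff : hausdorff_space M;
  mfd_countable : @second_countable M;
  mfd_connected : connected [set: M];
  mfd_charts : forall a, is_chart (A a);
  mfd_cover : forall p : M, exists a, cdom (A a) p;
  mfd_smooth : forall a b (i : 'I_n), smooth_on (overlap (A a) (A b))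
    (fun y => transition (A a) (A b) y 0 i) }.

Definition smooth_fun A (f : M -> R) : Prop :=
  forall a, smooth_on (cimg (A a)) (f \o cinv (A a)).

Definition metric A := aidx A -> 'rV[R]_n -> 'M[R]_n.

(* The Jacobian matrices of the library act on row vectors on the right. *)
Record riemannian A (g : metric A) : Prop := Riemannian {
  metric_smooth : forall a i j,
    smooth_on (cimg (A a)) (fun y => g a y i j);
  metric_sym : forall a y, cimg (A a) y -> (g a y)^T = g a y;
  metric_pos : forall a y (v : 'rV[R]_n), cimg (A a) y -> v != 0 ->
    0 < inner (g a) y v v;
  metric_compat : forall a b y, overlap (A a) (A b) y ->
    let J := 'J (transition (A a) (A b)) y in
    g a y = J *m g b (transition (A a) (A b) y) *m J^T }.

Definition rescale A (u : M -> R) (g : metric A) : metric A :=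
  fun a y => u (cinv (A a) y) *: g a y.

(* Being tensorial, the pointwise conditions below hold in one chart at a point
   if and only if they hold in every chart at that point. *)

Definition weakly_einstein A (g : metric A) : Prop :=
  exists2 phi : M -> R, smooth_fun A phi &
    forall a p, cdom (A a) p -> let y := cmap (A a) p in
    forall i j, \sum_k \sum_l \sum_m
      riemann (g a) y i k l m * riemann_up (g a) y j k l m
      = phi p * g a y i j.

Definition einstein A (g : metric A) : Prop :=
  forall a p, cdom (A a) p -> einstein_tensor (g a) (cmap (A a) p) = 0.

(* Near every point some smooth positive multiple of the metric is flat. *)
Definition conformally_flat A (g : metric A) : Prop :=
  forall p : M, exists a (U : set 'rV[R]_n) (u : 'rV[R]_n -> R),
    [/\ cdom (A a) p, open U, U (cmap (A a) p) & U `<=` cimg (A a)] /\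
    [/\ smooth_on U u, forall y, U y -> 0 < u y &
        forall y, U y -> forall i j k l,
          riemann (fun z => u z *: g a z) y i j k l = 0].

End OneManifold.

Definition gaussian_curvature (M : topologicalType) (A : atlas M 2)
    (g : metric A) (K : M -> R) : Prop :=
  forall a p, cdom (A a) p -> K p = gauss_curvature (g a) (cmap (A a) p).

Section Product.
Context {M N : topologicalType} {m n : nat}.

Definition prod_chart (x : chart M m) (x' : chart N n)
    : chart (M * N)%type (m + n) :=
  Chart (cdom x `*` cdom x')
        (fun p => row_mx (cmap x p.1) (cmap x' p.2))
        (fun y => (cinv x (lsubmx y), cinv x' (rsubmx y))).

Definition prod_atlas (A : atlas M m) (B : atlas N n)
    : atlas (M * N)%type (m + n) :=
  @Atlas _ _ (aidx A * aidx B) (fun ab => prod_chart (A ab.1) (B ab.2)).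

Definition prod_metric (A : atlas M m) (B : atlas N n)
    (g : metric A) (h : metric B) : metric (prod_atlas A B) :=
  fun ab y => block_mx (g ab.1 (lsubmx y)) 0 0 (h ab.2 (rsubmx y)).

End Product.

End Manifolds.

Section HomothetyInvariant.
Context {R : realType}.
Variables (G : 'rV[R]_4 -> 'M[R]_4) (y : 'rV[R]_4).

(* Components (u /\ v)^kl = u^k v^l - u^l v^k. *)
Definition wedge (u v : 'rV[R]_4) : 'M[R]_4 := u^T *m v - v^T *m u.

(* (W zeta)_ij = (1/2) W_ijkl zeta^kl is b times zeta_ij = g_ik g_jl zeta^kl.
   As W preserves self-duality and anti-self-duality, for zeta in Lambda^+ or
   Lambda^- this is the eigenvector condition for W^+ or W^-. *)
Definition weyl_eigen (b : R) (zeta : 'M[R]_4) : Prop :=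
  forall i j, 2^-1 * (\sum_k \sum_l weyl G y i j k l * zeta k l)
              = b * \sum_k \sum_l G y i k * G y j l * zeta k l.

Definition weyl_eigenbasis (sg : R) (u1 u2 u3 u4 : 'rV[R]_4)
    (b : seq R) : Prop :=
  [/\ weyl_eigen (b`_0) (wedge u1 u2 + sg *: wedge u3 u4),
      weyl_eigen (b`_1) (wedge u1 u3 + sg *: wedge u4 u2) &
      weyl_eigen (b`_2) (wedge u1 u4 + sg *: wedge u2 u3)].

(* The local-homothety invariant at the point with coordinates y; the rows of u
   are the basis vectors, and o tells whether the orientation of the tangent
   space is opposite to that of the coordinates. *)
Definition homothety_invariant (o : bool) (s : R) (a : seq R)
    (bp bm : seq R) : Prop :=
  scalar_curvature G y = s /\
  exists u : 'M[R]_4,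
    [/\ forall i j, inner G y (row i u) (row j u) = (i == j)%:R,
        0 < (-1) ^+ o * \det u,
        forall i, row i u *m einstein_tensor G y
                  = a`_i *: (row i u *m G y),
        weyl_eigenbasis 1 (row 0 u) (row 1 u) (row 2 u) (row 3 u) bp &
        weyl_eigenbasis (-1) (row 0 u) (row 1 u) (row 2 u) (row 3 u) bm].

End HomothetyInvariant.

Section Conditions.
Context {R : realType} {M : topologicalType} {A : @atlas R M 2}.
Variables (g : metric A) (phi K : M -> R) (c : R).

(* 2 Hess phi = (Delta phi) g *)
Definition hessian_pure (a : aidx A) (p : M) : Prop :=
  let y := cmap (A a) p in let f := phi \o cinv (A a) in
  2 *: hessian (g a) y f = laplacian (g a) y f *: g a y.

(* g(grad phi, grad phi) *)
Definition grad_sq (a : aidx A) (p : M) : R :=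
  let y := cmap (A a) p in let v := gradient (g a) y (phi \o cinv (A a)) in
  inner (g a) y v v.

Definition case_i : Prop :=
  forall a p, cdom (A a) p ->
    laplacian (g a) (cmap (A a) p) ((fun q => (phi q)^-1) \o cinv (A a)) = 0 /\
    2 * grad_sq a p = (c - K p) * phi p ^+ 2.

Definition case_ii : Prop :=
  forall a p, cdom (A a) p ->
    hessian_pure a p /\
    (K p + c) * phi p ^+ 2
      + phi p * laplacian (g a) (cmap (A a) p) (phi \o cinv (A a))
    = 2 * grad_sq a p.

End Conditions.

(* Main.v *)
(* On a frame orthonormal for [g + h] that diagonalizes the Hessian of [phi], the
   curvature tensor of [(g + h) / phi^2] is diagonal on bivectors: its eigenvalues
   on the coordinate planes are [k + P + q - Q], [P - Q] (twice), [q - Q] (twice)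
   and [l - Q], where [k = phi^2 K], [l = phi^2 c], [P] and [q] are [phi] times the
   eigenvalues of the Hessian and [Q = g(grad phi, grad phi)].  Case (i) says
   [P + q = 2Q = l - k], case (ii) says [P = q] and [k + l + P + q = 2Q].  Either
   one makes the three opposite pairs of eigenvalues equal up to sign, which is the
   weakly Einstein condition, and all pointwise assertions become linear algebra:
   in particular the Weyl tensor is a multiple of [k + l].

   The function in the weakly Einstein condition is [2(l - Q)^2 + 4(P - Q)^2]; in
   case (i), [(P - Q)^2 = Q^2 - P q] and [P q = phi^2 det(Hess phi) / det g].

   If [K = -c] with [c >= 0], the equations [Hess f = c f g],
   [g(grad f, grad f) = c f^2] have positive local solutions on Sigma by the
   Frobenius theorem, and [(g + h) / f^2] is flat; if [c < 0], the same holds with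
   the factors exchanged.  Conversely, a metric conformal to a flat one has zero
   Weyl tensor. *)

From HB Require Import structures.
Require Import Defs.
From mathcomp Require Import all_boot all_order all_algebra.
From mathcomp Require Import all_classical all_reals all_analysis.
From mathcomp Require Import ring lra.
Import Order.TTheory GRing.Theory Num.Theory.
Import numFieldNormedType.Exports.
Local Open Scope classical_set_scope.
Local Open Scope ring_scope.
Set Implicit Arguments.
Unset Strict Implicit.
Unset Printing Implicit Defensive.

(** * Smooth functions *)

(** The frame that diagonalizes the Hessian is available only point by point: where the two
    eigenvalues meet it need not vary smoothly. Curvature statements are therefore identities at one
    point, and whatever has to be smooth is assembled from quantities that make sense without a
    frame.

    For a curvature tensor with eigenvalues [kappa a b], the weakly Einstein condition says that the
    sum over [b] of [kappa a b ^+ 2] does not depend on [a]. Exactly one plane of each opposite pair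
    contains a given frame vector, so equal squares within the pairs suffice.

    The Weyl tensor does not see [P], [q] and [Q] because they enter through products of the metric
    with a symmetric form. The curvature is diagonal at all because, for the conformal factor
    [phi^-2], the terms in the square of [d phi] cancel.

    Pointwise algebra cannot produce the flat metrics needed when [K = -c]. The differential system
    used there is linear, so a bound on its coefficients alone determines a box on which it can be
    integrated: along a horizontal line, then along vertical ones. Differentiability across the
    vertical lines is the delicate point and follows from a Gronwall estimate. *)

Section PartialRules.
Context {R : realType} {n : nat}.
Implicit Types (f g : 'rV[R]_n -> R) (y : 'rV[R]_n) (i : 'I_n).

Lemma partial_eq_near f g y i : (\forall z \near y, f z = g z) ->
  partial i f y = partial i g y.
Proof. exact: near_eq_derive. Qed.

Lemma partial_cst (k : R) y i : partial i (fun=> k) y = 0.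
Proof. exact: derive_cst. Qed.

Lemma partialD f g y i : derivable f y 'e_i -> derivable g y 'e_i ->
  partial i (fun z => f z + g z) y = partial i f y + partial i g y.
Proof. exact: deriveD. Qed.

Lemma partialB f g y i : derivable f y 'e_i -> derivable g y 'e_i ->
  partial i (fun z => f z - g z) y = partial i f y - partial i g y.
Proof. exact: deriveB. Qed.

Lemma partialM f g y i : derivable f y 'e_i -> derivable g y 'e_i ->
  partial i (fun z => f z * g z) y = partial i f y * g y + f y * partial i g y.
Proof.
by move=> df dg; rewrite addrC /partial (deriveM df dg) [in LHS]/GRing.scale/= [g y * _]mulrC.
Qed.

Lemma partialZ (k : R) f y i : derivable f y 'e_i ->
  partial i (fun z => k * f z) y = k * partial i f y.
Proof. by move=> df; exact: (deriveZ k df). Qed.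

Lemma partialV f y i : f y != 0 -> derivable f y 'e_i ->
  partial i (fun z => (f z)^-1) y = - partial i f y / f y ^+ 2.
Proof.
by move=> f0 df; rewrite /partial (deriveV f0 df) /GRing.scale/= mulNr mulrC mulNr.
Qed.

Lemma fsumE m (F : 'I_m -> 'rV[R]_n -> R) :
  (fun z => \sum_k F k z) = \sum_k F k.
Proof. by apply/funext => z; rewrite fct_sumE. Qed.

Lemma partial_sum m (F : 'I_m -> 'rV[R]_n -> R) y i :
  (forall k, derivable (F k) y 'e_i) ->
  partial i (fun z => \sum_k F k z) y = \sum_k partial i (F k) y.
Proof. by move=> dF; rewrite fsumE /partial; exact: derive_sum. Qed.

End PartialRules.

Section Smooth.
Context {R : realType} {n : nat}.
Implicit Types (f g : 'rV[R]_n -> R) (U : set 'rV[R]_n) (y : 'rV[R]_n).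

Lemma smooth_continuous U f y : smooth_on U f -> U y -> {for y, continuous f}.
Proof. by move=> sf Uy; exact: (sf 0%N). Qed.

Lemma smooth_derivable U f y i : smooth_on U f -> U y -> derivable f y 'e_i.
Proof. by move=> sf Uy; have [+ _] := sf 1%N; apply. Qed.

Lemma smooth_partial U f i : smooth_on U f -> smooth_on U (partial i f).
Proof. by move=> sf k; have [_] := sf k.+1; apply. Qed.

Lemma smooth_intro U f : (forall y, U y -> {for y, continuous f}) ->
  (forall y i, U y -> derivable f y 'e_i) ->
  (forall i, smooth_on U (partial i f)) -> smooth_on U f.
Proof. by move=> cf df pf [|k]//; split=> // i; exact: pf. Qed.

Lemma open_near U y (P : set 'rV[R]_n) : open U -> U y ->
  (forall z, U z -> P z) -> \forall z \near y, P z.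
Proof.
by move=> oU Uy UP; apply: filterS (open_nbhs_nbhs (conj oU Uy)).
Qed.

(** Openness of [U] carries the argument: [Ck] tests continuity and derivatives of total functions,
    and agreement on [U] is agreement near each point of [U]. *)
Lemma Ck_eq k U f g : open U -> (forall y, U y -> f y = g y) ->
  Ck k U f -> Ck k U g.
Proof.
move=> oU; elim: k f g => [|k IH] f g fg /=.
  move=> cf y Uy; have fgy := open_near oU Uy fg.
  rewrite /prop_for /continuous_at -(fg _ Uy).
  by have H := cf _ Uy; apply: cvg_trans H; exact: (@near_eq_cvg _ _ (nbhs y) _ f g fgy).
move=> [df pf]; split.
  move=> y i Uy; apply: near_eq_derivable (df y i Uy).
  exact: (open_near oU Uy).
move=> i; apply: IH (pf i) => y Uy; apply: partial_eq_near.
exact: (open_near oU Uy).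
Qed.

Lemma smooth_eq U f g : open U -> (forall y, U y -> f y = g y) ->
  smooth_on U f -> smooth_on U g.
Proof. by move=> oU fg sf k; exact: Ck_eq (sf k). Qed.

Lemma smooth_sub U V f : V `<=` U -> smooth_on U f -> smooth_on V f.
Proof.
move=> VU sf k; elim: k f sf => [|k IH] f sf /=.
  by move=> y /VU; exact: smooth_continuous sf.
split=> [y i /VU|i]; first exact: smooth_derivable sf.
by apply: IH; exact: smooth_partial.
Qed.

Lemma smooth_cst U (k : R) : smooth_on U (fun=> k).
Proof.
move=> m; elim: m k => [|m IH] k /=; first by move=> y _; exact: cst_continuous.
split=> [y i _|i]; first exact: derivable_cst.
have -> : partial i (fun=> k) = fun=> 0 :> R by apply/funext => y; exact: partial_cst.
exact: IH.
Qed.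

Variables (U : set 'rV[R]_n) (oU : open U).

(** The algebra spanned by [B] under sums, products and inverses of functions without zeros on [U].
    It gives smoothness of functions known only through equations for their partial derivatives: a
    base whose derivatives fall back into this algebra consists of smooth functions. *)
Inductive generated (B : ('rV[R]_n -> R) -> Prop) : ('rV[R]_n -> R) -> Prop :=
| generated_base f : B f -> generated B f
| generated_cst k : generated B (fun=> k)
| generated_add f g : generated B f -> generated B g ->
    generated B (fun z => f z + g z)
| generated_mul f g : generated B f -> generated B g ->
    generated B (fun z => f z * g z)
| generated_inv f : generated B f -> (forall y, U y -> f y != 0) ->
    generated B (fun z => (f z)^-1).

(** Continuity, derivability and having derivatives in the algebra pass from the base to the whole
    algebra. The order [k] is then raised for all members at once, so the induction hypothesis
    applies to the derivatives. *)
Lemma generated_smooth B f :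
  (forall f, B f -> [/\ forall y, U y -> {for y, continuous f},
     forall y i, U y -> derivable f y 'e_i &
     forall i, exists2 g, generated B g & forall y, U y -> partial i f y = g y]) ->
  generated B f -> smooth_on U f.
Proof.
move=> HB; have {HB}H : forall f, generated B f ->
    [/\ forall y, U y -> {for y, continuous f},
     forall y i, U y -> derivable f y 'e_i &
     forall i, exists2 g, generated B g & forall y, U y -> partial i f y = g y].
  move=> {}f; elim=> {f} [f /HB//|k|f g gf [cf df pf] gg [cg dg pg]
    |f g gf [cf df pf] gg [cg dg pg]|f gf [cf df pf] f0].
  - split=> [y _|y i _|i]; first exact: cst_continuous.
      exact: derivable_cst.
    exists (fun=> 0); first exact: generated_cst.
    by move=> y _; rewrite partial_cst.
  - split=> [y Uy|y i Uy|i].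
    + by apply: continuousD; [exact: cf|exact: cg].
    + by apply: derivableD; [exact: df|exact: dg].
    + have [f' gf' f'E] := pf i; have [g' gg' g'E] := pg i.
      exists (fun z => f' z + g' z); first exact: generated_add.
      by move=> y Uy; rewrite partialD ?f'E ?g'E//; [exact: df|exact: dg].
  - split=> [y Uy|y i Uy|i].
    + by apply: continuousM; [exact: cf|exact: cg].
    + by apply: derivableM; [exact: df|exact: dg].
    + have [f' gf' f'E] := pf i; have [g' gg' g'E] := pg i.
      exists (fun z => f' z * g z + f z * g' z).
        by apply: generated_add; apply: generated_mul.
      by move=> y Uy; rewrite partialM ?f'E ?g'E//; [exact: df|exact: dg].
  - split=> [y Uy|y i Uy|i].
    + by apply: continuousV; [exact: f0|exact: cf].
    + by apply: derivableV; [exact: f0|exact: df].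
    + have [f' gf' f'E] := pf i.
      exists (fun z => (-1 * f' z) * ((f z)^-1 * (f z)^-1)).
        apply: generated_mul; first by apply: generated_mul => //; apply: generated_cst.
        by apply: generated_mul; apply: generated_inv.
      move=> y Uy; rewrite partialV ?f'E//; [|exact: f0|exact: df].
      by rewrite expr2 invfM mulN1r.
move=> gf k; elim: k f gf => [|k IH] f gf; have [cf df pf] := H f gf => //=.
split=> // i; have [g gg fg] := pf i.
by apply: (@Ck_eq k U g) (IH _ gg) => // y Uy; rewrite fg.
Qed.

Lemma smooth_generated f : generated (smooth_on U) f -> smooth_on U f.
Proof.
apply: generated_smooth => {}f sf; split=> [y Uy|y i Uy|i].
- exact: smooth_continuous Uy.
- exact: smooth_derivable Uy.
- by exists (partial i f) => //; apply: generated_base; exact: smooth_partial.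
Qed.

Lemma smoothD f g : smooth_on U f -> smooth_on U g ->
  smooth_on U (fun z => f z + g z).
Proof.
by move=> sf sg; apply: smooth_generated; apply: generated_add; apply: generated_base.
Qed.

Lemma smoothM f g : smooth_on U f -> smooth_on U g ->
  smooth_on U (fun z => f z * g z).
Proof.
by move=> sf sg; apply: smooth_generated; apply: generated_mul; apply: generated_base.
Qed.

Lemma smoothV f : smooth_on U f -> (forall y, U y -> f y != 0) ->
  smooth_on U (fun z => (f z)^-1).
Proof.
by move=> sf f0; apply: smooth_generated; apply: generated_inv => //; apply: generated_base.
Qed.

Lemma smoothZ (k : R) f : smooth_on U f -> smooth_on U (fun z => k * f z).
Proof. by apply: smoothM; exact: smooth_cst. Qed.

Lemma smoothN f : smooth_on U f -> smooth_on U (fun z => - f z).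
Proof.
by move=> /(smoothZ (-1)); apply: smooth_eq => // y _; rewrite mulN1r.
Qed.

Lemma smoothB f g : smooth_on U f -> smooth_on U g ->
  smooth_on U (fun z => f z - g z).
Proof. by move=> sf /smoothN; exact: smoothD. Qed.

Lemma smoothX f k : smooth_on U f -> smooth_on U (fun z => f z ^+ k).
Proof.
move=> sf; elim: k => [|k IH]; first exact: smooth_cst.
by apply: smooth_eq (smoothM sf IH) => // y _; rewrite exprS.
Qed.

Lemma smooth_sum (I : Type) (r : seq I) (P : pred I) (F : I -> 'rV[R]_n -> R) :
  (forall k, smooth_on U (F k)) -> smooth_on U (fun z => \sum_(k <- r | P k) F k z).
Proof.
move=> sF; elim: r => [|k r IH].
  by apply: smooth_eq (smooth_cst U 0) => // y _; rewrite big_nil.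
case: (boolP (P k)) => Pk.
  by apply: smooth_eq (smoothD (sF k) IH) => // y _; rewrite big_cons Pk.
by apply: smooth_eq IH => // y _; rewrite big_cons (negbTE Pk).
Qed.

Lemma smooth_prod (I : Type) (r : seq I) (F : I -> 'rV[R]_n -> R) :
  (forall k, smooth_on U (F k)) -> smooth_on U (fun z => \prod_(k <- r) F k z).
Proof.
move=> sF; elim: r => [|k r IH].
  by apply: smooth_eq (smooth_cst U 1) => // y _; rewrite big_nil.
by apply: smooth_eq (smoothM (sF k) IH) => // y _; rewrite big_cons.
Qed.

Lemma smooth_det m (G : 'rV[R]_n -> 'M[R]_m) :
  (forall i j, smooth_on U (fun z => G z i j)) -> smooth_on U (fun z => \det (G z)).
Proof.
move=> sG; rewrite /determinant; apply: smooth_sum => s.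
by apply: smoothZ; apply: smooth_prod.
Qed.

(** By Cramer's rule the entries of the inverse are cofactors divided by the determinant, so closure
    under algebraic operations is enough. *)
Lemma smooth_invmx m (G : 'rV[R]_n -> 'M[R]_m) i j :
  (forall i j, smooth_on U (fun z => G z i j)) ->
  (forall y, U y -> G y \in unitmx) -> smooth_on U (fun z => invmx (G z) i j).
Proof.
move=> sG uG.
apply: (@smooth_eq _ (fun z => (\det (G z))^-1 * cofactor (G z) j i)) => //.
  by move=> y Uy; rewrite /invmx uG// !mxE.
apply: smoothM.
  apply: smoothV; first exact: smooth_det.
  by move=> y /uG; rewrite unitmxE unitfE.
rewrite /cofactor; apply: smoothZ; apply: smooth_det => k l.
by apply: smooth_eq (sG (lift j k) (lift i l)) => // y _; rewrite !mxE.
Qed.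

End Smooth.

(** * Mean value theorems and the symmetry of second derivatives *)

Section MeanValue.
Context {R : realType}.

(** The increment [h] may have either sign; locating the intermediate point only by its absolute
    value lets one estimate serve both. *)
Lemma mvt_symmetric (f df : R -> R) (h : R) :
  (forall s, `|s| <= `|h| -> is_derive s (1 : R) f (df s)) ->
  exists2 s, `|s| <= `|h| & f h - f 0 = df s * h.
Proof.
move=> fdf.
have cf (s : R) : `|s| <= `|h| -> {for s, continuous f}.
  by move=> /fdf [/derivable1_diffP dfs _]; exact: differentiable_continuous.
have cw a b : (forall s, s \in `[a, b] -> `|s| <= `|h|) ->
    {within `[a, b], continuous f}.
  by move=> H; apply: continuous_in_subspaceT => s /set_mem /H; exact: cf.
have [h0|h0] := leP 0 h.
  have H s : s \in `[0, h] -> `|s| <= `|h|.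
    by rewrite in_itv/= => /andP[s0 sh]; rewrite !ger0_norm.
  have [s sh E] := @MVT_segment R f df 0 h h0 (fun s sh => fdf s (H s (subset_itv_oo_cc sh))) (cw _ _ H).
  by exists s; [exact: H|rewrite E subr0].
have H s : s \in `[h, 0] -> `|s| <= `|h|.
  by rewrite in_itv/= => /andP[s0 sh]; rewrite !ler0_norm// ?lerN2// ltW.
have [s sh E] := @MVT_segment R f df h 0 (ltW h0) (fun s sh => fdf s (H s (subset_itv_oo_cc sh))) (cw _ _ H).
by exists s; [exact: H|rewrite -opprB E; ring].
Qed.

Context {n : nat}.
Implicit Types (f : 'rV[R]_n -> R) (y v z : 'rV[R]_n) (i j : 'I_n).

Lemma is_derive_line f y v (t : R) : derivable f (y + t *: v) v ->
  is_derive t (1 : R) (fun s : R => f (y + s *: v)) ('D_v f (y + t *: v)).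
Proof.
move=> dfv.
have E : (fun h : R => h^-1 *: (((fun s : R => f (y + s *: v)) \o shift t) (h *: 1) -
      f (y + t *: v))) =
    (fun h => h^-1 *: ((f \o shift (y + t *: v)) (h *: v) - f (y + t *: v))).
  apply/funext => h /=; congr (_ *: (f _ - _)).
  by rewrite [h%:A]mulr1 scalerDl addrCA.
by apply: DeriveDef; rewrite /derivable /derive E.
Qed.

Lemma mvt_line f y v (h : R) :
  (forall s, `|s| <= `|h| -> derivable f (y + s *: v) v) ->
  exists2 s, `|s| <= `|h| & f (y + h *: v) - f y = 'D_v f (y + s *: v) * h.
Proof.
move=> dfv.
have [s sh] := @mvt_symmetric (fun s : R => f (y + s *: v))
  (fun s => 'D_v f (y + s *: v)) h (fun s sh => is_derive_line (dfv s sh)).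
by rewrite scale0r addr0 => E; exists s.
Qed.

(** The norm on row vectors is the maximum over the coordinates, so balls are boxes. *)
Lemma rV_nbhsP y (P : 'rV[R]_n -> Prop) :
  (\forall z \near y, P z) <->
  exists2 r : R, 0 < r & forall z, (forall i, `|z 0 i - y 0 i| < r) -> P z.
Proof.
split.
  move=> /nbhs_ballP[r /= r0 rP]; exists r => // z zr; apply: rP.
  by split=> // i j; rewrite ord1 /ball/= distrC.
move=> [r r0 rP]; apply/nbhs_ballP; exists r => // z [_ zr]; apply: rP => i.
by have := zr 0 i; rewrite /ball/= distrC.
Qed.

Lemma rV_continuousP f y : {for y, continuous f} <->
  forall e : R, 0 < e -> \forall z \near y, `|f z - f y| < e.
Proof.
split=> [cf e e0|H].
  exact: (@cvgrPdistC_lt _ _ _ (nbhs y) _ f (f y)).1 cf e e0.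
by apply/(@cvgrPdistC_lt _ _ _ (nbhs y) _ f (f y)) => e e0; exact: H.
Qed.

(** Two mean value theorems: along [e_i], for the difference of [f] over the step [s] in direction
    [e_j]; then along [e_j], for [partial i f] at the abscissa found. *)
Lemma second_difference (U : set 'rV[R]_n) f y i j (s : R) : smooth_on U f ->
  (forall a b : R, `|a| <= `|s| -> `|b| <= `|s| -> U (y + a *: 'e_i + b *: 'e_j)) ->
  exists a b : R, [/\ `|a| <= `|s|, `|b| <= `|s| &
    f (y + s *: 'e_i + s *: 'e_j) - f (y + s *: 'e_i) - (f (y + s *: 'e_j) - f y)
    = partial j (partial i f) (y + a *: 'e_i + b *: 'e_j) * s * s].
Proof.
move=> sf inU.
have Ui (a : R) : `|a| <= `|s| -> U (y + a *: 'e_i).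
  by move=> ha; have := inU a 0 ha; rewrite scale0r addr0 normr0; apply.
have Uj (a : R) : `|a| <= `|s| -> U (y + s *: 'e_j + a *: 'e_i).
  by move=> ?; rewrite addrAC; exact: inU.
have [a sa] := @mvt_symmetric
  (fun t => f (y + s *: 'e_j + t *: 'e_i) - f (y + t *: 'e_i))
  (fun t => partial i f (y + s *: 'e_j + t *: 'e_i) - partial i f (y + t *: 'e_i)) s
  (fun t ts => is_deriveB (is_derive_line (smooth_derivable sf (Uj t ts)))
                          (is_derive_line (smooth_derivable sf (Ui t ts)))).
have [b sb E2] := @mvt_line (partial i f) (y + a *: 'e_i) 'e_j s
  (fun t ts => smooth_derivable (smooth_partial i sf) (inU _ _ sa ts)).
rewrite !scale0r !addr0 => E; exists a, b; split=> //.
rewrite /partial -E2 -/(partial i f) [y + a *: _ + s *: _]addrAC.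
move: E; rewrite [y + s *: 'e_j + s *: _]addrAC [y + s *: 'e_j + a *: _]addrAC => E; by rewrite -E.
Qed.

(** The second difference over a small square is symmetric in the two directions, and it is the
    squared side times either mixed derivative at some nearby point. If the mixed derivatives
    differed at [y], continuity would keep these two values apart. *)
Lemma schwarz (U : set 'rV[R]_n) f y i j : open U -> smooth_on U f -> U y ->
  partial i (partial j f) y = partial j (partial i f) y.
Proof.
move=> oU sf Uy; have [->//|ij] := eqVneq i j.
have coord (a b : R) k l : k != l ->
    forall m, `|(y + a *: 'e_k + b *: 'e_l) 0 m - y 0 m| <= Num.max `|a| `|b|.
  move=> kl m; have cancel (p q r : R) : p + q + r - p = q + r by ring.
  rewrite !mxE !eqxx/= cancel le_max.
  have [->|mk] := eqVneq m k; first by rewrite (negbTE kl)/= mulr1 mulr0 addr0 lexx.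
  have [_|_] := eqVneq m l; rewrite /= ?mulr1 mulr0 add0r ?lexx ?orbT//.
  by rewrite mulr0 normr0 normr_ge0.
apply/eqP; rewrite eq_sym -subr_eq0 -normr_eq0; apply/negPn/negP => ne0.
move: ne0; set A := partial j _ _; set B := partial i _ _ => ne0.
have [d dE] : exists d, d = A - B by exists (A - B).
rewrite -dE in ne0.
(* Each mixed derivative stays within half the gap of its value at [y], so a common value would give
   [|d| < |d|]. *)
have d0 : 0 < `|d| / 2 by rewrite divr_gt0// lt_def ne0/=.
have c1 := smooth_continuous (smooth_partial j (smooth_partial i sf)) Uy.
have c2 := smooth_continuous (smooth_partial i (smooth_partial j sf)) Uy.
have [r r0 H] := proj1 (@rV_nbhsP _ _)
  (filterI (open_near oU Uy (fun z Uz => Uz))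
    (filterI (proj1 (@rV_continuousP _ _) c1 _ d0)
             (proj1 (@rV_continuousP _ _) c2 _ d0))).
have sr : `|r / 2| < r by rewrite gtr0_norm ?divr_gt0// ltr_pdivrMr// ltr_pMr// ltr1n.
have inB (a b : R) k l : k != l -> `|a| <= `|r / 2| -> `|b| <= `|r / 2| ->
    forall m, `|(y + a *: 'e_k + b *: 'e_l) 0 m - y 0 m| < r.
  move=> kl ar br m; apply: le_lt_trans (coord a b k l kl m) _.
  by rewrite gt_max (le_lt_trans ar sr) (le_lt_trans br sr).
have ji : j != i by rewrite eq_sym.
have [X H1 E] : exists2 X : R, `|X - A| < `|d| / 2 &
    f (y + r / 2 *: 'e_i + r / 2 *: 'e_j) - f (y + r / 2 *: 'e_i) - (f (y + r / 2 *: 'e_j) - f y)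
    = X * (r / 2) * (r / 2).
  have [a [b [ar br E]]] := @second_difference U f y i j (r / 2) sf
    (fun a b ar br => (H _ (inB a b _ _ ij ar br)).1).
  exists (partial j (partial i f) (y + a *: 'e_i + b *: 'e_j)); last exact: E.
  exact: (H _ (inB _ _ _ _ ij ar br)).2.1.
have [Y H2 E'] : exists2 Y : R, `|Y - B| < `|d| / 2 &
    f (y + r / 2 *: 'e_j + r / 2 *: 'e_i) - f (y + r / 2 *: 'e_j) - (f (y + r / 2 *: 'e_i) - f y)
    = Y * (r / 2) * (r / 2).
  have [a [b [ar br E']]] := @second_difference U f y j i (r / 2) sf
    (fun a b ar br => (H _ (inB a b _ _ ji ar br)).1).
  exists (partial i (partial j f) (y + a *: 'e_j + b *: 'e_i)); last exact: E'.
  exact: (H _ (inB _ _ _ _ ji ar br)).2.2.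
have r2 : r / 2 != 0 by rewrite mulf_neq0// gt_eqF.
have XY : X = Y.
  have cancel (p q d1 d2 t : R) : t != 0 -> d1 = p * t * t -> d2 = q * t * t ->
      d1 = d2 -> p = q by move=> t0 -> -> /(mulIf t0)/(mulIf t0).
  apply: (cancel _ _ _ _ _ r2 E E').
  rewrite [y + r / 2 *: 'e_j + _]addrAC.
  have swap (p q u v : R) : p - q - (u - v) = p - u - (q - v) by ring.
  exact: swap.
rewrite XY in H1.
rewrite distrC in H1.
suff : `|d| < `|d| by rewrite ltxx.
rewrite {2}[`|d|]splitr; apply: le_lt_trans (ltrD H1 H2).
by apply: le_trans _ (ler_normD _ _); rewrite addrA subrK dE.
Qed.

End MeanValue.

(** * Differentiability in the plane and the chain rule *)

Section Differentiability.
Context {R : realType}.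

Definition dot_row (n : nat) (a : 'I_n -> R) (h : 'rV[R]_n) : R :=
  \sum_i h 0 i * a i.

Lemma dot_row_is_linear n (a : 'I_n -> R) : linear (dot_row a).
Proof.
move=> k u v; rewrite /dot_row scaler_sumr -big_split/=; apply: eq_bigr => i _.
by rewrite !mxE mulrDl -mulrA.
Qed.

HB.instance Definition _ n (a : 'I_n -> R) :=
  GRing.isLinear.Build R 'rV[R]_n R _ (dot_row a) (dot_row_is_linear a).

Lemma dot_row_continuous n (a : 'I_n -> R) : continuous (dot_row a).
Proof.
move=> x; apply: differentiable_continuous.
have -> : (dot_row a : _ -> R) = \sum_i (fun h : 'rV[R]_n => h 0 i * a i).
  by apply/funext => h; rewrite fct_sumE.
apply: differentiable_sum => i; apply: differentiableM; first exact: differentiable_coord.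
exact: differentiable_cst.
Qed.

Lemma rV_norm_coord n (h : 'rV[R]_n) i : `|h 0 i| <= `|h|.
Proof. by rewrite {2}/Num.Def.normr/= mx_normrE; exact: (le_bigmax _ _ (0, i)). Qed.

Lemma sum2E (V : nmodType) (F : 'I_2 -> V) : \sum_i F i = F 0 + F 1.
Proof.
rewrite big_ord_recl big_ord1; congr (_ + F _); exact: val_inj.
Qed.

Lemma rV2E (h : 'rV[R]_2) : h = h 0 0 *: 'e_0 + h 0 1 *: 'e_1.
Proof.
apply/rowP => i; rewrite !mxE eqxx/=.
case: i => [[|[|i]] Hi]//=; rewrite ?mulr1 ?mulr0 ?addr0 ?add0r.
  by congr (h _ _); apply: val_inj.
by congr (h _ _); apply: val_inj.
Qed.

Lemma is_diff_expansion (V W : normedModType R) (f : V -> W)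
  (df : {linear V -> W}) x : continuous df ->
  f \o shift x = cst (f x) + df +o_ 0 id -> is_diff x f df.
Proof.
move=> cdf E; have D : 'd f x = df :> (_ -> _) by exact: diff_unique.
by apply: DiffDef => //; apply/diff_locallyP; rewrite D.
Qed.

(** The way from [y] to [h + y] follows two coordinate segments; the mean value theorem on each,
    with continuity of the partial derivatives, bounds the remainder. The plane suffices because
    coordinates are changed only on the surface [Sigma]. *)
Lemma smooth_is_diff (U : set 'rV[R]_2) (f : 'rV[R]_2 -> R) y :
  open U -> smooth_on U f -> U y ->
  is_diff y f (dot_row (fun i => partial i f y)).
Proof.
move=> oU sf Uy; 
refine (@is_diff_expansion 'rV[R]_2 R f (dot_row (fun i => partial i f y)) y _ _); first exact: dot_row_continuous.
apply/eqaddoP => e e0.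
have e2 : 0 < e / 2 by rewrite divr_gt0.
have c0 := smooth_continuous (smooth_partial 0 sf) Uy.
have c1 := smooth_continuous (smooth_partial 1 sf) Uy.
have [r r0 H] := proj1 (@rV_nbhsP _ _ _ _)
  (filterI (open_near oU Uy (fun z Uz => Uz))
    (filterI (proj1 (@rV_continuousP _ _ _ _) c0 _ e2)
             (proj1 (@rV_continuousP _ _ _ _) c1 _ e2))).
have {}H (a b : R) : `|a| < r -> `|b| < r -> let z := y + a *: 'e_0 + b *: 'e_1 in
   [/\ U z, `|partial 0 f z - partial 0 f y| < e / 2 & `|partial 1 f z - partial 1 f y| < e / 2].
  move=> ar br z; have [i|? []] := H z; last by split.
  rewrite /z !mxE eqxx/=; case: i => [[|[|i]] Hi]//=; rewrite ?mulr1 ?mulr0 ?addr0.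
    by rewrite addrAC subrr add0r.
  by rewrite addrAC subrr add0r.
have H0 : forall a : R, `|a| < r -> let z := y + a *: 'e_0 in
    [/\ U z, `|partial 0 f z - partial 0 f y| < e / 2 & `|partial 1 f z - partial 1 f y| < e / 2].
  by move=> a ar; have := H a 0 ar; rewrite normr0 scale0r addr0; apply.
apply/rV_nbhsP; exists r => // h hr.
have {}hr i : `|h 0 i| < r by have := hr i; rewrite mxE subr0.
have [a ah Ea] := @mvt_line _ _ f y 'e_0 (h 0 0) (fun s sh =>
  smooth_derivable sf (let: And3 U0 _ _ := H0 s (le_lt_trans sh (hr 0)) in U0)).
have [b bh Eb] := @mvt_line _ _ f (y + h 0 0 *: 'e_0) 'e_1 (h 0 1) (fun s sh =>
  smooth_derivable sf (let: And3 U0 _ _ := H _ _ (hr 0) (le_lt_trans sh (hr 1)) in U0)).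
have [_ P0 _] := H0 _ (le_lt_trans ah (hr 0)).
have [_ _ P1] := H _ _ (hr 0) (le_lt_trans bh (hr 1)).
rewrite -/(partial _ _ _) in Ea; rewrite -/(partial _ _ _) in Eb.
have dfE : dot_row (fun i => partial i f y) h = h 0 0 * partial 0 f y + h 0 1 * partial 1 f y.
  by rewrite /dot_row sum2E.
rewrite -[X in `|X|]/(f (h + y) - (f y + dot_row (fun i => partial i f y) h)).
have -> : f (h + y) - (f y + dot_row (fun i => partial i f y) h) =
   (partial 0 f (y + a *: 'e_0) - partial 0 f y) * h 0 0 +
   (partial 1 f (y + h 0 0 *: 'e_0 + b *: 'e_1) - partial 1 f y) * h 0 1.
  rewrite [h + y]addrC {1}[h]rV2E addrA dfE.
  have alg (F2 F1 F0 A B A0 B0 x z : R) : F1 - F0 = A * x -> F2 - F1 = B * z ->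
      F2 - (F0 + (x * A0 + z * B0)) = (A - A0) * x + (B - B0) * z.
    by move=> E1 E2; rewrite !mulrBl -E1 -E2; ring.
  exact: alg Ea Eb.
apply: le_trans (ler_normD _ _) _; rewrite !normrM [e]splitr mulrDl.
apply: lerD.
  exact: (ler_pM (normr_ge0 _) (normr_ge0 _) (ltW P0) (rV_norm_coord h 0)).
exact: (ler_pM (normr_ge0 _) (normr_ge0 _) (ltW P1) (rV_norm_coord h 1)).
Qed.

End Differentiability.

Section ChainRule.
Context {R : realType}.
Variables (U : set 'rV[R]_2) (t : 'rV[R]_2 -> 'rV[R]_2) (y : 'rV[R]_2).
Hypotheses (oU : open U) (Uy : U y).
Hypothesis st : forall k, smooth_on U (fun z => t z 0 k).

Lemma smooth_map_differentiable : differentiable t y.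
Proof.
have -> : t = \sum_k (fun z => t z 0 k *: ('e_k : 'rV[R]_2)).
  apply/funext => z; rewrite fct_sumE; exact: row_sum_delta.
apply: differentiable_sum => k; apply: differentiableZl.
exact: (@ex_diff _ _ _ _ _ _ _ (smooth_is_diff oU (st k) Uy)).
Qed.

Lemma jacobianE : 'J t y = \matrix_(i, k) partial i (fun z => t z 0 k) y.
Proof.
apply/row_matrixP => i; rewrite rowE -(deriveEjacobian _ smooth_map_differentiable).
rewrite derive_mx; last exact/diff_derivable/smooth_map_differentiable.
by apply/rowP => k; rewrite !mxE.
Qed.

Lemma partial_comp (V : set 'rV[R]_2) (f : 'rV[R]_2 -> R) i :
  open V -> smooth_on V f -> V (t y) ->
  partial i (fun z => f (t z)) y = \sum_k 'J t y i k * partial k f (t y).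
Proof.
move=> oV sf Vt; have df := smooth_is_diff oV sf Vt.
have dt := smooth_map_differentiable.
have dff : differentiable f (t y) by case: df.
have dft : differentiable (f \o t) y by exact: differentiable_comp.
rewrite /partial -[fun z => f (t z)]/(f \o t) (deriveE _ dft).
rewrite diff_comp//.
rewrite (@diff_val _ _ _ _ _ _ _ df) /= /dot_row; apply: eq_bigr => k _.
by congr (_ * _); rewrite -(deriveE _ dt) deriveEjacobian// -rowE mxE.
Qed.

End ChainRule.

(** * Functions pulled back from a factor of a product *)

Section Submatrices.
Context {R : realType} {m n : nat}.
Implicit Types (y : 'rV[R]_(m + n)).

Lemma derive_lsubmx (f : 'rV[R]_m -> R) y v :
  'D_v (fun z => f (lsubmx z)) y = 'D_(lsubmx v) f (lsubmx y).
Proof.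
rewrite /derive; set g1 := fun h => _; set g2 := fun h => _.
by suff -> : g1 = g2 by []; apply/funext => h; rewrite /g1 /= (_ : lsubmx (h *: v + y) = h *: lsubmx v + lsubmx y)// linearD linearZ.
Qed.

Lemma derivable_lsubmx (f : 'rV[R]_m -> R) y v :
  derivable (fun z => f (lsubmx z)) y v = derivable f (lsubmx y) (lsubmx v).
Proof.
rewrite /derivable; set g1 := fun h => _; set g2 := fun h => _.
by suff -> : g1 = g2 by []; apply/funext => h; rewrite /g1 /= (_ : lsubmx (h *: v + y) = h *: lsubmx v + lsubmx y)// linearD linearZ.
Qed.

Lemma derive_rsubmx (f : 'rV[R]_n -> R) y v :
  'D_v (fun z => f (rsubmx z)) y = 'D_(rsubmx v) f (rsubmx y).
Proof.
rewrite /derive; set g1 := fun h => _; set g2 := fun h => _.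
by suff -> : g1 = g2 by []; apply/funext => h; rewrite /g1 /= (_ : rsubmx (h *: v + y) = h *: rsubmx v + rsubmx y)// linearD linearZ.
Qed.

Lemma derivable_rsubmx (f : 'rV[R]_n -> R) y v :
  derivable (fun z => f (rsubmx z)) y v = derivable f (rsubmx y) (rsubmx v).
Proof.
rewrite /derivable; set g1 := fun h => _; set g2 := fun h => _.
by suff -> : g1 = g2 by []; apply/funext => h; rewrite /g1 /= (_ : rsubmx (h *: v + y) = h *: rsubmx v + rsubmx y)// linearD linearZ.
Qed.

Lemma lsubmx_e_lshift (i : 'I_m) : lsubmx ('e_(lshift n i) : 'rV[R]_(m + n)) = 'e_i.
Proof. by apply/rowP => j; rewrite !mxE eq_lshift. Qed.

Lemma lsubmx_e_rshift (i : 'I_n) : lsubmx ('e_(rshift m i) : 'rV[R]_(m + n)) = 0.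
Proof. by apply/rowP => j; rewrite !mxE eq_lrshift andbF. Qed.

Lemma rsubmx_e_rshift (i : 'I_n) : rsubmx ('e_(rshift m i) : 'rV[R]_(m + n)) = 'e_i.
Proof. by apply/rowP => j; rewrite !mxE eq_rshift. Qed.

Lemma rsubmx_e_lshift (i : 'I_m) : rsubmx ('e_(lshift n i) : 'rV[R]_(m + n)) = 0.
Proof. by apply/rowP => j; rewrite !mxE eq_rlshift andbF. Qed.

Lemma partial_lsubmx_l (f : 'rV[R]_m -> R) i :
  partial (lshift n i) (fun z : 'rV[R]_(m + n) => f (lsubmx z)) = fun z => partial i f (lsubmx z).
Proof. by apply/funext => y; rewrite /partial derive_lsubmx lsubmx_e_lshift. Qed.

Lemma partial_lsubmx_r (f : 'rV[R]_m -> R) i :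
  partial (rshift m i) (fun z : 'rV[R]_(m + n) => f (lsubmx z)) = fun=> 0.
Proof. by apply/funext => y; rewrite /partial derive_lsubmx lsubmx_e_rshift derive0. Qed.

Lemma partial_rsubmx_r (f : 'rV[R]_n -> R) i :
  partial (rshift m i) (fun z : 'rV[R]_(m + n) => f (rsubmx z)) = fun z => partial i f (rsubmx z).
Proof. by apply/funext => y; rewrite /partial derive_rsubmx rsubmx_e_rshift. Qed.

Lemma partial_rsubmx_l (f : 'rV[R]_n -> R) i :
  partial (lshift n i) (fun z : 'rV[R]_(m + n) => f (rsubmx z)) = fun=> 0.
Proof. by apply/funext => y; rewrite /partial derive_rsubmx rsubmx_e_lshift derive0. Qed.

Lemma smooth_lsubmx (U : set 'rV[R]_m) (f : 'rV[R]_m -> R) : smooth_on U f ->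
  smooth_on [set z : 'rV[R]_(m + n) | U (lsubmx z)] (fun z => f (lsubmx z)).
Proof.
move=> sf k; elim: k f sf => [|k IH] f sf /=.
  move=> y Uy; apply: (@continuous_comp _ _ _ lsubmx f).
    exact: continuous_lsubmx.
  exact: smooth_continuous sf Uy.
split=> [y i Uy|i]; case: (split_ordP i) => j ->.
- by rewrite derivable_lsubmx lsubmx_e_lshift; exact: smooth_derivable sf Uy.
- by rewrite derivable_lsubmx lsubmx_e_rshift; exact: derivable0.
- by rewrite partial_lsubmx_l; apply: IH; exact: smooth_partial.
- by rewrite partial_lsubmx_r; exact: smooth_cst.
Qed.

Lemma smooth_rsubmx (U : set 'rV[R]_n) (f : 'rV[R]_n -> R) : smooth_on U f ->
  smooth_on [set z : 'rV[R]_(m + n) | U (rsubmx z)] (fun z => f (rsubmx z)).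
Proof.
move=> sf k; elim: k f sf => [|k IH] f sf /=.
  move=> y Uy; apply: (@continuous_comp _ _ _ rsubmx f).
    exact: continuous_rsubmx.
  exact: smooth_continuous sf Uy.
split=> [y i Uy|i]; case: (split_ordP i) => j ->.
- by rewrite derivable_rsubmx rsubmx_e_lshift; exact: derivable0.
- by rewrite derivable_rsubmx rsubmx_e_rshift; exact: smooth_derivable sf Uy.
- by rewrite partial_rsubmx_l; exact: smooth_cst.
- by rewrite partial_rsubmx_r; apply: IH; exact: smooth_partial.
Qed.

End Submatrices.

(** * Curvature of conformal and product metrics *)

#[local] Opaque partial invmx.

Section Contraction.
Context {R : realType} {n : nat}.
Implicit Types (P : 'M[R]_n) (a b c : 'I_n -> R).

(** With [P] the inverse metric this is the inner product of covectors; with [P] a Hessian it is its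
    value on two vectors. *)
Definition pairing P a b : R := \sum_p \sum_q P p q * a p * b q.

Lemma pairingC P a b : P^T = P -> pairing P a b = pairing P b a.
Proof.
move=> sP; rewrite /pairing exchange_big/=; apply: eq_bigr => p _.
by apply: eq_bigr => q _; rewrite -{1}sP mxE; ring.
Qed.

Lemma pairingDl P a b c : pairing P (fun p => a p + b p) c = pairing P a c + pairing P b c.
Proof.
rewrite -big_split/=; apply: eq_bigr => p _; rewrite -big_split/=.
by apply: eq_bigr => q _; ring.
Qed.

Lemma pairingZl P k a c : pairing P (fun p => k * a p) c = k * pairing P a c.
Proof.
rewrite mulr_sumr; apply: eq_bigr => p _; rewrite mulr_sumr.
by apply: eq_bigr => q _; ring.
Qed.

Lemma pairingDr P a b c : pairing P c (fun p => a p + b p) = pairing P c a + pairing P c b.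
Proof.
rewrite -big_split/=; apply: eq_bigr => p _; rewrite -big_split/=.
by apply: eq_bigr => q _; ring.
Qed.

Lemma pairingZr P k a c : pairing P c (fun p => k * a p) = k * pairing P c a.
Proof.
rewrite mulr_sumr; apply: eq_bigr => p _; rewrite mulr_sumr.
by apply: eq_bigr => q _; ring.
Qed.

(** The combination has the shape of the Christoffel symbols of a rescaled metric in
    [christoffel1_scale]. *)
Lemma pairing_comb4l P (x t a1 a2 a3 : R) c g1 g2 d b :
  pairing P (fun p => x * c p + t * (a1 * g1 p + (a2 * g2 p + a3 * d p))) b =
  x * pairing P c b + t * (a1 * pairing P g1 b + (a2 * pairing P g2 b + a3 * pairing P d b)).
Proof. by rewrite pairingDl !pairingZl pairingDl pairingDl !pairingZl. Qed.

Lemma pairing_comb4r P (x t a1 a2 a3 : R) c g1 g2 d b :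
  pairing P b (fun p => x * c p + t * (a1 * g1 p + (a2 * g2 p + a3 * d p))) =
  x * pairing P b c + t * (a1 * pairing P b g1 + (a2 * pairing P b g2 + a3 * pairing P b d)).
Proof. by rewrite pairingDr !pairingZr pairingDr pairingDr !pairingZr. Qed.

Lemma pairingZ P k a b : pairing (k *: P) a b = k * pairing P a b.
Proof.
rewrite mulr_sumr; apply: eq_bigr => p _; rewrite mulr_sumr.
by apply: eq_bigr => q _; rewrite mxE; ring.
Qed.

Lemma invmx_sym (G : 'M[R]_n) : G^T = G -> (invmx G)^T = invmx G.
Proof. by move=> sG; rewrite trmx_inv sG. Qed.

Lemma pairing_metric (G : 'M[R]_n) b k : G \in unitmx -> G^T = G ->
  pairing (invmx G) (fun p => G k p) b = b k.
Proof.
move=> uG sG; rewrite /pairing exchange_big/=.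
rewrite (eq_bigr (fun q => (G *m invmx G) k q * b q)) => [|q _].
  rewrite mulmxV// (bigD1 k)//= mxE eqxx mul1r big1 ?addr0// => i ik.
  by rewrite mxE eq_sym (negbTE ik) mul0r.
by rewrite mxE mulr_suml; apply: eq_bigr => p _; rewrite [_ * G _ _]mulrC.
Qed.

End Contraction.

(** * Christoffel symbols and the covariant curvature tensor *)

Section LocalMetric.
Context {R : realType} {n : nat}.

(** Recording invertibility in place of positivity makes the class stable under multiplication by
    any function without zeros. *)
Record smooth_metric (U : set 'rV[R]_n) (G : 'rV[R]_n -> 'M[R]_n) : Prop := SmoothMetric {
  smet_open : open U;
  smet_smooth : forall i j, smooth_on U (fun z => G z i j);
  smet_sym : forall y, U y -> (G y)^T = G y;
  smet_unit : forall y, U y -> G y \in unitmx }.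

(** Christoffel symbols of the first kind, with the lowered index in front. They do not contain the
    inverse metric, so its derivatives never have to be computed. *)
Definition christoffel1 (G : 'rV[R]_n -> 'M[R]_n) (k i j : 'I_n) (z : 'rV[R]_n) : R :=
  2^-1 * (partial i (fun w => G w j k) z + partial j (fun w => G w i k) z
          - partial k (fun w => G w i j) z).

Lemma christoffelE G k i j z :
  christoffel G k i j z = \sum_l invmx (G z) k l * christoffel1 G l i j z.
Proof.
rewrite /christoffel mulr_sumr; apply: eq_bigr => l _; rewrite /christoffel1; ring.
Qed.

Variables (U : set 'rV[R]_n) (G : 'rV[R]_n -> 'M[R]_n) (mG : smooth_metric U G).
Let oU := smet_open mG.

Lemma metric_symE z i j : U z -> G z i j = G z j i.
Proof. by move=> /(smet_sym mG) E; rewrite -{1}E mxE. Qed.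

Lemma partial_metric_sym k z i j : U z ->
  partial k (fun w => G w i j) z = partial k (fun w => G w j i) z.
Proof.
move=> Uz; apply: partial_eq_near; apply: (open_near oU Uz) => w Uw.
exact: metric_symE.
Qed.

Lemma christoffel1C k i j z : U z -> christoffel1 G k i j z = christoffel1 G k j i z.
Proof.
move=> Uz; rewrite /christoffel1 (partial_metric_sym k i j Uz).
by rewrite [X in _ * (X - _)]addrC.
Qed.

Lemma christoffelC k i j z : U z -> christoffel G k i j z = christoffel G k j i z.
Proof.
by move=> Uz; rewrite !christoffelE; apply: eq_bigr => l _; rewrite christoffel1C.
Qed.

Lemma smooth_christoffel1 k i j : smooth_on U (christoffel1 G k i j).
Proof.
by apply: smoothZ => //; apply: smoothB => //; [apply: smoothD => //|];
  apply: smooth_partial; exact: smet_smooth mG _ _.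
Qed.

Lemma smooth_christoffel k i j : smooth_on U (christoffel G k i j).
Proof.
apply: (@smooth_eq _ _ _ (fun z => \sum_l invmx (G z) k l * christoffel1 G l i j z)) => //.
  by move=> y _; rewrite christoffelE.
apply: smooth_sum => // l; apply: smoothM => //.
  by apply: smooth_invmx => //; [exact: smet_smooth mG|exact: smet_unit mG].
exact: smooth_christoffel1.
Qed.

Lemma lower_christoffel k i j z : U z ->
  \sum_m G z k m * christoffel G m i j z = christoffel1 G k i j z.
Proof.
move=> Uz; rewrite -(pairing_metric (christoffel1 G ^~ i ^~ j ^~ z) k (smet_unit mG Uz) (smet_sym mG Uz)).
apply: eq_bigr => p _; rewrite christoffelE mulr_sumr.
by apply: eq_bigr => q _; ring.
Qed.

(** Compatibility of the Levi-Civita connection with the metric. *)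
Lemma partial_metric i k m z : U z ->
  partial i (fun w => G w k m) z = christoffel1 G k i m z + christoffel1 G m i k z.
Proof.
move=> Uz; rewrite /christoffel1 (partial_metric_sym i m k Uz).
by move: (partial i _ z) (partial m _ z) (partial k _ z) => p q r; field.
Qed.

Lemma pairing_christoffel i k b z : U z ->
  \sum_p christoffel G p i k z * b p =
  pairing (invmx (G z)) (christoffel1 G ^~ i ^~ k ^~ z) b.
Proof.
move=> Uz; rewrite /pairing exchange_big/=; apply: eq_bigr => p _.
rewrite christoffelE mulr_suml; apply: eq_bigr => q _.
have /matrixP/(_ p q) := invmx_sym (smet_sym mG Uz).
by rewrite mxE => ->; ring.
Qed.

(** The metric is taken under the derivative of the symbols by the product rule; the derivative of
    the metric produced in this way combines with the quadratic terms and reverses their sign. *)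
Lemma riemann_christoffel1 i j k l y : U y ->
  riemann G y i j k l =
  partial i (christoffel1 G k j l) y - partial j (christoffel1 G k i l) y
  - pairing (invmx (G y)) (christoffel1 G ^~ i ^~ k ^~ y) (christoffel1 G ^~ j ^~ l ^~ y)
  + pairing (invmx (G y)) (christoffel1 G ^~ j ^~ k ^~ y) (christoffel1 G ^~ i ^~ l ^~ y).
Proof.
move=> Uy.
have D i' j' l' : \sum_m G y k m * partial i' (christoffel G m j' l') y =
    partial i' (christoffel1 G k j' l') y
    - \sum_m partial i' (fun w => G w k m) y * christoffel G m j' l' y.
  apply/eqP; rewrite eq_sym subr_eq -big_split/= eq_sym; apply/eqP.
  rewrite [RHS](_ : _ = partial i' (fun z => \sum_m G z k m * christoffel G m j' l' z) y).
    rewrite partial_sum => [|m]; last first.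
      apply: derivableM; first exact: smooth_derivable (smet_smooth mG _ _) Uy.
      exact: smooth_derivable (smooth_christoffel _ _ _) Uy.
    apply: eq_bigr => m _; rewrite partialM//.
      by rewrite addrC.
    exact: smooth_derivable (smet_smooth mG _ _) Uy.
    exact: smooth_derivable (smooth_christoffel _ _ _) Uy.
  apply: partial_eq_near; apply: (open_near oU Uy) => z Uz.
  by rewrite lower_christoffel.
have Q i' j' l' : \sum_m G y k m * \sum_p christoffel G m i' p y * christoffel G p j' l' y
   = \sum_p christoffel1 G k i' p y * christoffel G p j' l' y.
  rewrite (eq_bigr (fun m => \sum_p G y k m * (christoffel G m i' p y * christoffel G p j' l' y))) => [|m _]; last by rewrite mulr_sumr.
  rewrite exchange_big/=; apply: eq_bigr => p _.
  rewrite -(lower_christoffel k i' p Uy) mulr_suml; apply: eq_bigr => m _; ring.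
(* By [partial_metric] the derivative of the metric is a sum of two symbols, one of which cancels
   the quadratic term; the other one remains with a minus sign. *)
have C i' j' l' : \sum_p christoffel1 G k i' p y * christoffel G p j' l' y
    - \sum_m partial i' (fun w => G w k m) y * christoffel G m j' l' y =
    - pairing (invmx (G y)) (christoffel1 G ^~ i' ^~ k ^~ y) (christoffel1 G ^~ j' ^~ l' ^~ y).
  rewrite (pairingC _ _ (invmx_sym (smet_sym mG Uy))) -pairing_christoffel//.
  rewrite -sumrB -sumrN; apply: eq_bigr => p _; rewrite partial_metric//; ring.
have S : riemann G y i j k l =
    \sum_m G y k m * partial i (christoffel G m j l) y
    - \sum_m G y k m * partial j (christoffel G m i l) y
    + (\sum_m G y k m * (\sum_p christoffel G m i p y * christoffel G p j l y)
       - \sum_m G y k m * (\sum_p christoffel G m j p y * christoffel G p i l y)).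
  rewrite /riemann -!sumrB -big_split/=; apply: eq_bigr => m _.
  by rewrite sumrB mulrDr !mulrBr.
have alg (a b c d e f p q x y' : R) : x = a - b -> y' = c - d ->
    e - b = - p -> f - d = - q -> x - y' + (e - f) = a - c - p + q.
  by move=> -> -> E1 E2; rewrite -[q]opprK -E2 -E1; ring.
rewrite S; apply: (alg _ _ _ _ _ _ _ _ _ _ (D i j l) (D j i l)); rewrite Q; exact: C.
Qed.

Lemma partial_christoffel1 i k j l y : U y ->
  partial i (christoffel1 G k j l) y =
  2^-1 * (partial i (partial j (fun w => G w l k)) y
          + partial i (partial l (fun w => G w j k)) y
          - partial i (partial k (fun w => G w j l)) y).
Proof.
move=> Uy; have d a b c : derivable (partial a (fun w => G w b c)) y 'e_i.
  exact: smooth_derivable (smooth_partial _ (smet_smooth mG _ _)) Uy.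
rewrite /christoffel1 partialZ; last first.
  apply: derivableB => //; exact: derivableD.
rewrite partialB//; last exact: derivableD.
by rewrite partialD.
Qed.

(** Of the six second derivatives, two are the mixed derivatives of the same entry in opposite order
    and cancel by [schwarz]. *)
Lemma riemannE i j k l y : U y ->
  riemann G y i j k l =
  2^-1 * (partial i (partial l (fun w => G w j k)) y
          - partial i (partial k (fun w => G w j l)) y
          - partial j (partial l (fun w => G w i k)) y
          + partial j (partial k (fun w => G w i l)) y)
  - pairing (invmx (G y)) (christoffel1 G ^~ i ^~ k ^~ y) (christoffel1 G ^~ j ^~ l ^~ y)
  + pairing (invmx (G y)) (christoffel1 G ^~ j ^~ k ^~ y) (christoffel1 G ^~ i ^~ l ^~ y).
Proof.
move=> Uy; rewrite riemann_christoffel1// !partial_christoffel1//.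
have alg (a b c d e f p q : R) : a = d -> 2^-1 * (a + b - c) - 2^-1 * (d + e - f) - p + q
    = 2^-1 * (b - c - e + f) - p + q by move=> ->; ring.
by apply: alg; exact: schwarz oU (smet_smooth mG l k) Uy.
Qed.

End LocalMetric.

#[local] Transparent partial invmx.

(** The quadratic part of the conformal change of curvature, kept apart because here the inverse
    metric meets the metric and has to be contracted by [pairing_metric] before the rest becomes
    rational algebra. *)
Lemma pairing_scale {R : realType} {n : nat} (c1 c2 d : 'I_n -> R)
    (G : 'M[R]_n) (v : R) i k j l :
  G \in unitmx -> G^T = G -> v != 0 ->
  pairing (v^-1 *: invmx G)
    (fun p => v * c1 p + 2^-1 * (d i * G k p + (d k * G i p + - G i k * d p)))
    (fun p => v * c2 p + 2^-1 * (d j * G l p + (d l * G j p + - G j l * d p))) =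
  v * pairing (invmx G) c1 c2
  + 2^-1 * (d i * c2 k + d k * c2 i - G i k * pairing (invmx G) c2 d)
  + 2^-1 * (d j * c1 l + d l * c1 j - G j l * pairing (invmx G) c1 d)
  + (4 * v)^-1 *
    (d i * d j * G k l + d i * d l * G k j + d k * d j * G i l + d k * d l * G i j
     - 2 * d i * d k * G j l - 2 * G i k * d j * d l
     + G i k * G j l * pairing (invmx G) d d).
Proof.
move=> uG sG v0; have sP := invmx_sym sG.
rewrite pairingZ pairing_comb4l !pairing_comb4r.
have gl k' b : pairing (invmx G) (fun p => G k' p) b = b k' by exact: pairing_metric.
have gr k' b : pairing (invmx G) b (fun p => G k' p) = b k' by rewrite pairingC.
have symG a b : G a b = G b a by rewrite -{1}sG mxE.
rewrite !gl !gr (pairingC d c2 sP) (symG l k) (symG l i) (symG j k) (symG j i).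
move: (pairing _ _ _) (pairing _ _ _) (pairing _ _ _) (pairing _ _ _) => q1 q2 q3 q4.
move: (c1 _) (c1 _) (c2 _) (c2 _) (d _) (d _) (d _) (d _) => *.
move: (G _ _) (G _ _) (G _ _) (G _ _) (G _ _) (G _ _) => *.
by field.
Qed.

(** * Conformal change of the metric *)

Section Conformal.
Context {R : realType} {n : nat}.
Variables (U : set 'rV[R]_n) (G : 'rV[R]_n -> 'M[R]_n) (mG : smooth_metric U G).
Variables (u : 'rV[R]_n -> R) (su : smooth_on U u) (u0 : forall y, U y -> u y != 0).
Let oU := smet_open mG.
Let sG := smet_smooth mG.

Lemma smooth_metric_scale : smooth_metric U (fun z => u z *: G z).
Proof.
split=> // [i j|y Uy|y Uy].
- by apply: smooth_eq (smoothM oU su (sG i j)) => // z _; rewrite mxE.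
- by rewrite linearZ/= (smet_sym mG).
- by have := smet_unit mG Uy; rewrite !unitmxE detZ !unitfE mulf_eq0 negb_or expf_neq0 ?u0.
Qed.

Lemma scale_entry (z : 'rV[R]_n -> R) i j :
  (fun w => (z w *: G w) i j) = (fun w => z w * G w i j).
Proof. by apply/funext => w; rewrite mxE. Qed.

Lemma partial_scale a i j y : U y ->
  partial a (fun w => u w * G w i j) y =
  partial a u y * G y i j + u y * (christoffel1 G i a j y + christoffel1 G j a i y).
Proof.
move=> Uy; rewrite partialM; first by rewrite (partial_metric mG).
  exact: smooth_derivable su Uy.
exact: smooth_derivable (sG _ _) Uy.
Qed.

Lemma christoffel1_scale k i j y : U y ->
  christoffel1 (fun z => u z *: G z) k i j y =
  u y * christoffel1 G k i j y +
  2^-1 * (partial i u y * G y j k + (partial j u y * G y i k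
          + - G y i j * partial k u y)).
Proof.
move=> Uy; rewrite {1}/christoffel1 !scale_entry !partial_scale//.
rewrite !(christoffel1C mG k j i Uy) !(christoffel1C mG j k i Uy) !(christoffel1C mG i k j Uy).
by move: (partial _ _ _) (partial _ _ _) (partial _ _ _) (christoffel1 _ _ _ _ _)
  (christoffel1 _ _ _ _ _) (christoffel1 _ _ _ _ _) => *; field.
Qed.

Lemma partial2_scale a b i j y : U y ->
  partial a (partial b (fun w => u w * G w i j)) y =
  partial a (partial b u) y * G y i j
  + partial b u y * (christoffel1 G i a j y + christoffel1 G j a i y)
  + partial a u y * (christoffel1 G i b j y + christoffel1 G j b i y)
  + u y * partial a (partial b (fun w => G w i j)) y.
Proof.
move=> Uy.
have du c : derivable u y 'e_c by exact: smooth_derivable su Uy.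
have dG c : derivable (fun w => G w i j) y 'e_c by exact: smooth_derivable (sG _ _) Uy.
have ddu c : derivable (partial b u) y 'e_c by exact: smooth_derivable (smooth_partial _ su) Uy.
have ddG c : derivable (partial b (fun w => G w i j)) y 'e_c.
  exact: smooth_derivable (smooth_partial _ (sG _ _)) Uy.
rewrite (_ : partial a _ y =
   partial a (fun w => partial b u w * G w i j + u w * partial b (fun w => G w i j) w) y).
  rewrite partialD; [|exact: derivableM|exact: derivableM].
  by rewrite !partialM// -!(partial_metric mG)// !addrA.
apply: partial_eq_near; apply: (open_near oU Uy) => z Uz.
rewrite partialM//; first exact: smooth_derivable su Uz.
exact: smooth_derivable (sG _ _) Uz.
Qed.

Lemma invmx_scale y : U y -> invmx (u y *: G y) = (u y)^-1 *: invmx (G y).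
Proof.
move=> Uy; have uG := smet_unit smooth_metric_scale Uy; exact: (invmxZ uG).
Qed.

Definition grad_form (f h : 'rV[R]_n -> R) (y : 'rV[R]_n) : R :=
  pairing (invmx (G y)) (partial ^~ f ^~ y) (partial ^~ h ^~ y).

(** With [w = (log u) / 2] this is [- u] times the classical form [Hess w - dw dw + |dw|^2 g / 2];
    written in [u] itself it involves no logarithm. *)
Definition conformal_term (y : 'rV[R]_n) : 'M[R]_n :=
  - 2^-1 *: hessian G y u
  + (3 / 4 / u y) *: (\matrix_(j, l) (partial j u y * partial l u y))
  - (8^-1 * grad_form u u y / u y) *: G y.

Lemma hessian_grad_form (f : 'rV[R]_n -> R) i j y : U y ->
  hessian G y f i j = partial i (partial j f) y
   - pairing (invmx (G y)) (christoffel1 G ^~ i ^~ j ^~ y) (partial ^~ f ^~ y).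
Proof. by move=> Uy; rewrite mxE -(pairing_christoffel mG). Qed.

(** After expansion by [riemannE] the second derivatives of [G] match on both sides, and what is
    left is a rational identity in [u], its derivatives, the metric and its Christoffel symbols. *)
Lemma riemann_conformal i j k l y : U y ->
  riemann (fun z => u z *: G z) y i j k l =
  u y * riemann G y i j k l
  + (G y i k * conformal_term y j l + G y j l * conformal_term y i k
     - G y i l * conformal_term y j k - G y j k * conformal_term y i l).
Proof.
move=> Uy.
have uG := smet_unit mG Uy; have syG := smet_sym mG Uy.
have EA a b : conformal_term y a b = - 2^-1 * (partial a (partial b u) y
     - pairing (invmx (G y)) (christoffel1 G ^~ a ^~ b ^~ y) (partial ^~ u ^~ y))
     + 3 / 4 / u y * (partial a u y * partial b u y)
     - 8^-1 * grad_form u u y / u y * G y a b.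
  by rewrite -(hessian_grad_form _ _ _ Uy) !mxE.
have E a b : christoffel1 (fun z => u z *: G z) ^~ a ^~ b ^~ y =
    (fun p => u y * christoffel1 G p a b y + 2^-1 * (partial a u y * G y b p
       + (partial b u y * G y a p + - G y a b * partial p u y))).
  by apply/funext => p; rewrite christoffel1_scale.
have symG a b : G y a b = G y b a by exact: (metric_symE mG).
have D a b i' j' : partial a (partial b (fun w => (u w *: G w) i' j')) y =
  partial a (partial b u) y * G y i' j'
  + partial b u y * (christoffel1 G i' a j' y + christoffel1 G j' a i' y)
  + partial a u y * (christoffel1 G i' b j' y + christoffel1 G j' b i' y)
  + u y * partial a (partial b (fun w => G w i' j')) y.
  by rewrite scale_entry partial2_scale.
have Q a b a' b' := pairing_scale (christoffel1 G ^~ a ^~ b ^~ y)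
  (christoffel1 G ^~ a' ^~ b' ^~ y) (partial ^~ u ^~ y) a b a' b' uG syG (u0 Uy).
have {}Q a b a' b' := etrans (congr2 (pairing (invmx (u y *: G y))) (E a b) (E a' b'))
  (etrans (congr1 (fun P => pairing P _ _) (invmx_scale Uy)) (Q a b a' b')).
rewrite (riemannE smooth_metric_scale i j k l Uy) (riemannE mG i j k l Uy).
rewrite (D i l j k) (D i k j l) (D j l i k) (D j k i l) (Q i k j l) (Q j k i l).
rewrite (EA j l) (EA i k) (EA j k) (EA i l) /grad_form.
have sC a b c : christoffel1 G a b c y = christoffel1 G a c b y by apply: (christoffel1C mG).
(* Entries that are equal by symmetry are given the same form before being generalized; otherwise
   [field] would treat them as independent. *)
rewrite (sC j l k) (sC k l j) (sC l k j) (sC k j i) (sC i l k) (sC k l i) (sC l j i) (sC l k i).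
rewrite (symG k j) (symG j i) (symG k i).
have := u0 Uy.
repeat match goal with |- context [pairing ?P ?a ?b] => generalize (pairing P a b) end.
repeat match goal with |- context [partial ?a ?f y] => generalize (partial a f y) end.
repeat match goal with |- context [christoffel1 G ?a ?b ?c y] => generalize (christoffel1 G a b c y) end.
repeat match goal with |- context [fun_of_matrix (G y) ?a ?b] => generalize (G y a b) end.
generalize (u y).
intros; field.
by [].
Qed.

End Conformal.

(** * Riemannian products *)

Section ProductMetric.
Context {R : realType} {m n : nat}.
Variables (U1 : set 'rV[R]_m) (G1 : 'rV[R]_m -> 'M[R]_m) (mG1 : smooth_metric U1 G1).
Variables (U2 : set 'rV[R]_n) (G2 : 'rV[R]_n -> 'M[R]_n) (mG2 : smooth_metric U2 G2).

Definition product_metric (z : 'rV[R]_(m + n)) : 'M[R]_(m + n) :=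
  block_mx (G1 (lsubmx z)) 0 0 (G2 (rsubmx z)).

Definition product_set : set 'rV[R]_(m + n) :=
  [set z | U1 (lsubmx z) /\ U2 (rsubmx z)].

Lemma open_product_set : open product_set.
Proof.
apply: openI.
  by apply: open_comp (smet_open mG1) => z _; exact: continuous_lsubmx.
by apply: open_comp (smet_open mG2) => z _; exact: continuous_rsubmx.
Qed.

Lemma product_metric_ll i j :
  (fun w => product_metric w (lshift n i) (lshift n j)) = (fun w => G1 (lsubmx w) i j).
Proof. by apply/funext => w; rewrite /product_metric block_mxEul. Qed.

Lemma product_metric_lr i j :
  (fun w => product_metric w (lshift n i) (rshift m j)) = (fun=> 0).
Proof. by apply/funext => w; rewrite /product_metric block_mxEur mxE. Qed.

Lemma product_metric_rl i j :
  (fun w => product_metric w (rshift m i) (lshift n j)) = (fun=> 0).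
Proof. by apply/funext => w; rewrite /product_metric block_mxEdl mxE. Qed.

Lemma product_metric_rr i j :
  (fun w => product_metric w (rshift m i) (rshift m j)) = (fun w => G2 (rsubmx w) i j).
Proof. by apply/funext => w; rewrite /product_metric block_mxEdr. Qed.

Definition product_metricE :=
  (product_metric_ll, product_metric_lr, product_metric_rl, product_metric_rr).

Lemma product_metric_unit z : product_set z -> product_metric z \in unitmx.
Proof.
move=> [/(smet_unit mG1) u1 /(smet_unit mG2) u2].
by move: u1 u2; rewrite !unitmxE det_ublock unitrM => -> ->.
Qed.

Lemma invmx_product_metric z : product_set z ->
  invmx (product_metric z) = block_mx (invmx (G1 (lsubmx z))) 0 0 (invmx (G2 (rsubmx z))).
Proof. by move=> /product_metric_unit; exact: invmx_block_diag. Qed.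

Lemma smooth_product_metric : smooth_metric product_set product_metric.
Proof.
have oU := open_product_set.
split=> // [i j|y [U1y U2y]|y].
- case: (split_ordP i) => i' ->; case: (split_ordP j) => j' ->; rewrite product_metricE.
  + apply: smooth_sub (smooth_lsubmx (smet_smooth mG1 i' j')) => z [] //.
  + exact: smooth_cst.
  + exact: smooth_cst.
  + apply: smooth_sub (smooth_rsubmx (smet_smooth mG2 i' j')) => z [] //.
- rewrite /product_metric (tr_block_mx (G1 _)) !trmx0.
  by rewrite (smet_sym mG1)// (smet_sym mG2).
- exact: product_metric_unit.
Qed.

Lemma partial_cst_fun p (k : R) (a : 'I_p) : partial a (fun=> k) = (fun=> 0 : R).
Proof. by apply/funext => z; rewrite partial_cst. Qed.

Let lentry_l i j a : partial (lshift n a) (fun w : 'rV[R]_(m + n) => G1 (lsubmx w) i j) =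
  fun w => partial a (fun z => G1 z i j) (lsubmx w).
Proof. exact: (partial_lsubmx_l (fun z => G1 z i j)). Qed.

Let lentry_r i j a : partial (rshift m a) (fun w : 'rV[R]_(m + n) => G1 (lsubmx w) i j) =
  fun=> 0.
Proof. exact: (partial_lsubmx_r (fun z => G1 z i j)). Qed.

Let rentry_l i j a : partial (lshift n a) (fun w : 'rV[R]_(m + n) => G2 (rsubmx w) i j) =
  fun=> 0.
Proof. exact: (partial_rsubmx_l (fun z => G2 z i j)). Qed.

Let rentry_r i j a : partial (rshift m a) (fun w : 'rV[R]_(m + n) => G2 (rsubmx w) i j) =
  fun w => partial a (fun z => G2 z i j) (rsubmx w).
Proof. exact: (partial_rsubmx_r (fun z => G2 z i j)). Qed.

Let partialE := (product_metricE, lentry_l, lentry_r, rentry_l, rentry_r,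
  @partial_lsubmx_l R m n, @partial_lsubmx_r R m n, @partial_rsubmx_l R m n,
  @partial_rsubmx_r R m n, @partial_cst_fun (m + n)).

Lemma christoffel1_product_l i j z :
  (fun p => christoffel1 product_metric (lshift n p) i j z) =
  match fintype.split i, fintype.split j with
  | inl a, inl b => fun p => christoffel1 G1 p a b (lsubmx z)
  | _, _ => fun=> 0
  end.
Proof.
by case: (split_ordP i) => a ->; case: (split_ordP j) => b ->;
  apply/funext => p; rewrite /christoffel1 !partialE ?(addr0, subr0, mulr0).
Qed.

Lemma christoffel1_product_r i j z :
  (fun p => christoffel1 product_metric (rshift m p) i j z) =
  match fintype.split i, fintype.split j with
  | inr a, inr b => fun p => christoffel1 G2 p a b (rsubmx z)
  | _, _ => fun=> 0
  end.
Proof.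
by case: (split_ordP i) => a ->; case: (split_ordP j) => b ->;
  apply/funext => p; rewrite /christoffel1 !partialE ?(addr0, subr0, mulr0).
Qed.

Lemma partial2_product_metric a b i j z :
  partial a (partial b (fun w => product_metric w i j)) z =
  match fintype.split a, fintype.split b, fintype.split i, fintype.split j with
  | inl a, inl b, inl i, inl j => partial a (partial b (fun w => G1 w i j)) (lsubmx z)
  | inr a, inr b, inr i, inr j => partial a (partial b (fun w => G2 w i j)) (rsubmx z)
  | _, _, _, _ => 0
  end.
Proof.
by case: (split_ordP a) => a' ->; case: (split_ordP b) => b' ->;
  case: (split_ordP i) => i' ->; case: (split_ordP j) => j' ->; rewrite !partialE.
Qed.

Lemma block_diagE (A : 'M[R]_m) (D : 'M[R]_n) i j :
  block_mx A 0 0 D i j =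
  match fintype.split i, fintype.split j with
  | inl i, inl j => A i j
  | inr i, inr j => D i j
  | _, _ => 0
  end.
Proof.
by case: (split_ordP i) => i' ->; case: (split_ordP j) => j' ->;
  rewrite ?(block_mxEul, block_mxEur, block_mxEdl, block_mxEdr)// mxE.
Qed.

Lemma pairing_block (P1 : 'M[R]_m) (P2 : 'M[R]_n) (a b : 'I_(m + n) -> R) :
  pairing (block_mx P1 0 0 P2) a b =
  pairing P1 (fun p => a (lshift n p)) (fun p => b (lshift n p)) +
  pairing P2 (fun p => a (rshift m p)) (fun p => b (rshift m p)).
Proof.
rewrite /pairing big_split_ord/=; congr (_ + _); apply: eq_bigr => p _.
  rewrite big_split_ord/= [X in _ + X]big1 ?addr0 => [|q _].
    by apply: eq_bigr => q _; rewrite block_mxEul.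
  by rewrite block_mxEur mxE !mul0r.
rewrite big_split_ord/= [X in X + _]big1 ?add0r => [|q _].
  by apply: eq_bigr => q _; rewrite block_mxEdr.
by rewrite block_mxEdl mxE !mul0r.
Qed.

Lemma pairing0l p (P : 'M[R]_p) b : pairing P (fun=> 0) b = 0.
Proof. by rewrite /pairing big1// => i _; rewrite big1// => j _; rewrite mulr0 mul0r. Qed.

Lemma pairing0r p (P : 'M[R]_p) b : pairing P b (fun=> 0) = 0.
Proof. by rewrite /pairing big1// => i _; rewrite big1// => j _; rewrite mulr0. Qed.

(** [K1] and [K2] are numbers attached to one point, so that any two surfaces qualify. Unless all
    four indices belong to the same factor, both sides vanish. *)
Lemma riemann_product_metric (K1 K2 : R) y : product_set y ->
  (forall i j k l, riemann G1 (lsubmx y) i j k l =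
    K1 * (G1 (lsubmx y) i k * G1 (lsubmx y) j l - G1 (lsubmx y) i l * G1 (lsubmx y) j k)) ->
  (forall i j k l, riemann G2 (rsubmx y) i j k l =
    K2 * (G2 (rsubmx y) i k * G2 (rsubmx y) j l - G2 (rsubmx y) i l * G2 (rsubmx y) j k)) ->
  let S := block_mx (G1 (lsubmx y)) 0 0 0 in
  let T := block_mx 0 0 0 (G2 (rsubmx y)) in
  forall i j k l, riemann product_metric y i j k l =
    K1 * (S i k * S j l - S i l * S j k) + K2 * (T i k * T j l - T i l * T j k).
Proof.
move=> Uy H1 H2 S T i j k l.
rewrite (riemannE smooth_product_metric i j k l Uy) invmx_product_metric// !pairing_block.
case: Uy => U1y U2y.
rewrite (christoffel1_product_l i k y) (christoffel1_product_l j l y).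
rewrite (christoffel1_product_l j k y) (christoffel1_product_l i l y).
rewrite (christoffel1_product_r i k y) (christoffel1_product_r j l y).
rewrite (christoffel1_product_r j k y) (christoffel1_product_r i l y).
rewrite (partial2_product_metric i l j k) (partial2_product_metric i k j l).
rewrite (partial2_product_metric j l i k) (partial2_product_metric j k i l).
rewrite /S /T (block_diagE _ _ i k) (block_diagE _ _ j l) (block_diagE _ _ i l).
rewrite (block_diagE _ _ j k) (block_diagE _ _ i k) (block_diagE _ _ j l).
rewrite (block_diagE _ _ i l) (block_diagE _ _ j k).
case: (split_ordP i) => i' _; case: (split_ordP j) => j' _;
  case: (split_ordP k) => k' _; case: (split_ordP l) => l' _ /=.
all: rewrite ?pairing0l ?pairing0r.
all: rewrite ?(@mxE R).
all: rewrite ?(mul0r, mulr0, addr0, add0r, subr0, oppr0) //.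
- by rewrite -H1 (riemannE mG1).
- by rewrite -H2 (riemannE mG2).
Qed.

End ProductMetric.

Section RiemannSymmetries.
Context {R : realType} {n : nat}.
Variables (U : set 'rV[R]_n) (G : 'rV[R]_n -> 'M[R]_n) (mG : smooth_metric U G).

Lemma riemann_swap12 i j k l y : U y -> riemann G y i j k l = - riemann G y j i k l.
Proof.
move=> Uy; rewrite (riemannE mG i j k l Uy) (riemannE mG j i k l Uy).
repeat match goal with |- context [pairing ?P ?a ?b] => generalize (pairing P a b) end.
repeat match goal with |- context [partial ?a ?f y] => generalize (partial a f y) end.
by intros; ring.
Qed.

Lemma riemann_swap34 i j k l y : U y -> riemann G y i j k l = - riemann G y i j l k.
Proof.
move=> Uy; rewrite (riemannE mG i j k l Uy) (riemannE mG i j l k Uy).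
have sP := invmx_sym (smet_sym mG Uy).
rewrite (pairingC _ (fun p => christoffel1 G p j k y) sP).
rewrite (pairingC _ (fun p => christoffel1 G p j l y) sP).
repeat match goal with |- context [pairing ?P ?a ?b] => generalize (pairing P a b) end.
repeat match goal with |- context [partial ?a ?f y] => generalize (partial a f y) end.
by intros; ring.
Qed.

End RiemannSymmetries.

Lemma ord2P (P : 'I_2 -> Prop) : P 0 -> P 1 -> forall i, P i.
Proof.
move=> P0 P1 [[|[|i]] Hi] //; [move: P0|move: P1]; congr (P _); exact: val_inj.
Qed.

Lemma det2E (R : comNzRingType) (A : 'M[R]_2) : \det A = A 0 0 * A 1 1 - A 0 1 * A 1 0.
Proof.
rewrite (expand_det_row _ 0) sum2E /cofactor !det_mx11 !mxE /= expr0 expr1 mul1r mulN1r mulrN.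
by congr (_ * A _ _ - _ * A _ _); apply: val_inj.
Qed.

(** Skew symmetry in both pairs of indices leaves one component in dimension two, the one used to
    define [gauss_curvature]. *)
Lemma riemann_surface (R : realType) (U : set 'rV[R]_2) (G : 'rV[R]_2 -> 'M[R]_2) y :
  smooth_metric U G -> U y -> forall i j k l,
  riemann G y i j k l =
  gauss_curvature G y * (G y i k * G y j l - G y i l * G y j k).
Proof.
move=> mG Uy.
have d0 : \det (G y) != 0 by have := smet_unit mG Uy; rewrite unitmxE unitfE.
have K0 : riemann G y 0 1 0 1 = gauss_curvature G y * (G y 0 0 * G y 1 1 - G y 0 1 * G y 1 0).
  by rewrite /gauss_curvature -det2E divfK.
have alg (x : R) : x = - x -> x = 0 by move=> ?; lra.
have z12 i k l : riemann G y i i k l = 0.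
  exact/alg/(riemann_swap12 mG).
have z34 i j k : riemann G y i j k k = 0.
  exact/alg/(riemann_swap34 mG).
have s12 i j k l := riemann_swap12 mG i j k l Uy.
have s34 i j k l := riemann_swap34 mG i j k l Uy.
move: (riemann G y) K0 z12 z34 s12 s34 => r K0 z12 z34 s12 s34.
move: (gauss_curvature G y) K0 => K K0.
apply: ord2P; apply: ord2P; apply: ord2P; apply: ord2P;
  rewrite ?z12 ?z34 ?[r 1 0 _ _]s12 ?[r 0 1 1 0]s34 ?K0.
all: ring.
Qed.

(** * Curvature tensors diagonal in a frame *)

Section FrameSums.
Context {R : comNzRingType} {n : nat}.

(** Moves a contraction inside an expansion over frame planes, where it acts on products of
    covectors. *)
Lemma sum2_pull (g : 'I_n -> 'I_n -> R) (k : 'I_n -> 'I_n -> R) (X : 'I_n -> 'I_n -> 'I_n -> 'I_n -> R) :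
  \sum_p \sum_q g p q * (\sum_a \sum_b k a b * X a b p q) =
  \sum_a \sum_b k a b * (\sum_p \sum_q g p q * X a b p q).
Proof.
rewrite !pair_bigA/=.
rewrite (eq_bigr (fun u => \sum_v g u.1 u.2 * (k v.1 v.2 * X v.1 v.2 u.1 u.2))) => [|u _]; last first.
  by rewrite pair_bigA mulr_sumr.
rewrite exchange_big/=; apply: eq_bigr => v _; rewrite pair_bigA mulr_sumr.
by apply: eq_bigr => u _; rewrite mulrCA.
Qed.

Lemma sum3_pull (g : 'I_n -> 'I_n -> 'I_n -> R) (k : 'I_n -> 'I_n -> R)
    (X : 'I_n -> 'I_n -> 'I_n -> 'I_n -> 'I_n -> R) :
  \sum_p \sum_q \sum_r g p q r * (\sum_a \sum_b k a b * X a b p q r) =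
  \sum_a \sum_b k a b * (\sum_p \sum_q \sum_r g p q r * X a b p q r).
Proof.
rewrite pair_bigA pair_bigA/= pair_bigA/=.
rewrite (eq_bigr (fun u => \sum_v g u.1.1 u.1.2 u.2 * (k v.1 v.2 * X v.1 v.2 u.1.1 u.1.2 u.2))) => [|u _]; last first.
  by rewrite pair_bigA mulr_sumr.
rewrite exchange_big/=; apply: eq_bigr => v _; rewrite pair_bigA pair_bigA/= mulr_sumr.
by apply: eq_bigr => u _; rewrite mulrCA.
Qed.

Lemma sum2_factor (f g : 'I_n -> R) :
  \sum_p \sum_q f p * g q = (\sum_p f p) * (\sum_q g q).
Proof. by rewrite big_distrlr. Qed.

Lemma sum3_factor (f g h : 'I_n -> R) :
  \sum_p \sum_q \sum_r f p * g q * h r = (\sum_p f p) * (\sum_q g q) * (\sum_r h r).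
Proof.
rewrite -mulrA -sum2_factor mulr_suml; apply: eq_bigr => p _; rewrite mulr_sumr.
by apply: eq_bigr => q _; rewrite mulr_sumr; apply: eq_bigr => r _; rewrite mulrA.
Qed.

Lemma sum2_lin (m c : R) (f0 f1 f2 f3 f4 f5 f6 : 'I_n -> 'I_n -> R) :
  \sum_a \sum_b f0 a b - m * (\sum_a \sum_b f1 a b - \sum_a \sum_b f2 a b
     + \sum_a \sum_b f3 a b - \sum_a \sum_b f4 a b)
  + c * (\sum_a \sum_b f5 a b - \sum_a \sum_b f6 a b) =
  \sum_a \sum_b (f0 a b - m * (f1 a b - f2 a b + f3 a b - f4 a b) + c * (f5 a b - f6 a b)).
Proof.
rewrite !pair_bigA/= -!sumrB -big_split/= -sumrB !mulr_sumr -sumrB -big_split/=.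
by apply: eq_bigr.
Qed.

Lemma sum_delta (f : 'I_n -> R) a : \sum_b f b * (a == b)%:R = f a.
Proof.
rewrite (bigD1 a)//= eqxx mulr1 big1 ?addr0// => b ba.
by rewrite eq_sym (negbTE ba) mulr0.
Qed.

End FrameSums.

(* The components of a curvature tensor all of whose coordinate planes in the
   frame dual to the columns of [B] are eigenplanes, with eigenvalues [kappa]. *)
Definition pure_tensor (R : nzRingType) n (B : 'M[R]_n) (kappa : 'I_n -> 'I_n -> R) (i j k l : 'I_n) : R :=
  \sum_a \sum_b kappa a b *
    (B i a * B k a * B j b * B l b - B i a * B l a * B j b * B k b).

Section PureCurvature.
Context {R : realType} {n : nat}.
Variables (G : 'rV[R]_n -> 'M[R]_n) (y : 'rV[R]_n) (B E : 'M[R]_n).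
Variables (kappa : 'I_n -> 'I_n -> R).
Hypotheses (EB : E *m B = 1%:M) (GB : G y = B *m B^T).
Hypotheses (kappaC : forall a b, kappa a b = kappa b a) (kappa0 : forall a, kappa a a = 0).
Hypothesis riemB : forall i j k l, riemann G y i j k l = pure_tensor B kappa i j k l.

(** The rows of [E] are an orthonormal frame and the columns of [B] its dual coframe; every
    contraction below reduces to this duality. *)
Lemma frame_delta a b : \sum_k E a k * B k b = (a == b)%:R.
Proof. by move/matrixP/(_ a b): EB; rewrite !mxE => <-. Qed.

Lemma frame_metricE i j : G y i j = \sum_a B i a * B j a.
Proof. by rewrite GB mxE; apply: eq_bigr => a _; rewrite mxE. Qed.

Lemma frame_invmx : invmx (G y) = E^T *m E.
Proof.
have BE : B *m E = 1%:M by exact: mulmx1C.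
have uG : G y \in unitmx.
  by rewrite GB unitmx_mul unitmx_tr andbb; case: (mulmx1_unit BE).
apply: (can_inj (mulKmx uG)); rewrite mulmxV// GB.
by rewrite -mulmxA [B^T *m _]mulmxA -trmx_mul EB trmx1 mul1mx BE.
Qed.

Lemma frame_raise k a : \sum_k' invmx (G y) k k' * B k' a = E a k.
Proof.
have -> : \sum_k' invmx (G y) k k' * B k' a = (invmx (G y) *m B) k a by rewrite mxE.
by rewrite frame_invmx -mulmxA EB mulmx1 mxE.
Qed.

Lemma frame_trace a b : \sum_p \sum_q invmx (G y) p q * (B p a * B q b) = (a == b)%:R.
Proof.
rewrite -frame_delta exchange_big/=.
under eq_bigr => q _.
  rewrite (eq_bigr (fun p => invmx (G y) p q * B p a * B q b)) => [|p _]; last by rewrite mulrA.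
  rewrite -mulr_suml.
  rewrite (eq_bigr (fun p => invmx (G y) q p * B p a)) => [|p _]; last first.
    by congr (_ * _); rewrite frame_invmx !mxE; apply: eq_bigr => c _; rewrite !mxE mulrC.
  rewrite frame_raise; over.
by [].
Qed.

Definition pure_ricci a : R := \sum_b kappa a b.
Definition pure_scalar : R := \sum_a pure_ricci a.

(** The trace of the first product of covectors is 1; that of the second is concentrated on [a = b],
    where [kappa] vanishes. *)
Lemma ricci_pure i j : ricci G y i j = \sum_a pure_ricci a * (B i a * B j a).
Proof.
rewrite mxE.
rewrite (eq_bigr (fun p => \sum_q invmx (G y) p q * (\sum_a \sum_b kappa a b *
   (B i a * B j a * (B p b * B q b) - B i a * B j b * (B p b * B q a))))) => [|p _]; last first.
  apply: eq_bigr => q _; congr (_ * _); rewrite riemB; apply: eq_bigr => a _.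
  by apply: eq_bigr => b _; congr (_ * _); ring.
rewrite sum2_pull; apply: eq_bigr => a _; rewrite mulr_suml.
rewrite [RHS](_ : _ = \sum_b kappa a b * (B i a * B j a) - 
     \sum_b (kappa a b * (B i a * B j b)) * (a == b)%:R); last first.
  by rewrite sum_delta kappa0 mul0r subr0.
rewrite -sumrB; apply: eq_bigr => b _.
have -> : \sum_p \sum_q invmx (G y) p q *
   (B i a * B j a * (B p b * B q b) - B i a * B j b * (B p b * B q a)) =
   B i a * B j a * (\sum_p \sum_q invmx (G y) p q * (B p b * B q b)) -
   B i a * B j b * (\sum_p \sum_q invmx (G y) p q * (B p b * B q a)).
  rewrite !mulr_sumr -sumrB; apply: eq_bigr => p _.
  rewrite !mulr_sumr -sumrB; apply: eq_bigr => q _; ring.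
rewrite !frame_trace eqxx (eq_sym b a) /=.
by move: ((a == b)%:R : R) => d; ring.
Qed.

Lemma scalar_curvature_pure : scalar_curvature G y = pure_scalar.
Proof.
rewrite /scalar_curvature.
rewrite (eq_bigr (fun p => \sum_q invmx (G y) p q * (\sum_a \sum_(b < 1) pure_ricci a *
   (B p a * B q a)))) => [|p _]; last first.
  apply: eq_bigr => q _; congr (_ * _); rewrite ricci_pure; apply: eq_bigr => a _.
  by rewrite big_ord1.
rewrite (eq_bigr (fun p => \sum_a \sum_q pure_ricci a * (invmx (G y) p q * (B p a * B q a)))) => [|p _]; last first.
  rewrite exchange_big/=; apply: eq_bigr => q _; rewrite mulr_sumr.
  by apply: eq_bigr => a _; rewrite big_ord1 mulrCA.
rewrite exchange_big/=; apply: eq_bigr => a _.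
have tr := frame_trace a a; rewrite eqxx in tr.
rewrite -[RHS]mulr1 -[X in _ = _ * X]tr mulr_sumr; apply: eq_bigr => p _.
by rewrite mulr_sumr.
Qed.

Lemma einstein_tensor_pure i j : einstein_tensor G y i j =
  \sum_a (pure_ricci a - pure_scalar / n%:R) * (B i a * B j a).
Proof.
rewrite /einstein_tensor scalar_curvature_pure mxE ricci_pure 2!mxE frame_metricE mulr_sumr -sumrB.
by apply: eq_bigr => a _; rewrite mulrBl.
Qed.

Definition pure_weyl a b : R :=
  kappa a b - (n%:R - 2)^-1 * (pure_ricci a + pure_ricci b)
  + pure_scalar / ((n%:R - 1) * (n%:R - 2)).

(** The metric and the Ricci tensor are both diagonal in the frame, hence the correction terms are
    diagonal on its planes as well. *)
Lemma weyl_pure i j k l : weyl G y i j k l = pure_tensor B pure_weyl i j k l.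
Proof.
have P (x z : 'I_n -> R) i' j' k' l' :
    (\sum_a x a * (B i' a * B j' a)) * (\sum_b z b * (B k' b * B l' b)) =
    \sum_a \sum_b x a * z b * (B i' a * B j' a * B k' b * B l' b).
  rewrite -sum2_factor; apply: eq_bigr => a _; apply: eq_bigr => b _; ring.
have Gm i' j' : G y i' j' = \sum_a 1 * (B i' a * B j' a).
  by rewrite frame_metricE; apply: eq_bigr => a _; rewrite mul1r.
rewrite /weyl riemB scalar_curvature_pure.
rewrite [G y j l * ricci G y i k]mulrC [G y j k * ricci G y i l]mulrC.
rewrite !ricci_pure !Gm !P /pure_tensor sum2_lin.
apply: eq_bigr => a _; apply: eq_bigr => b _; rewrite /pure_weyl.
move: (pure_ricci a) (pure_ricci b) (_^-1) (pure_scalar / _) (kappa a b) => *; ring.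
Qed.

(** For each frame direction [a] the contraction collects the squares of the eigenvalues on the
    planes containing [a]. The factor 2 counts the two orders of the last two contracted indices. *)
Lemma weakly_einstein_pure i j :
  \sum_k \sum_l \sum_m riemann G y i k l m * riemann_up G y j k l m =
  \sum_a (2 * \sum_b kappa a b ^+ 2) * (B i a * B j a).
Proof.
(* Raising the three indices turns the covectors in these positions into frame vectors. *)
have up k l m : riemann_up G y j k l m = \sum_a \sum_b (kappa a b * B j a) *
    (E b k * (E a l * E b m - E b l * E a m)).
  rewrite /riemann_up; under eq_bigr => k' _ do under eq_bigr => l' _ do under eq_bigr => m' _ do rewrite riemB.
  rewrite sum3_pull; apply: eq_bigr => a _; apply: eq_bigr => b _.
  rewrite -mulrA; congr (_ * _).
  transitivity (B j a * ((\sum_k' invmx (G y) k k' * B k' b) *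
      (\sum_l' invmx (G y) l l' * B l' a) * (\sum_m' invmx (G y) m m' * B m' b)) -
      B j a * ((\sum_k' invmx (G y) k k' * B k' b) *
      (\sum_l' invmx (G y) l l' * B l' b) * (\sum_m' invmx (G y) m m' * B m' a))).
    rewrite -!sum3_factor !mulr_sumr -sumrB; apply: eq_bigr => k' _.
    rewrite !mulr_sumr -sumrB; apply: eq_bigr => l' _.
    rewrite !mulr_sumr -sumrB; apply: eq_bigr => m' _; ring.
  by rewrite !frame_raise; ring.
under eq_bigr => k _ do under eq_bigr => l _ do under eq_bigr => m _ do rewrite up.
rewrite sum3_pull; apply: eq_bigr => a _.
rewrite [RHS](_ : _ = \sum_b kappa a b * B j a * (2 * kappa a b * B i a)); last first.
  rewrite mulr_sumr mulr_suml; apply: eq_bigr => b _; ring.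
apply: eq_bigr => b _; congr (_ * _).
under eq_bigr => k _ do under eq_bigr => l _ do under eq_bigr => m _ do rewrite riemB mulrC.
rewrite sum3_pull.
have inn c d : \sum_p \sum_q \sum_r E b p * (E a q * E b r - E b q * E a r) *
    (B i c * B q c * B p d * B r d - B i c * B r c * B p d * B q d) =
    2 * B i c * ((a == c)%:R * (b == d)%:R) - 2 * B i c * ((b == c)%:R * (a == d)%:R * (b == d)%:R).
  transitivity (B i c * ((\sum_p E b p * B p d) * (\sum_q E a q * B q c) * (\sum_r E b r * B r d))
    - B i c * ((\sum_p E b p * B p d) * (\sum_q E b q * B q c) * (\sum_r E a r * B r d))
    - (B i c * ((\sum_p E b p * B p d) * (\sum_q E a q * B q d) * (\sum_r E b r * B r c))
    - B i c * ((\sum_p E b p * B p d) * (\sum_q E b q * B q d) * (\sum_r E a r * B r c)))).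
    rewrite -!sum3_factor !mulr_sumr -!sumrB; apply: eq_bigr => p _.
    rewrite !mulr_sumr -!sumrB; apply: eq_bigr => q _.
    rewrite !mulr_sumr -!sumrB; apply: eq_bigr => r _; ring.
  (* The indicator of [b = d] occurs squared; its idempotence is the only relation that [ring]
     cannot supply. *)
  rewrite !frame_delta; have idem (t : bool) : (t%:R : R) * t%:R = t%:R.
    by case: t; rewrite ?mulr1 ?mulr0.
  have := idem (b == d).
  move: ((a == c)%:R : R) ((b == d)%:R : R) ((b == c)%:R : R) ((a == d)%:R : R) => x z v w zz.
  transitivity (2 * B i c * (x * (z * z)) - 2 * B i c * (v * w * z)); first by ring.
  by rewrite zz.
under eq_bigr => c _ do under eq_bigr => d _ do rewrite inn.
rewrite (eq_bigr (fun c => (2 * kappa c b * B i c) * (a == c)%:R - 2 * kappa c b * B i c * (a == b)%:R * (b == c)%:R)).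
  by rewrite sumrB !sum_delta kappa0; ring.
move=> c _; rewrite (eq_bigr (fun d => (2 * B i c * (a == c)%:R * kappa c d) * (b == d)%:R -
  (2 * B i c * (b == c)%:R * kappa c d * (a == d)%:R) * (b == d)%:R)) => [|d _].
  rewrite sumrB !sum_delta.
  move: ((a == c)%:R : R) ((b == c)%:R : R) ((a == b)%:R : R) => *; ring.
move: ((a == c)%:R : R) ((b == d)%:R : R) ((b == c)%:R : R) ((a == d)%:R : R) => *; ring.
Qed.

End PureCurvature.

Section WeylEigen.
Context {R : realType}.
Variables (G : 'rV[R]_4 -> 'M[R]_4) (y : 'rV[R]_4).

Lemma weyl_eigen_comb (b s t : R) (z w : 'M[R]_4) :
  weyl_eigen G y b z -> weyl_eigen G y b w -> weyl_eigen G y b (s *: z + t *: w).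
Proof.
move=> ez ew i j.
have L (F : 'I_4 -> 'I_4 -> R) : \sum_k \sum_l F k l * (s *: z + t *: w) k l =
    s * (\sum_k \sum_l F k l * z k l) + t * (\sum_k \sum_l F k l * w k l).
  rewrite !mulr_sumr -big_split/=; apply: eq_bigr => k _.
  rewrite !mulr_sumr -big_split/=; apply: eq_bigr => l _.
  by rewrite !mxE; ring.
by rewrite !L mulrDr mulrCA ez mulrCA [X in _ + X]mulrCA ew; ring.
Qed.

Lemma wedge_scale (s t : R) (u v : 'rV[R]_4) :
  wedge (s *: u) (t *: v) = (s * t) *: wedge u v.
Proof.
by rewrite /wedge !linearZ/= -!scalemxAl !scalerA scalerN scalerA (mulrC t s) -scalerBr.
Qed.

Variables (B E : 'M[R]_4) (w : 'I_4 -> 'I_4 -> R).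
Hypotheses (EB : E *m B = 1%:M) (GB : G y = B *m B^T).
Hypotheses (wC : forall a b, w a b = w b a).
Hypothesis weylB : forall i j k l, weyl G y i j k l = pure_tensor B w i j k l.

(** A plane occurs in the double sum in two orders, which the factor 1/2 in the action on bivectors
    compensates. *)
Lemma weyl_eigen_pure a b : weyl_eigen G y (w a b) (wedge (row a E) (row b E)).
Proof.
have Z k l : wedge (row a E) (row b E) k l = E a k * E b l - E b k * E a l.
  by rewrite /wedge !mxE !big_ord1 !mxE.
have EBd c d : \sum_k E c k * B k d = (c == d)%:R by exact: frame_delta.
move=> i j; have lower c i' : \sum_k G y i' k * E c k = B i' c.
  have := EB; move/mulmx1C => BE.
  have -> : \sum_k G y i' k * E c k = (G y *m E^T) i' c.
    by rewrite mxE; apply: eq_bigr => k _; rewrite mxE.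
  by rewrite GB -mulmxA -trmx_mul EB trmx1 mulmx1.
have -> : \sum_k \sum_l G y i k * G y j l * wedge (row a E) (row b E) k l =
    B i a * B j b - B i b * B j a.
  rewrite -!lower -!sum2_factor -sumrB; apply: eq_bigr => k _.
  by rewrite -sumrB; apply: eq_bigr => l _; rewrite Z; ring.
have -> : \sum_k \sum_l weyl G y i j k l * wedge (row a E) (row b E) k l =
  \sum_c \sum_d w c d * (\sum_k \sum_l wedge (row a E) (row b E) k l *
    (B i c * B k c * B j d * B l d - B i c * B l c * B j d * B k d)).
  rewrite -sum2_pull; apply: eq_bigr => k _; apply: eq_bigr => l _.
  by rewrite weylB mulrC.
have inn c d : \sum_k \sum_l wedge (row a E) (row b E) k l *
    (B i c * B k c * B j d * B l d - B i c * B l c * B j d * B k d) =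
  2 * (B i c * B j d) * ((a == c)%:R * (b == d)%:R - (b == c)%:R * (a == d)%:R).
  transitivity (B i c * B j d * ((\sum_k E a k * B k c) * (\sum_l E b l * B l d))
     - B i c * B j d * ((\sum_k E b k * B k c) * (\sum_l E a l * B l d))
     - (B i c * B j d * ((\sum_k E a k * B k d) * (\sum_l E b l * B l c))
     - B i c * B j d * ((\sum_k E b k * B k d) * (\sum_l E a l * B l c)))).
    rewrite -!sum2_factor !mulr_sumr -!sumrB; apply: eq_bigr => k _.
    by rewrite !mulr_sumr -!sumrB; apply: eq_bigr => l _; rewrite Z; ring.
  rewrite !EBd.
  move: ((a == c)%:R : R) ((b == d)%:R : R) ((b == c)%:R : R) ((a == d)%:R : R) => *; ring.
under eq_bigr => c _ do under eq_bigr => d _ do rewrite inn.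
rewrite (eq_bigr (fun c => (2 * w c b * (B i c * B j b)) * (a == c)%:R
   - (2 * w c a * (B i c * B j a)) * (b == c)%:R)); last first.
  move=> c _; rewrite (eq_bigr (fun d => (2 * w c d * (B i c * B j d) * (a == c)%:R) * (b == d)%:R -
    (2 * w c d * (B i c * B j d) * (b == c)%:R) * (a == d)%:R)) => [|d _].
    by rewrite sumrB !sum_delta.
  move: ((a == c)%:R : R) ((b == d)%:R : R) ((b == c)%:R : R) ((a == d)%:R : R) => *; ring.
rewrite sumrB !sum_delta (wC b a).
by move: (w a b) (B i a) (B i b) (B j a) (B j b) => *; field.
Qed.

End WeylEigen.

Section Homothety.
Context {R : realType}.
Variables (G : 'rV[R]_4 -> 'M[R]_4) (y : 'rV[R]_4) (B E : 'M[R]_4).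

Lemma inner_scale (s t : R) (u v : 'rV[R]_4) :
  inner G y (s *: u) (t *: v) = s * t * inner G y u v.
Proof.
rewrite /inner; have -> : (t *: v)^T = t *: v^T by rewrite linearZ.
by rewrite -!scalemxAl -scalemxAr scalerA mxE.
Qed.

Variables (kappa : 'I_4 -> 'I_4 -> R).
Hypotheses (EB : E *m B = 1%:M) (GB : G y = B *m B^T).
Hypotheses (kappaC : forall a b, kappa a b = kappa b a) (kappa0 : forall a, kappa a a = 0).
Hypothesis riemB : forall i j k l, riemann G y i j k l = pure_tensor B kappa i j k l.

Lemma pure_weylC a b : pure_weyl kappa a b = pure_weyl kappa b a.
Proof. by rewrite /pure_weyl kappaC [pure_ricci _ _ + _]addrC. Qed.

(** The Weyl tensor has the same eigenvalue on opposite planes, so the sum and the difference of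
    their bivectors are both eigenvectors; this is why one list [b] serves both orientations. The
    map [t] puts the frame in the prescribed order. *)
Lemma homothety_invariant_pure (t : 'I_4 -> 'I_4) (o : bool) (a b : seq R) :
  injective t ->
  (forall i : 'I_4, pure_ricci kappa (t i) - pure_scalar kappa / 4 = a`_i) ->
  pure_weyl kappa (t 0) (t 1) = b`_0 -> pure_weyl kappa (t 2) (t 3) = b`_0 ->
  pure_weyl kappa (t 0) (t 2) = b`_1 -> pure_weyl kappa (t 3) (t 1) = b`_1 ->
  pure_weyl kappa (t 0) (t 3) = b`_2 -> pure_weyl kappa (t 1) (t 2) = b`_2 ->
  homothety_invariant G y o (scalar_curvature G y) a b b.
Proof.
move=> tI ha w01 w23 w02 w31 w03 w12; split=> //.
have EBrow c : row c E *m B = 'e_c by rewrite -row_mul EB row1.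
have inner0 i j : inner G y (row (t i) E) (row (t j) E) = (i == j)%:R.
  rewrite /inner GB mulmxA EBrow -mulmxA -trmx_mul EBrow -(inj_eq tI).
  by rewrite trmx_delta mul_delta_mx_cond; case: eqP; rewrite ?mulr1n ?mulr0n mxE.
have ein i : row (t i) E *m einstein_tensor G y = a`_i *: (row (t i) E *m G y).
  apply/rowP => j; rewrite GB mulmxA EBrow -rowE !mxE.
  have Er c : \sum_k E (t i) k * B k c = (t i == c)%:R by exact: frame_delta.
  under eq_bigr => k _ do rewrite mxE (einstein_tensor_pure EB GB kappa0 riemB) mulr_sumr.
  rewrite exchange_big/=.
  rewrite (eq_bigr (fun c => (pure_ricci kappa c - pure_scalar kappa / 4) * B j c * (t i == c)%:R)) => [|c _].
    by rewrite sum_delta ha.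
  by rewrite -Er mulr_sumr; apply: eq_bigr => k _; ring.
have weylB i j k l : weyl G y i j k l = pure_tensor B (pure_weyl kappa) i j k l.
  exact: (weyl_pure EB GB kappa0 riemB).
have we c d : weyl_eigen G y (pure_weyl kappa c d) (wedge (row c E) (row d E)).
  exact: (weyl_eigen_pure EB GB pure_weylC weylB).
(* The orientation is corrected by the sign of the last vector. This changes simple bivectors by a
   sign at most, and relative signs within an eigenspace are harmless. *)
have [e e2 edet] : exists2 e : R, e ^+ 2 = 1 &
    0 < (-1) ^+ o * \det (\matrix_(i < 4) ((if i == 3 then e else 1) *: row (t i) E)).
  pose M := \matrix_(i < 4) row (t i) E.
  have detE (e : R) : \det (\matrix_(i < 4) ((if i == 3 then e else 1) *: row (t i) E)) = e * \det M.
    have -> : \matrix_(i < 4) ((if i == 3 then e else 1) *: row (t i) E) =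
        diag_mx (\row_i (if i == 3 then e else 1)) *m M.
      by rewrite mul_diag_mx; apply/matrixP => i j; rewrite !mxE.
    rewrite det_mulmx det_diag (bigD1 3)//= mxE eqxx big1 ?mulr1// => i /negbTE i3.
    by rewrite mxE i3.
  (* Orthonormality exhibits a right inverse of [M]. *)
  have d0 : \det M != 0.
    have M1 : M *m (G y *m M^T) = 1%:M.
      rewrite mulmxA; apply/matrixP => i j; rewrite [RHS]mxE -inner0 /inner.
      have rowM c : row (t c) E = row c M by rewrite rowK.
      rewrite !rowM -row_mul tr_row [LHS]mxE [RHS]mxE; apply: eq_bigr => k _.
      by rewrite [row _ _ _ _]mxE [col _ _ _ _]mxE.
    by have [+ _] := mulmx1_unit M1; rewrite unitmxE unitfE.
  have [dp|dn] := ltP 0 ((-1) ^+ o * \det M).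
    by exists 1; rewrite ?expr1n// detE mul1r.
  exists (-1); rewrite ?sqrrN ?expr1n// detE mulN1r mulrN oppr_gt0 lt_neqAle dn andbT.
  by rewrite mulf_neq0// expf_neq0// oppr_eq0 oner_neq0.
pose s (i : 'I_4) := if i == 3 then e else 1.
exists (\matrix_(i < 4) (s i *: row (t i) E)).
have rowu i : row i (\matrix_(i < 4) (s i *: row (t i) E)) = s i *: row (t i) E by rewrite rowK.
have s2 i : s i * s i = 1.
  by rewrite /s; case: ifP => _; rewrite ?mulr1// -expr2.
have eig (sg w : R) (c d c' d' : 'I_4) : pure_weyl kappa (t c) (t d) = w ->
   pure_weyl kappa (t c') (t d') = w ->
   weyl_eigen G y w (wedge (s c *: row (t c) E) (s d *: row (t d) E) +
     sg *: wedge (s c' *: row (t c') E) (s d' *: row (t d') E)).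
  move=> cd cd'; rewrite !wedge_scale scalerA.
  by apply: weyl_eigen_comb; [rewrite -cd|rewrite -cd']; exact: we.
split=> //.
- move=> i j; rewrite !rowu inner_scale inner0.
  by case: eqP => [->|_]; rewrite ?mulr0 ?mulr1.
- by move=> i; rewrite rowu -!scalemxAl ein !scalerA mulrC.
- by rewrite /weyl_eigenbasis !rowu; split; apply: eig.
- by rewrite /weyl_eigenbasis !rowu; split; apply: eig.
Qed.

End Homothety.

(** * Warped products of surfaces *)

Section HessianRules.
Context {R : realType} {n : nat}.
Variables (U : set 'rV[R]_n) (G : 'rV[R]_n -> 'M[R]_n) (mG : smooth_metric U G).
Variables (f : 'rV[R]_n -> R) (sf : smooth_on U f).
Let oU := smet_open mG.

Lemma hessian_sym y : U y -> (hessian G y f)^T = hessian G y f.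
Proof.
move=> Uy; apply/matrixP => i j; rewrite mxE.
rewrite (hessian_grad_form mG f j i Uy) (hessian_grad_form mG f i j Uy).
have -> : (fun p => christoffel1 G p j i y) = (fun p => christoffel1 G p i j y).
  by apply/funext => p; exact: (christoffel1C mG).
have S := schwarz j i oU sf Uy; exact: (congr1 (fun x => x - _) S).
Qed.

(** Meant for [h] a function of [f]: [r] is its first derivative and [a] the second derivative times
    the square of [df]. The Christoffel term is linear in [dh], so it scales with [r]. *)
Lemma hessian_entry (h : 'rV[R]_n -> R) (a : 'I_n -> 'I_n -> R) (r : R) y : U y ->
  (forall i j, partial i (partial j h) y = r * partial i (partial j f) y + a i j) ->
  (forall i, partial i h y = r * partial i f y) ->
  forall i j, hessian G y h i j = r * hessian G y f i j + a i j.
Proof.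
move=> Uy H2 H1 i j; rewrite !(hessian_grad_form mG)// H2.
have -> : (fun x => partial x h y) = (fun x => r * partial x f y) by apply/funext.
by rewrite pairingZr; ring.
Qed.

Lemma grad_form_scale (h : 'rV[R]_n -> R) (r : R) y :
  (forall i, partial i h y = r * partial i f y) ->
  grad_form G h h y = r ^+ 2 * grad_form G f f y.
Proof.
move=> H; rewrite /grad_form.
have -> : (fun x => partial x h y) = (fun x => r * partial x f y) by apply/funext.
by rewrite pairingZr pairingZl mulrA expr2.
Qed.

Lemma partial_sqr i y : U y -> partial i (fun z => f z ^+ 2) y = 2 * f y * partial i f y.
Proof.
move=> Uy; have df := smooth_derivable sf Uy.
have -> : (fun z => f z ^+ 2) = (fun z => f z * f z) by apply/funext => z; rewrite expr2.
by rewrite partialM//; ring.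
Qed.

Lemma hessian_sqr i j y : U y -> hessian G y (fun z => f z ^+ 2) i j =
  2 * f y * hessian G y f i j + 2 * partial i f y * partial j f y.
Proof.
move=> Uy; apply: (hessian_entry (a := fun i j => 2 * partial i f y * partial j f y)) => // [{}i {}j|{}i]; last exact: partial_sqr.
rewrite (@partial_eq_near _ _ _ (fun z => 2 * (f z * partial j f z))).
  rewrite partialZ; last first.
    by apply: derivableM; [exact: smooth_derivable sf Uy|exact: smooth_derivable (smooth_partial _ sf) Uy].
  rewrite partialM; last 2 first.
    exact: smooth_derivable sf Uy.
    exact: smooth_derivable (smooth_partial _ sf) Uy.
  by move: (partial _ _ y) (partial _ _ y) (partial _ _ y) => *; ring.
by apply: (open_near oU Uy) => z Uz; rewrite partial_sqr// mulrA.
Qed.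

Hypothesis f0 : forall y, U y -> f y != 0.

Lemma partial_inv i y : U y -> partial i (fun z => (f z)^-1) y = - (f y) ^- 2 * partial i f y.
Proof.
by move=> Uy; rewrite partialV ?f0//; [rewrite mulrC mulrN mulNr|exact: smooth_derivable sf Uy].
Qed.

Lemma hessian_inv i j y : U y -> hessian G y (fun z => (f z)^-1) i j =
  - (f y) ^- 2 * hessian G y f i j + 2 * (f y) ^- 3 * partial i f y * partial j f y.
Proof.
move=> Uy; have sr := smoothV oU sf f0.
apply: (hessian_entry (a := fun i j => 2 * (f y) ^- 3 * partial i f y * partial j f y)) => // [{}i {}j|{}i]; last exact: partial_inv.
rewrite (@partial_eq_near _ _ _ (fun z => - 1 * (((f z)^-1 * (f z)^-1) * partial j f z))).
  have dr := smooth_derivable sr Uy.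
  have dp := smooth_derivable (smooth_partial j sf) Uy.
  rewrite partialZ; last by apply: derivableM; [exact: derivableM|].
  rewrite partialM//; last exact: derivableM.
  rewrite partialM// !partial_inv//.
  have := f0 Uy.
  by move: (partial _ _ y) (partial _ _ y) (partial _ _ y) (f y) => *; field.
by apply: (open_near oU Uy) => z Uz; rewrite partial_inv// mulN1r mulNr expr2 invfM.
Qed.

(** Translates the harmonicity of [1 / phi] into [P + q = 2 Q]. *)
Lemma laplacian_inv y : U y -> laplacian G y (fun z => (f z)^-1) =
  - (f y) ^- 2 * laplacian G y f + 2 * (f y) ^- 3 * grad_form G f f y.
Proof.
move=> Uy; rewrite /laplacian /grad_form /pairing !mulr_sumr -big_split/=; apply: eq_bigr => i _.
rewrite !mulr_sumr -big_split/=; apply: eq_bigr => j _; rewrite hessian_inv//.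
by move: (hessian _ _ _ _ _) (partial _ _ y) (partial _ _ y) (_ ^- 2) (_ ^- 3) => *; ring.
Qed.

End HessianRules.

Section ConformalSquare.
Context {R : realType} {n : nat}.
Variables (U : set 'rV[R]_n) (G : 'rV[R]_n -> 'M[R]_n) (mG : smooth_metric U G).
Variables (f : 'rV[R]_n -> R) (sf : smooth_on U f) (f0 : forall y, U y -> f y != 0).
Let oU := smet_open mG.

Lemma smooth_inv_sqr : smooth_on U (fun z => (f z ^+ 2)^-1).
Proof. by apply: smoothV => //; [exact: smoothX|move=> y /f0 fy; rewrite expf_neq0]. Qed.

(** For the exponent -2 the square of [df] enters [conformal_term] with coefficients [-3 f^-4] and
    [3 f^-4], from the Hessian and from the quadratic term, and drops out. Only the Hessian and the
    squared gradient remain. *)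
Lemma riemann_conformal_sqr i j k l y : U y ->
  let H := hessian G y f in let Q := grad_form G f f y in
  riemann (fun z => (f z ^+ 2)^-1 *: G z) y i j k l =
  (f y) ^- 2 * riemann G y i j k l
  + (f y) ^- 3 * (G y i k * H j l + G y j l * H i k - G y i l * H j k - G y j k * H i l)
  - (f y) ^- 4 * Q * (G y i k * G y j l - G y i l * G y j k).
Proof.
move=> Uy H Q; have sr := smoothV oU sf f0.
have ur0 z : U z -> (f z ^+ 2)^-1 != 0 by move=> /f0 fz; rewrite invr_neq0// expf_neq0.
rewrite (riemann_conformal mG smooth_inv_sqr ur0)//.
have uE : (fun z => (f z ^+ 2)^-1) = (fun z => (f z)^-1 ^+ 2) by apply/funext => z; rewrite exprVn.
have du i' : partial i' (fun z => (f z ^+ 2)^-1) y = - 2 * (f y) ^- 3 * partial i' f y.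
  rewrite uE (partial_sqr sr)// (partial_inv sf f0)//.
  by have := f0 Uy; move: (partial _ _ _) (f y) => p q q0; field.
have A i' j' : conformal_term G (fun z => (f z ^+ 2)^-1) y i' j' =
    (f y) ^- 3 * H i' j' - 2^-1 * (f y) ^- 4 * Q * G y i' j'.
  have entry (p q r : R) (A1 A2 A3 : 'M[R]_n) :
      (p *: A1 + q *: A2 - r *: A3) i' j' = p * A1 i' j' + q * A2 i' j' - r * A3 i' j'.
    by rewrite !mxE.
  rewrite /conformal_term entry (grad_form_scale _ du) -/Q.
  set M := (\matrix_(_, _) _ : 'M[R]_n).
  have -> : M i' j' = 4 * (f y) ^- 6 * partial i' f y * partial j' f y.
    rewrite mxE !du; have := f0 Uy.
    by move: (partial _ _ _) (partial _ _ _) (f y) => p q r r0; field.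
  have -> : hessian G y (fun z => (f z ^+ 2)^-1) i' j' =
     - 2 * (f y) ^- 3 * H i' j' + 6 * (f y) ^- 4 * partial i' f y * partial j' f y.
    rewrite uE (hessian_sqr mG sr)// (hessian_inv mG sf f0)// !(partial_inv sf f0)// -/H.
    by have := f0 Uy; move: (H i' j') (partial _ _ _) (partial _ _ _) (f y) => p q r t t0; field.
  have := f0 Uy; rewrite /H.
  move: (hessian _ _ _ _ _) (partial _ _ _) (partial _ _ _) (G y i' j') Q (f y) => *; field.
  by [].
rewrite !A => {A}; have := f0 Uy; rewrite -/H -/Q.
move: (riemann _ _ _ _ _ _) (H _ _) (H _ _) (H _ _) (H _ _) Q (f y) => *.
move: (G y _ _) (G y _ _) (G y _ _) (G y _ _) => *; field.
by [].
Qed.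

End ConformalSquare.

Section ProductFunctions.
Context {R : realType} {m n : nat}.
Variables (U1 : set 'rV[R]_m) (G1 : 'rV[R]_m -> 'M[R]_m) (mG1 : smooth_metric U1 G1).
Variables (U2 : set 'rV[R]_n) (G2 : 'rV[R]_n -> 'M[R]_n) (mG2 : smooth_metric U2 G2).
Let mG := smooth_product_metric mG1 mG2.

Lemma hessian_product_l (f : 'rV[R]_m -> R) y : product_set U1 U2 y ->
  hessian (product_metric G1 G2) y (fun z => f (lsubmx z)) =
  block_mx (hessian G1 (lsubmx y) f) 0 0 0.
Proof.
move=> Uy; apply/matrixP => i j; rewrite (hessian_grad_form mG _ i j Uy).
rewrite (invmx_product_metric mG1 mG2 Uy) pairing_block.
rewrite (christoffel1_product_l G1 G2 i j y) (christoffel1_product_r G1 G2 i j y).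
have -> : (fun p => partial (lshift n p) (fun z : 'rV[R]_(m + n) => f (lsubmx z)) y) =
    (fun p => partial p f (lsubmx y)).
  by apply/funext => p; rewrite partial_lsubmx_l.
have -> : (fun p => partial (rshift m p) (fun z : 'rV[R]_(m + n) => f (lsubmx z)) y) =
    (fun=> 0).
  by apply/funext => p; rewrite partial_lsubmx_r.
case: Uy => U1y _; rewrite pairing0r addr0 block_diagE.
case: (split_ordP j) => j' ->.
  rewrite partial_lsubmx_l; case: (split_ordP i) => i' ->.
    by rewrite partial_lsubmx_l (hessian_grad_form mG1).
  by rewrite partial_lsubmx_r pairing0l subr0.
rewrite partial_lsubmx_r partial_cst.
by case: (split_ordP i) => i' _ /=; rewrite pairing0l subr0 ?mxE.
Qed.

Lemma grad_form_product_l (f : 'rV[R]_m -> R) y : product_set U1 U2 y ->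
  let F := fun z => f (lsubmx z) in
  grad_form (product_metric G1 G2) F F y = grad_form G1 f f (lsubmx y).
Proof.
move=> Uy; rewrite /grad_form (invmx_product_metric mG1 mG2 Uy) pairing_block.
have -> : (fun p => partial (lshift n p) (fun z : 'rV[R]_(m + n) => f (lsubmx z)) y) =
    (fun p => partial p f (lsubmx y)).
  by apply/funext => p; rewrite partial_lsubmx_l.
have -> : (fun p => partial (rshift m p) (fun z : 'rV[R]_(m + n) => f (lsubmx z)) y) =
    (fun=> 0).
  by apply/funext => p; rewrite partial_lsubmx_r.
by rewrite pairing0r addr0.
Qed.

Lemma hessian_product_r (f : 'rV[R]_n -> R) y : product_set U1 U2 y ->
  hessian (product_metric G1 G2) y (fun z => f (rsubmx z)) =
  block_mx 0 0 0 (hessian G2 (rsubmx y) f).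
Proof.
move=> Uy; apply/matrixP => i j; rewrite (hessian_grad_form mG _ i j Uy).
rewrite (invmx_product_metric mG1 mG2 Uy) pairing_block.
rewrite (christoffel1_product_l G1 G2 i j y) (christoffel1_product_r G1 G2 i j y).
have -> : (fun p => partial (rshift m p) (fun z : 'rV[R]_(m + n) => f (rsubmx z)) y) =
    (fun p => partial p f (rsubmx y)).
  by apply/funext => p; rewrite partial_rsubmx_r.
have -> : (fun p => partial (lshift n p) (fun z : 'rV[R]_(m + n) => f (rsubmx z)) y) =
    (fun=> 0).
  by apply/funext => p; rewrite partial_rsubmx_l.
case: Uy => _ U2y; rewrite pairing0r add0r block_diagE.
case: (split_ordP j) => j' ->.
  rewrite partial_rsubmx_l partial_cst.
  by case: (split_ordP i) => i' _ /=; rewrite pairing0l subr0 ?mxE.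
rewrite partial_rsubmx_r; case: (split_ordP i) => i' ->.
  by rewrite partial_rsubmx_l pairing0l subr0.
by rewrite partial_rsubmx_r (hessian_grad_form mG2).
Qed.

Lemma grad_form_product_r (f : 'rV[R]_n -> R) y : product_set U1 U2 y ->
  let F := fun z => f (rsubmx z) in
  grad_form (product_metric G1 G2) F F y = grad_form G2 f f (rsubmx y).
Proof.
move=> Uy; rewrite /grad_form (invmx_product_metric mG1 mG2 Uy) pairing_block.
have -> : (fun p => partial (rshift m p) (fun z : 'rV[R]_(m + n) => f (rsubmx z)) y) =
    (fun p => partial p f (rsubmx y)).
  by apply/funext => p; rewrite partial_rsubmx_r.
have -> : (fun p => partial (lshift n p) (fun z : 'rV[R]_(m + n) => f (rsubmx z)) y) =
    (fun=> 0).
  by apply/funext => p; rewrite partial_rsubmx_l.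
by rewrite pairing0r add0r.
Qed.

End ProductFunctions.

Section PureAlgebra.
Context {R : comNzRingType} {n : nat}.
Variable B : 'M[R]_n.

Definition frame_form (x : 'I_n -> R) (i j : 'I_n) : R := \sum_a x a * (B i a * B j a).

Lemma kulkarni_pure x z i j k l :
  frame_form x i k * frame_form z j l - frame_form x i l * frame_form z j k =
  pure_tensor B (fun a b => x a * z b) i j k l.
Proof.
rewrite -!sum2_factor -sumrB; apply: eq_bigr => a _; rewrite -sumrB.
by apply: eq_bigr => b _; ring.
Qed.

Lemma pure_tensorD u v i j k l :
  pure_tensor B u i j k l + pure_tensor B v i j k l =
  pure_tensor B (fun a b => u a b + v a b) i j k l.
Proof.
rewrite -big_split/=; apply: eq_bigr => a _; rewrite -big_split/=.
by apply: eq_bigr => b _; rewrite mulrDl.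
Qed.

Lemma pure_tensorZ s u i j k l :
  s * pure_tensor B u i j k l = pure_tensor B (fun a b => s * u a b) i j k l.
Proof.
rewrite mulr_sumr; apply: eq_bigr => a _; rewrite mulr_sumr.
by apply: eq_bigr => b _; rewrite mulrA.
Qed.

(** The term with [a = b] is zero by alternation, so the weights may be normalized to vanish on the
    diagonal. *)
Lemma pure_tensor_eq u v i j k l : (forall a b, a != b -> u a b = v a b) ->
  pure_tensor B u i j k l = pure_tensor B v i j k l.
Proof.
move=> uv; apply: eq_bigr => a _; apply: eq_bigr => b _.
have [->|ab] := eqVneq a b; last by rewrite uv.
have -> : B i b * B k b * B j b * B l b - B i b * B l b * B j b * B k b = 0 by ring.
by rewrite !mulr0.
Qed.

End PureAlgebra.

Lemma block_frame_form (R : comNzRingType) m n (r : R) (b1 : 'M[R]_m) (b2 : 'M[R]_n) x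
    (X1 : 'M[R]_m) (X2 : 'M[R]_n) i j :
  (forall i j, X1 i j = r ^+ 2 * frame_form b1 (fun a => x (lshift n a)) i j) ->
  (forall i j, X2 i j = r ^+ 2 * frame_form b2 (fun a => x (rshift m a)) i j) ->
  block_mx X1 0 0 X2 i j = frame_form (block_mx (r *: b1) 0 0 (r *: b2)) x i j.
Proof.
move=> H1 H2; rewrite /frame_form big_split_ord/=.
case: (split_ordP i) => i' ->; case: (split_ordP j) => j' ->.
- rewrite block_mxEul H1 [X in _ + X]big1 ?addr0 => [|a _].
    by rewrite mulr_sumr; apply: eq_bigr => a _; rewrite !block_mxEul !mxE; ring.
  by rewrite block_mxEur mxE mul0r mulr0.
- rewrite block_mxEur mxE !big1 ?addr0// => a _.
    by rewrite ?(block_mxEur, block_mxEdl) !(@mxE R) ?mul0r ?mulr0.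
  by rewrite ?(block_mxEur, block_mxEdl) !(@mxE R) ?mul0r ?mulr0.
- rewrite block_mxEdl mxE !big1 ?addr0// => a _.
    by rewrite ?(block_mxEur, block_mxEdl) !(@mxE R) ?mul0r ?mulr0.
  by rewrite ?(block_mxEur, block_mxEdl) !(@mxE R) ?mul0r ?mulr0.
- rewrite block_mxEdr H2 [X in X + _]big1 ?add0r => [|a _].
    by rewrite mulr_sumr; apply: eq_bigr => a _; rewrite !block_mxEdr !mxE; ring.
  by rewrite block_mxEdl mxE mul0r mulr0.
Qed.

(** * Simultaneous diagonalization in dimension two *)

Section SimultaneousDiagonalization.
Context {R : realType}.

Definition posdef n (g : 'M[R]_n) : Prop := forall v : 'rV[R]_n, v != 0 -> 0 < (v *m g *m v^T) 0 0.

Definition mx2 (a b c d : R) : 'M[R]_2 :=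
  \matrix_(i, j) (if i == 0 then if j == 0 then a else b else if j == 0 then c else d).

Lemma matrix2P (A C : 'M[R]_2) : A 0 0 = C 0 0 -> A 0 1 = C 0 1 -> A 1 0 = C 1 0 ->
  A 1 1 = C 1 1 -> A = C.
Proof. by move=> *; apply/matrixP; apply: ord2P; apply: ord2P. Qed.

(** A lower triangular factor, whose diagonal entries are the square roots of [g 0 0] and of its
    Schur complement. *)
Lemma cholesky2 (g : 'M[R]_2) : g^T = g -> posdef g ->
  exists2 b : 'M[R]_2, b \in unitmx & g = b *m b^T.
Proof.
move=> sg pg; have s01 : g 1 0 = g 0 1 by rewrite -{1}sg mxE.
have q (x z : R) : (x != 0) || (z != 0) -> 0 < g 0 0 * x ^+ 2 + 2 * g 0 1 * x * z + g 1 1 * z ^+ 2.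
  move=> xz; have v0 : (\row_i (if i == 0 then x else z) : 'rV[R]_2) != 0.
    apply: contraTneq xz => /rowP v0; have := v0 0; have := v0 1; rewrite !mxE /= => -> ->.
    by rewrite eqxx.
  have := pg _ v0; rewrite !mxE !sum2E !mxE !sum2E !mxE /= s01.
  by congr (0 < _); ring.
have g0 : 0 < g 0 0 by have := q 1 0; rewrite oner_eq0 => /(_ isT); congr (0 < _); ring.
(* The Schur complement is the value of the form on the vector [(- g01 / g00, 1)]. *)
have d0 : 0 < g 1 1 - g 0 1 ^+ 2 / g 0 0.
  have := q (- g 0 1 / g 0 0) 1; rewrite oner_eq0 orbT => /(_ isT); congr (0 < _).
  by field; rewrite gt_eqF.
have r0 : 0 < Num.sqrt (g 0 0) by rewrite sqrtr_gt0.
have r1 : 0 < Num.sqrt (g 1 1 - g 0 1 ^+ 2 / g 0 0) by rewrite sqrtr_gt0.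
have := sqr_sqrtr (ltW g0); have := sqr_sqrtr (ltW d0).
move: r0 r1; set r := Num.sqrt _; set t := Num.sqrt _ => r0 r1 tE rE.
exists (mx2 r 0 (g 0 1 / r) t).
  by rewrite unitmxE det2E !mxE /= mul0r subr0 unitfE mulf_neq0// gt_eqF.
have rn : r != 0 by rewrite gt_eqF.
apply: matrix2P; rewrite !mxE !sum2E !mxE /= ?s01.
- by rewrite -rE; ring.
- by field.
- by field.
- by rewrite -[t * t]expr2 tE -rE; field.
Qed.

Lemma orthogonal_diag2 (A : 'M[R]_2) : A^T = A ->
  exists (o : 'M[R]_2) (p : 'I_2 -> R), o *m o^T = 1%:M /\
    forall i j, A i j = \sum_a p a * (o i a * o j a).
Proof.
move=> sA; have s01 : A 1 0 = A 0 1 by rewrite -{1}sA mxE.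
(* A diagonal matrix is treated apart: [d] could vanish for it, and with it the eigenvector
   [(A01, d)] used below. *)
have [b0|b0] := eqVneq (A 0 1) 0.
  exists 1%:M, (fun a => A a a); split; first by rewrite trmx1 mulmx1.
  by move=> i j; elim/ord2P: i; elim/ord2P: j; rewrite sum2E !mxE/= ?s01 ?b0 ?mulr1n ?mulr0n ?(mulr0, mulr1, addr0, add0r).
pose disc := (A 0 0 - A 1 1) ^+ 2 + 4 * A 0 1 ^+ 2.
have disc0 : 0 <= disc by rewrite /disc addr_ge0 ?sqr_ge0// mulr_ge0 ?sqr_ge0 ?ler0n.
have dE := sqr_sqrtr disc0; move: dE; set sq := Num.sqrt disc => dE.
(* A root of [d (d + A00 - A11) = A01^2], chosen so that [(A01, d)] and [(- d, A01)] are
   eigenvectors for [A00 + d] and [A11 - d]. *)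
pose d := (A 1 1 - A 0 0 + sq) / 2.
have d2 : d * (d + A 0 0 - A 1 1) = A 0 1 ^+ 2.
  have -> : d * (d + A 0 0 - A 1 1) = (sq ^+ 2 - (A 0 0 - A 1 1) ^+ 2) / 4 by rewrite /d; field.
  by rewrite dE /disc; field.
have dn0 : d != 0 by apply: contraNneq b0 => d0; rewrite -sqrf_eq0 -d2 d0 mul0r.
have gE : A 1 1 = d + A 0 0 - A 0 1 ^+ 2 / d by rewrite -d2; field.
have N0 : 0 < A 0 1 ^+ 2 + d ^+ 2 by rewrite ltr_pwDl ?sqr_ge0// lt_def sqr_ge0 andbT sqrf_eq0.
have NE := sqr_sqrtr (ltW N0).
have rN0 : Num.sqrt (A 0 1 ^+ 2 + d ^+ 2) != 0 by rewrite gt_eqF// sqrtr_gt0.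
move: rN0 NE; set N := Num.sqrt _ => rN0 NE.
have Nn : N ^+ 2 != 0 by rewrite sqrf_eq0.
exists (mx2 (A 0 1 / N) (- d / N) (d / N) (A 0 1 / N)).
exists (fun a => if a == 0 then A 0 0 + d else A 1 1 - d).
have H4 (x z : R) : x * N ^+ 2 = z -> x = z / N ^+ 2 by move=> <-; rewrite mulfK.
split.
  apply: matrix2P; rewrite !mxE !sum2E !mxE /= ?mulr1n ?mulr0n.
  - by apply/esym; rewrite (H4 1 (A 0 1 ^+ 2 + d ^+ 2)) ?mul1r//; field.
  - by field.
  - by field.
  - by apply/esym; rewrite (H4 1 (A 0 1 ^+ 2 + d ^+ 2)) ?mul1r//; field.
move=> i j; elim/ord2P: i; elim/ord2P: j; rewrite !sum2E !mxE /= ?s01.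
all: rewrite ?gE; move: (A 0 0) (A 0 1) NE rN0 dn0 Nn => a b NE' rN0' dn0' Nn'.
all: have frac (x z : R) : x / N * (z / N) = x * z / (b ^+ 2 + d ^+ 2) by (rewrite -NE'; field).
all: rewrite NE' in Nn'; rewrite !frac; move: dn0' Nn'; clear; move: d => d hd hn; field; by rewrite ?hd ?hn.
Qed.

(** The Cholesky factor reduces [g] to the identity, and the transported [H] is then diagonalized by
    an orthogonal matrix, which leaves the identity alone. *)
Lemma simultaneous_diag2 (g H : 'M[R]_2) : g^T = g -> posdef g -> H^T = H ->
  exists (e b : 'M[R]_2) (p : 'I_2 -> R), [/\ e *m b = 1%:M, g = b *m b^T &
    forall i j, H i j = frame_form b p i j].
Proof.
move=> sg pg sH; have [b0 ub gE] := cholesky2 sg pg.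
have [|o [p [oo AE]]] := @orthogonal_diag2 (invmx b0 *m H *m (invmx b0)^T).
  by rewrite !trmx_mul trmxK sH mulmxA.
exists (o^T *m invmx b0), (b0 *m o), p; split.
- rewrite mulmxA -(mulmxA o^T) mulVmx// mulmx1; exact: mulmx1C oo.
- by rewrite trmx_mul mulmxA -(mulmxA b0) oo mulmx1.
move=> i j; have -> : H = b0 *m (invmx b0 *m H *m (invmx b0)^T) *m b0^T.
  rewrite !mulmxA mulmxV// mul1mx -mulmxA -trmx_mul mulmxV// trmx1 mulmx1//.
have -> : invmx b0 *m H *m (invmx b0)^T = o *m diag_mx (\row_a p a) *m o^T.
  apply/matrixP => k l; rewrite AE mul_mx_diag mxE; apply: eq_bigr => a _.
  by rewrite !mxE; ring.
rewrite !mulmxA -[_ *m o^T *m _]mulmxA -trmx_mul mul_mx_diag mxE; apply: eq_bigr => a _.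
by rewrite !mxE; ring.
Qed.

End SimultaneousDiagonalization.

Section HessianEigenvalues.
Context {R : realType}.
Variables (U : set 'rV[R]_2) (G : 'rV[R]_2 -> 'M[R]_2) (mG : smooth_metric U G).
Variables (f : 'rV[R]_2 -> R) (y : 'rV[R]_2) (e b : 'M[R]_2) (p : 'I_2 -> R).
Hypotheses (eb : e *m b = 1%:M) (gb : G y = b *m b^T).
Hypothesis hb : forall i j, hessian G y f i j = frame_form b p i j.

Lemma laplacian_frame : laplacian G y f = p 0 + p 1.
Proof.
rewrite /laplacian.
transitivity (\sum_i \sum_j invmx (G y) i j * (\sum_a \sum_(c < 2) (p a * (a == c)%:R) * (b i a * b j c))).
  apply: eq_bigr => i _; apply: eq_bigr => j _; congr (_ * _).
  rewrite hb; apply: eq_bigr => a _; rewrite -(sum_delta (fun c => p a * (b i a * b j c)) a).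
  by apply: eq_bigr => c _; ring.
rewrite sum2_pull -sum2E; apply: eq_bigr => a _.
rewrite -[RHS](sum_delta (fun c => p a) a); apply: eq_bigr => c _.
rewrite (frame_trace eb gb).
by case: (a == c); rewrite ?mulr1 ?mulr0.
Qed.

Lemma hessian_pure_frame :
  2 *: hessian G y f = laplacian G y f *: G y <-> p 0 = p 1.
Proof.
have EBd c d : \sum_k e c k * b k d = (c == d)%:R by exact: frame_delta.
rewrite laplacian_frame; split=> [/matrixP H|E].
  (* Evaluation on the first frame vector twice selects the first weight; applied to both sides it
     gives [2 p0 = p0 + p1]. *)
  have proj (x : 'I_2 -> R) : \sum_i \sum_j (e 0 i * e 0 j) * frame_form b x i j = x 0.
    transitivity (\sum_i \sum_j (e 0 i * e 0 j) * (\sum_a \sum_(c < 2) (x a * (a == c)%:R) * (b i a * b j c))).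
      apply: eq_bigr => i _; apply: eq_bigr => j _; congr (_ * _).
      apply: eq_bigr => a _; rewrite -(sum_delta (fun c => x a * (b i a * b j c)) a).
      by apply: eq_bigr => c _; ring.
    rewrite sum2_pull.
    transitivity (\sum_a \sum_(c < 2) x a * (a == c)%:R * ((0 == a)%:R * (0 == c)%:R)).
      apply: eq_bigr => a _; apply: eq_bigr => c _; congr (_ * _).
      rewrite -!EBd -sum2_factor; apply: eq_bigr => i _; apply: eq_bigr => j _; ring.
    by rewrite !sum2E !eqxx /= !(mulr1, mulr0, addr0).
  have L : \sum_i \sum_j (e 0 i * e 0 j) * (2 *: hessian G y f) i j = 2 * p 0.
    rewrite -(proj p) mulr_sumr; apply: eq_bigr => i _; rewrite mulr_sumr; apply: eq_bigr => j _.
    by rewrite mxE hb mulrCA.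
  have L' : \sum_i \sum_j (e 0 i * e 0 j) * ((p 0 + p 1) *: G y) i j = p 0 + p 1.
    rewrite -[RHS](proj (fun=> p 0 + p 1)); apply: eq_bigr => i _; apply: eq_bigr => j _.
    by rewrite mxE (frame_metricE gb) mulr_sumr.
  have LL : 2 * p 0 = p 0 + p 1.
    by rewrite -L -L'; apply: eq_bigr => i _; apply: eq_bigr => j _; rewrite H.
  by move: LL; move: (p 0) (p 1) => x z LL; lra.
apply/matrixP => i j; rewrite mxE [RHS]mxE hb (frame_metricE gb) !mulr_sumr.
apply: eq_bigr => a _; have -> : p a = p 0 by elim/ord2P: a.
by rewrite -E; ring.
Qed.

(** Both determinants contain the square of [\det b], so their quotient depends only on the
    eigenvalues. *)
Lemma hessian_det_frame : \det (hessian G y f) / \det (G y) = p 0 * p 1.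
Proof.
have db : \det b != 0.
  by apply/eqP => b0; move/(congr1 determinant)/eqP: eb; rewrite det_mulmx b0 mulr0 det1 eq_sym oner_eq0.
have -> : \det (hessian G y f) = p 0 * p 1 * \det b ^+ 2.
  by rewrite !det2E !hb /frame_form !sum2E; ring.
by rewrite gb det_mulmx det_tr -expr2 mulfK// expf_neq0.
Qed.

End HessianEigenvalues.

Section ProductFrame.
Context {R : realType}.

(** The indices 2 and 3 are the directions of [Pi], along which [f] is constant. *)
Definition hess_weight (P q : R) (a : nat) : R :=
  match a with 0 => P | 1 => q | _ => 0 end.

(* Eigenvalues of the curvature of [(g + h) / f^2] on the coordinate planes of a
   frame diagonalizing [g], [h] and the Hessian of [f] on the first factor: [k]
   and [l] are [f^2] times the Gaussian curvatures, [P] and [q] are [f] times the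
   eigenvalues of the Hessian, and [Q] is the squared length of the gradient. *)
Definition product_kappa (k l P q Q : R) (a b : 'I_4) : R :=
  if a == b then 0 else
  (if (a < 2)%N && (b < 2)%N then k else 0) + (if (1 < a)%N && (1 < b)%N then l else 0)
  + (hess_weight P q a + hess_weight P q b) - Q.

Lemma product_kappaC k l P q Q a b : product_kappa k l P q Q a b = product_kappa k l P q Q b a.
Proof.
rewrite /product_kappa eq_sym andbC [(1 < b)%N && _]andbC.
by rewrite [hess_weight _ _ a + _]addrC.
Qed.

Lemma product_kappa0 k l P q Q a : product_kappa k l P q Q a a = 0.
Proof. by rewrite /product_kappa eqxx. Qed.

Variables (U1 : set 'rV[R]_2) (G1 : 'rV[R]_2 -> 'M[R]_2) (mG1 : smooth_metric U1 G1).
Variables (U2 : set 'rV[R]_2) (G2 : 'rV[R]_2 -> 'M[R]_2) (mG2 : smooth_metric U2 G2).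
Variables (f : 'rV[R]_2 -> R) (sf : smooth_on U1 f) (f0 : forall z, U1 z -> f z != 0).

Definition warped_metric (z : 'rV[R]_(2 + 2)) : 'M[R]_(2 + 2) :=
  (f (lsubmx z) ^+ 2)^-1 *: product_metric G1 G2 z.

Lemma riemann_warped i j k l y : product_set U1 U2 y ->
  let S := block_mx (G1 (lsubmx y)) 0 0 0 in
  let T := block_mx 0 0 0 (G2 (rsubmx y)) in
  let H := block_mx (hessian G1 (lsubmx y) f) 0 0 0 in
  let G := product_metric G1 G2 y in
  let r := f (lsubmx y) in
  riemann warped_metric y i j k l =
  r ^- 2 * (gauss_curvature G1 (lsubmx y) * (S i k * S j l - S i l * S j k)
            + gauss_curvature G2 (rsubmx y) * (T i k * T j l - T i l * T j k))
  + r ^- 3 * (G i k * H j l + G j l * H i k - G i l * H j k - G j k * H i l)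
  - r ^- 4 * grad_form G1 f f (lsubmx y) * (G i k * G j l - G i l * G j k).
Proof.
move=> Uy S T H G r.
have sF : smooth_on (product_set U1 U2) (fun z : 'rV[R]_(2 + 2) => f (lsubmx z)).
  by apply: smooth_sub (smooth_lsubmx sf) => z [].
have F0 z : product_set U1 U2 z -> f (lsubmx z) != 0 by move=> [/f0].
rewrite (riemann_conformal_sqr (smooth_product_metric mG1 mG2) sF F0)//.
rewrite (hessian_product_l mG1 mG2 f Uy) (grad_form_product_l mG1 mG2 f Uy).
rewrite (riemann_product_metric mG1 mG2 Uy (riemann_surface mG1 Uy.1) (riemann_surface mG2 Uy.2)).
by [].
Qed.

Lemma warped_frame y : product_set U1 U2 y ->
  posdef (G1 (lsubmx y)) -> posdef (G2 (rsubmx y)) ->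
  exists (E B : 'M[R]_4) (p0 p1 : R),
    let r := f (lsubmx y) in
    [/\ E *m B = 1%:M, warped_metric y = B *m B^T,
      forall i j k l, riemann warped_metric y i j k l =
        pure_tensor B (product_kappa (r ^+ 2 * gauss_curvature G1 (lsubmx y))
          (r ^+ 2 * gauss_curvature G2 (rsubmx y)) (r * p0) (r * p1)
          (grad_form G1 f f (lsubmx y))) i j k l,
      laplacian G1 (lsubmx y) f = p0 + p1 /\
        \det (hessian G1 (lsubmx y) f) / \det (G1 (lsubmx y)) = p0 * p1 &
      2 *: hessian G1 (lsubmx y) f = laplacian G1 (lsubmx y) f *: G1 (lsubmx y) <-> p0 = p1].
Proof.
move=> Uy pd1 pd2; have [U1y U2y] := Uy; have r0 := f0 U1y.
have [e1 [b1 [p [eb1 gb1 hb1]]]] := simultaneous_diag2 (smet_sym mG1 U1y) pd1 (hessian_sym mG1 sf U1y).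
(* Only an orthonormal frame of the second factor is wanted, so its metric also serves as the form
   to be diagonalized. *)
have [e2 [b2 [_ [eb2 gb2 _]]]] := simultaneous_diag2 (smet_sym mG2 U2y) pd2 (smet_sym mG2 U2y).
set r := f (lsubmx y) in r0 *.
(* Dividing the metric by [r^2] multiplies orthonormal vectors by [r] and their dual covectors by
   [r^-1]. *)
exists (block_mx (r *: e1) 0 0 (r *: e2)), (block_mx (r^-1 *: b1) 0 0 (r^-1 *: b2)), (p 0), (p 1).
move=> r'; set B := block_mx (r^-1 *: b1) _ _ _.
split=> //.
- apply: etrans (mulmx_block (r *: e1) 0 0 (r *: e2) (r^-1 *: b1) 0 0 (r^-1 *: b2)) _.
  rewrite !mulmx0 !mul0mx !addr0 !add0r.
  by rewrite -!scalemxAl -!scalemxAr !scalerA !divff// !scale1r eb1 eb2 -scalar_mx_block.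
- have BT : B^T = block_mx (r^-1 *: b1)^T 0 0 (r^-1 *: b2)^T.
    by apply: etrans (tr_block_mx (r^-1 *: b1) 0 0 (r^-1 *: b2)) _; rewrite !trmx0.
  rewrite BT; apply/esym.
  apply: etrans (mulmx_block (r^-1 *: b1) 0 0 (r^-1 *: b2) (r^-1 *: b1)^T 0 0 (r^-1 *: b2)^T) _.
  rewrite !mulmx0 !mul0mx !addr0 !add0r.
  rewrite !linearZ/= -!scalemxAl !scalerA -gb1 -gb2 /warped_metric /product_metric.
  by rewrite scale_block_mx !scaler0 -/r -invfM -expr2.
- move=> i j k l; rewrite riemann_warped//= -/r.
  have fr (x : 'I_(2 + 2) -> R) (X1 X2 : 'M[R]_2) i' j' :
     (forall i j, X1 i j = frame_form b1 (fun a => r ^- 2 * x (lshift 2 a)) i j) ->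
     (forall i j, X2 i j = frame_form b2 (fun a => r ^- 2 * x (rshift 2 a)) i j) ->
     block_mx X1 0 0 X2 i' j' = frame_form B x i' j'.
    move=> H1 H2; apply: block_frame_form => u v; rewrite ?H1 ?H2 /frame_form mulr_sumr;
      by apply: eq_bigr => a _; rewrite -exprVn; ring.
  (* Weights of the two pulled-back metrics and of the Hessian in the rescaled coframe; [r ^+ 2]
     makes up for the factor [r^-1] in each covector. *)
  pose s (a : 'I_4) : R := if (a < 2)%N then r ^+ 2 else 0.
  pose t (a : 'I_4) : R := if (1 < a)%N then r ^+ 2 else 0.
  pose h (a : 'I_4) : R := r ^+ 2 * hess_weight (p 0) (p 1) a.
  have rr : r ^- 2 * r ^+ 2 = 1 by rewrite mulVf// expf_neq0.
  have Sf i' j' : block_mx (G1 (lsubmx y)) 0 0 (0 : 'M[R]_2) i' j' = frame_form B s i' j'.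
    apply: fr => u v; last by rewrite /frame_form big1 ?mxE// => a _; rewrite /s /= mulr0 mul0r.
    rewrite (frame_metricE gb1); apply: eq_bigr => a _; rewrite /s /=.
    by rewrite ltn_ord rr mul1r.
  have Tf i' j' : block_mx (0 : 'M[R]_2) 0 0 (G2 (rsubmx y)) i' j' = frame_form B t i' j'.
    apply: fr => u v.
      rewrite /frame_form big1 ?mxE// => a _; rewrite /t /=.
      by rewrite ltnNge -ltnS ltn_ord mulr0 mul0r.
    rewrite (frame_metricE gb2); apply: eq_bigr => a _; rewrite /t /=.
    by rewrite rr mul1r.
  have Hf i' j' : block_mx (hessian G1 (lsubmx y) f) 0 0 (0 : 'M[R]_2) i' j' = frame_form B h i' j'.
    apply: fr => u v; last by rewrite /frame_form big1 ?mxE// => a _; rewrite /h /= !mulr0 mul0r.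
    rewrite hb1; apply: eq_bigr => a _; rewrite /h [r ^- 2 * (_ * _)]mulrA rr mul1r.
    by congr (_ * _); elim/ord2P: a.
  have Gf i' j' : product_metric G1 G2 y i' j' = frame_form B (fun=> r ^+ 2) i' j'.
    apply: fr => u v; [rewrite (frame_metricE gb1)|rewrite (frame_metricE gb2)];
      by apply: eq_bigr => a _; rewrite rr mul1r.
  rewrite !Sf !Tf !Hf !Gf !kulkarni_pure.
  rewrite [frame_form B (fun=> _) j l * _]mulrC [frame_form B (fun=> _) j k * _]mulrC.
  (* Regrouped into two differences, each of the form treated by [kulkarni_pure]. *)
  have -> : forall q1 q2 q3 q4 : R, q1 + q2 - q3 - q4 = (q1 - q3) + (q2 - q4) by move=> *; ring.
  rewrite !kulkarni_pure -mulNr !(pure_tensorD, pure_tensorZ); apply: pure_tensor_eq => a c ac.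
  rewrite /product_kappa (negbTE ac) /s /t /h; move: ac => _.
  have wt (u : 'I_4) : hess_weight (r * p 0) (r * p 1) u = r * hess_weight (p 0) (p 1) u.
    by case: (u : nat) => [|[|?]] /=; rewrite ?mulr0.
  rewrite !wt; have lt1 (u : 'I_4) : (1 < u)%N = ~~ (u < 2)%N by rewrite leqNgt.
  rewrite !lt1.
  move: (hess_weight _ _ _) (hess_weight _ _ _) (grad_form _ _ _ _) => w1 w2 Q.
  rewrite /r'; have := r0; clearbody r.
  move: (gauss_curvature _ _) (gauss_curvature _ _) (r) => K1 K2 x x0.
  by case: (a < 2)%N; case: (c < 2)%N => /=; field.
- by rewrite (laplacian_frame eb1 gb1 hb1) (hessian_det_frame eb1 gb1 hb1).
- exact: (hessian_pure_frame eb1 gb1 hb1).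
Qed.

End ProductFrame.

Lemma sum4E (V : nmodType) (F : 'I_4 -> V) : \sum_i F i = F 0 + F 1 + F 2 + F 3.
Proof.
rewrite 4!big_ord_recl big_ord0 addr0 !addrA.
by congr (F _ + F _ + F _ + F _); exact: val_inj.
Qed.

Lemma ord4P (P : 'I_4 -> Prop) : P 0 -> P 1 -> P 2 -> P 3 -> forall i, P i.
Proof.
move=> P0 P1 P2 P3 [[|[|[|[|i]]]] Hi] //;
  [move: P0|move: P1|move: P2|move: P3]; congr (P _); exact: val_inj.
Qed.

(** * Algebra of the eigenvalues at a point *)

Section Pointwise.
Context {R : realType}.
Variables (G : 'rV[R]_4 -> 'M[R]_4) (y : 'rV[R]_4) (B E : 'M[R]_4).
Variables (k l P q Q : R).
Let kappa := product_kappa k l P q Q.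
Hypotheses (EB : E *m B = 1%:M) (GB : G y = B *m B^T).
Hypothesis riemB : forall i j m n, riemann G y i j m n = pure_tensor B kappa i j m n.
Let kC : forall a b, kappa a b = kappa b a := product_kappaC k l P q Q.
Let k0 : forall a, kappa a a = 0 := product_kappa0 k l P q Q.

Lemma einstein_tensor_eq0 :
  einstein_tensor G y = 0 <-> forall a, pure_ricci kappa a = pure_scalar kappa / 4.
Proof.
have eE := einstein_tensor_pure EB GB k0 riemB.
have EBd c d : \sum_m E c m * B m d = (c == d)%:R by exact: frame_delta.
split=> [/matrixP e0 a|H]; last first.
  by apply/matrixP => i j; rewrite eE big1 ?mxE// => a _; rewrite H subrr mul0r.
apply/eqP; rewrite -subr_eq0; apply/eqP.
have : \sum_i E a i * (\sum_j E a j * einstein_tensor G y i j) = 0.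
  by rewrite big1// => i _; rewrite big1 ?mulr0// => j _; rewrite e0 mxE mulr0.
rewrite (eq_bigr (fun i => E a i * ((pure_ricci kappa a - pure_scalar kappa / 4) * B i a))) => [|i _].
  move=> <-; have one : \sum_m E a m * B m a = 1 by rewrite EBd eqxx.
  rewrite -[LHS]mulr1 -one.
  by rewrite mulr_sumr; apply: eq_bigr => i _; rewrite mulrCA.
congr (_ * _).
rewrite (eq_bigr (fun j => \sum_c (pure_ricci kappa c - pure_scalar kappa / 4) * B i c * (E a j * B j c))) => [|j _].
  rewrite exchange_big/= -[RHS](sum_delta (fun c => (pure_ricci kappa c - pure_scalar kappa / 4) * B i c) a).
  by apply: eq_bigr => c _; rewrite -mulr_sumr EBd.
by rewrite eE mulr_sumr; apply: eq_bigr => c _; ring.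
Qed.

(** Equal indices are excluded because no plane corresponds to them and [pure_weyl] need not vanish
    there. For distinct ones the eigenvalue equation for the nonzero bivector of the plane gives the
    claim. *)
Lemma weyl_eq0 :
  (forall i j m n, weyl G y i j m n = 0) <-> (forall a b, a != b -> pure_weyl kappa a b = 0).
Proof.
have wE := weyl_pure EB GB k0 riemB; split=> [w0 a b ab|H i j m n]; last first.
  rewrite wE (@pure_tensor_eq _ _ _ _ (fun _ _ => 0)) // /pure_tensor.
  by rewrite big1// => a _; rewrite big1// => b _; rewrite mul0r.
have we := weyl_eigen_pure EB GB (pure_weylC kC) wE a b.
have EBd c d : \sum_m E c m * B m d = (c == d)%:R by exact: frame_delta.
have Z m n : wedge (row a E) (row b E) m n = E a m * E b n - E b m * E a n.
  by rewrite /wedge !mxE !big_ord1 !mxE.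
have lower c i' : \sum_k G y i' k * E c k = B i' c.
  have := EB; move/mulmx1C => BE.
  have -> : \sum_k G y i' k * E c k = (G y *m E^T) i' c.
    by rewrite mxE; apply: eq_bigr => m _; rewrite mxE.
  by rewrite GB -mulmxA -trmx_mul EB trmx1 mulmx1.
have {}we i j : 0 = pure_weyl kappa a b * (B i a * B j b - B i b * B j a).
  have := we i j; rewrite (_ : \sum_k \sum_l weyl _ _ _ _ _ _ * _ = 0) ?mulr0; last first.
    by rewrite big1// => m _; rewrite big1// => n _; rewrite w0 mul0r.
  move=> ->; congr (_ * _); rewrite -!lower -!sum2_factor -sumrB; apply: eq_bigr => m _.
  by rewrite -sumrB; apply: eq_bigr => n _; rewrite Z; ring.
have : \sum_i \sum_j E a i * E b j * (pure_weyl kappa a b * (B i a * B j b - B i b * B j a)) = 0.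
  by rewrite big1// => i _; rewrite big1// => j _; rewrite -we mulr0.
rewrite (_ : \sum_i \sum_j _ = pure_weyl kappa a b *
  ((\sum_i E a i * B i a) * (\sum_j E b j * B j b) - (\sum_i E a i * B i b) * (\sum_j E b j * B j a))).
  by rewrite !EBd !eqxx (negbTE ab) mul0r subr0 !mulr1.
rewrite -!sum2_factor -sumrB mulr_sumr; apply: eq_bigr => i _.
by rewrite -sumrB mulr_sumr; apply: eq_bigr => j _; ring.
Qed.

Lemma pure_ricciE : [/\ pure_ricci kappa 0 = k + 3 * P + q - 3 * Q,
  pure_ricci kappa 1 = k + P + 3 * q - 3 * Q,
  pure_ricci kappa 2 = P + q + l - 3 * Q & pure_ricci kappa 3 = P + q + l - 3 * Q].
Proof.
by split; rewrite /pure_ricci sum4E /kappa /product_kappa /=; ring.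
Qed.

Lemma pure_scalarE : pure_scalar kappa = 2 * (k + l + 3 * (P + q) - 6 * Q).
Proof.
rewrite /pure_scalar sum4E; case: pure_ricciE => -> -> -> ->; ring.
Qed.

(** The value for the unscaled product, where the plane of the first factor gives
    [k - (k + k) / 2 + 2 (k + l) / 6]. *)
Definition weyl_weight : R := (k + l) / 3.

Lemma pure_weylE : [/\ pure_weyl kappa 0 1 = weyl_weight, pure_weyl kappa 2 3 = weyl_weight,
  pure_weyl kappa 0 2 = - weyl_weight / 2, pure_weyl kappa 0 3 = - weyl_weight / 2 &
  pure_weyl kappa 1 2 = - weyl_weight / 2 /\ pure_weyl kappa 1 3 = - weyl_weight / 2].
Proof.
have E1 : ((4%:R : R) - 2)^-1 = 2^-1 by congr (_^-1); ring.
have E2 : ((4%:R : R) - 1) * (4%:R - 2) = 6 by ring.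
case: pure_ricciE => r0 r1 r2 r3.
split; [| | | |split]; rewrite /pure_weyl E1 E2 pure_scalarE ?r0 ?r1 ?r2 ?r3
  /kappa /product_kappa /weyl_weight /=; by field.
Qed.

Lemma weyl_eq0_weight : (forall i j m n, weyl G y i j m n = 0) <-> k + l = 0.
Proof.
rewrite weyl_eq0; split=> [H|kl a b].
  by have := H 0 1 isT; case: pure_weylE => -> _ _ _ _; rewrite /weyl_weight => ?; lra.
have w0 : weyl_weight = 0 by rewrite /weyl_weight kl mul0r.
case: pure_weylE; rewrite w0 oppr0 mul0r => w01 w23 w02 w03 [w12 w13].
have wC := pure_weylC kC.
by elim/ord4P: a; elim/ord4P: b => // _; rewrite // wC.
Qed.

(** The opposite pairs are 01 and 23, 02 and 13, 03 and 12. The second hypothesis equates the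
    squares in the first pair; the first one does so in both others, as the planes 02, 03 share one
    eigenvalue and 12, 13 the other. *)
Lemma weakly_einstein_case : (P - Q) ^+ 2 = (q - Q) ^+ 2 ->
  (k + P + q - Q) ^+ 2 = (l - Q) ^+ 2 -> forall i j,
  \sum_m \sum_n \sum_o riemann G y i m n o * riemann_up G y j m n o =
  (2 * (l - Q) ^+ 2 + 4 * (P - Q) ^+ 2) * G y i j.
Proof.
move=> e1 e2 i j; rewrite (weakly_einstein_pure EB GB k0 riemB) (frame_metricE GB) mulr_sumr.
apply: eq_bigr => a _; congr (_ * _); rewrite sum4E.
by elim/ord4P: a; rewrite /kappa /product_kappa /=;
  rewrite ?(expr0n, addr0, add0r, subr0)/= -?e2 -?e1 -?e2; ring.
Qed.

Section CaseOne.
Hypotheses (h1 : P + q = 2 * Q :> R) (h2 : 2 * Q = l - k :> R).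

(** The eigenvalues of the Einstein tensor are here [P - q], [q - P], 0, 0. *)
Lemma case_one_einstein : einstein_tensor G y = 0 <-> P = q.
Proof.
have h1c : P + q = 2 * Q :> R by exact: h1.
have h2c : 2 * Q = l - k :> R by exact: h2.
rewrite einstein_tensor_eq0; split=> [H|HPQ].
  by have := H 0; rewrite pure_scalarE; case: pure_ricciE => -> _ _ _ H0; lra.
by elim/ord4P; rewrite pure_scalarE; have [r0 r1 r2 r3] := pure_ricciE; rewrite ?r0 ?r1 ?r2 ?r3; lra.
Qed.

Lemma case_one_scalar : scalar_curvature G y = 2 * (k + l).
Proof.
have h1c : P + q = 2 * Q :> R by exact: h1.
have h2c : 2 * Q = l - k :> R by exact: h2.
by rewrite (scalar_curvature_pure EB GB k0 riemB) pure_scalarE; lra.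
Qed.

Lemma case_one_homothety o : let s := scalar_curvature G y in
  homothety_invariant G y o s [:: - (q - P); 0; 0; q - P]
    [:: - s / 12; - s / 12; s / 6] [:: - s / 12; - s / 12; s / 6].
Proof.
have h1c : P + q = 2 * Q :> R by exact: h1.
have h2c : 2 * Q = l - k :> R by exact: h2.
move=> s; have sE : s = 2 * (k + l) by exact: case_one_scalar.
(* The frame is reordered as 0, 2, 3, 1, so that the two nonzero Einstein eigenvalues come first and
   last. The tangent plane of [Sigma] is then spanned by the first and the fourth vector, whence
   [s / 6] in third place. *)
pose t (i : 'I_4) : 'I_4 := nth 0 [:: 0; 2; 3; 1] i.
have [w01 w23 w02 w03 [w12 w13]] := pure_weylE.
have wC := pure_weylC kC.
apply: (homothety_invariant_pure EB GB kC k0 riemB (t := t)).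
- by move=> i j; elim/ord4P: i; elim/ord4P: j => //; move=> /(congr1 val).
- by elim/ord4P; rewrite pure_scalarE /t /=; have [r0 r1 r2 r3] := pure_ricciE; rewrite ?r0 ?r1 ?r2 ?r3; lra.
- by rewrite /t /= w02 sE /weyl_weight; field.
- by rewrite /t /= wC w13 sE /weyl_weight; field.
- by rewrite /t /= w03 sE /weyl_weight; field.
- by rewrite /t /= w12 sE /weyl_weight; field.
- by rewrite /t /= w01 sE /weyl_weight; field.
- by rewrite /t /= w23 sE /weyl_weight; field.
Qed.

End CaseOne.

Section CaseTwo.
Hypotheses (h1 : P = q) (h2 : k + l + P + q = 2 * Q :> R).

(** The eigenvalues of the Einstein tensor are here [Q - l] on [Sigma] and [l - Q] on [Pi], each
    twice. *)
Lemma case_two_einstein : einstein_tensor G y = 0 <-> Q = l.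
Proof.
have h1c : P = q :> R by exact: h1.
have h2c : k + l + P + q = 2 * Q :> R by exact: h2.
rewrite einstein_tensor_eq0; split=> [H|HPQ].
  by have := H 0; rewrite pure_scalarE; case: pure_ricciE => -> _ _ _ H0; lra.
by elim/ord4P; rewrite pure_scalarE; have [r0 r1 r2 r3] := pure_ricciE; rewrite ?r0 ?r1 ?r2 ?r3; lra.
Qed.

Lemma case_two_scalar : scalar_curvature G y = - 4 * (k + l).
Proof.
have h1c : P = q :> R by exact: h1.
have h2c : k + l + P + q = 2 * Q :> R by exact: h2.
by rewrite (scalar_curvature_pure EB GB k0 riemB) pure_scalarE; lra.
Qed.

Lemma case_two_homothety o : let s := scalar_curvature G y in let la := l - Q in
  homothety_invariant G y o s [:: - la; - la; la; la]
    [:: - s / 12; s / 24; s / 24] [:: - s / 12; s / 24; s / 24].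
Proof.
have h1c : P = q :> R by exact: h1.
have h2c : k + l + P + q = 2 * Q :> R by exact: h2.
move=> s la; have sE : s = - 4 * (k + l) by exact: case_two_scalar.
have [w01 w23 w02 w03 [w12 w13]] := pure_weylE.
have wC := pure_weylC kC.
apply: (homothety_invariant_pure EB GB kC k0 riemB (t := id)) => //.
- rewrite /la; elim/ord4P; rewrite pure_scalarE /=; have [r0 r1 r2 r3] := pure_ricciE; rewrite ?r0 ?r1 ?r2 ?r3; lra.
- by rewrite /= w01 sE /weyl_weight; field.
- by rewrite /= w23 sE /weyl_weight; field.
- by rewrite /= w02 sE /weyl_weight; field.
- by rewrite /= wC w13 sE /weyl_weight; field.
- by rewrite /= w03 sE /weyl_weight; field.
- by rewrite /= w12 sE /weyl_weight; field.
Qed.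

End CaseTwo.

End Pointwise.

(** * Linear differential equations and the Frobenius theorem *)

Section RealLine.
Context {R : realType}.

(** Retraction of the line onto [[-r, r]]. It extends functions continuously beyond the interval of
    interest, as the integration lemmas ask for integrands continuous on the whole line. *)
Definition clamp (r t : R) : R := Num.max (- r) (Num.min r t).

Lemma clamp_id r t : `|t| <= r -> clamp r t = t.
Proof. by rewrite ler_norml => /andP[h1 h2]; rewrite /clamp min_r// max_r. Qed.

Lemma clamp_le r t : 0 <= r -> `|clamp r t| <= r.
Proof.
move=> r0; rewrite ler_norml /clamp le_max lexx/= ge_max ge_min lexx/= andbT.
by rewrite (le_trans _ r0)// oppr_le0.
Qed.

Lemma clamp_continuous r : continuous (clamp r).
Proof.
move=> t; apply: (@continuous_max _ _ (fun=> - r) (fun t => Num.min r t)).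
  exact: cst_continuous.
apply: (@continuous_min _ _ (fun=> r) id); first exact: cst_continuous.
by move=> A; apply.
Qed.

Lemma near_norm_lt (t r : R) : `|t| < r -> \forall s \near t, `|s| < r.
Proof.
move=> tr; apply/nbhs_ballP; exists (r - `|t|) => /=; first by rewrite subr_gt0.
move=> s /=; rewrite /ball/= distrC ltrBrDr => h; apply: le_lt_trans h.
by rewrite -{1}(subrK t s) ler_normD.
Qed.

Lemma antiderivative_bounded (g : R -> R) (r : R) : 0 < r -> continuous g ->
  exists F : R -> R, forall t, `|t| < r -> is_derive t (1 : R) F (g t).
Proof.
move=> r0 cg; pose F x := (\int[lebesgue_measure]_(t in [set` `[- r, x]]) (g t))%R.
exists F => t; rewrite ltr_norml => /andP[h1 h2].
have [|dF FE] := @continuous_FTC1_closed R g (- r) t r h2 _ h1 (cg t).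
  apply: continuous_compact_integrable; first exact: segment_compact.
  exact: continuous_subspaceT.
split; first exact: dF.
by rewrite -derive1E FE.
Qed.

(** Continuity of [F] on the whole line is part of the conclusion so that the construction can be
    iterated. *)
Lemma antiderivative (g : R -> R) (c r : R) : 0 < r -> continuous g ->
  exists F : R -> R, [/\ continuous F, F 0 = c &
    forall t, `|t| < r -> is_derive t (1 : R) F (g t)].
Proof.
move=> r0 cg; have r20 : 0 < r + r by rewrite addr_gt0.
(* The interval is doubled so that the endpoints reached by [clamp] are interior. *)
have [F dF] := antiderivative_bounded r20 cg.
have cF t : `|t| <= r -> {for t, continuous F}.
  move=> tr; have := dF t (le_lt_trans tr _); rewrite ltrDl => /(_ r0)[d _].
  exact/differentiable_continuous/derivable1_diffP.
exists (fun t => F (clamp r t) + (c - F 0)); split=> [t||t tr].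
- apply: (@continuousD _ _ _ (fun t => F (clamp r t)) (fun=> c - F 0)); last exact: cst_continuous.
  apply: (@continuous_comp _ _ _ (clamp r) F); first exact: clamp_continuous.
  exact/cF/clamp_le/ltW.
- by rewrite clamp_id ?normr0 ?ltW// addrC subrK.
have H : is_derive t (1 : R) (fun t => F t + (c - F 0)) (g t).
  apply: (is_derive_eq (is_deriveD (dF t _) (is_derive_cst _ _ _))); rewrite ?addr0//.
  by rewrite (lt_trans tr)// ltrDl.
apply: near_eq_is_derive H.
apply: filterS (near_norm_lt tr) => s sr; rewrite clamp_id//; exact: ltW.
Qed.

(** The tail after step [k] is at most [2 C / 2^k], so subtracting or adding it gives an increasing
    and a decreasing sequence; the supremum of the former is the limit, with an explicit error. *)
Lemma geometric_limit (u : nat -> R) (C : R) :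
  (forall k, `|u k.+1 - u k| <= C / 2 ^+ k) ->
  exists x, forall k, `|u k - x| <= 2 * C / 2 ^+ k.
Proof.
move=> H; pose a k := u k - 2 * C / 2 ^+ k; pose b k := u k + 2 * C / 2 ^+ k.
have pw k : C / 2 ^+ k = 2 * C / 2 ^+ k.+1.
  by rewrite exprS; field; rewrite expf_neq0.
have C0 k : 0 <= C / 2 ^+ k by exact: le_trans (H k).
have am k : a k <= a k.+1.
  have := H k; rewrite ler_norml /a => /andP[h1 h2].
  rewrite -pw; have := pw k; move: (C0 k) h1; rewrite -!mulrA; move: (C / _) => z; lra.
have bm k : b k.+1 <= b k.
  have := H k; rewrite ler_norml /b => /andP[h1 h2].
  rewrite -pw; move: (C0 k) h2; rewrite -!mulrA; move: (C / _) => z; lra.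
have aM i j : a i <= a (i + j)%N.
  by elim: j => [|j IH]; rewrite ?addn0// addnS (le_trans IH).
have bM i j : b (i + j)%N <= b i.
  by elim: j => [|j IH]; rewrite ?addn0// addnS (le_trans _ IH).
have ab i j : a i <= b j.
  apply: le_trans (aM i j) _; apply: le_trans (bM j i); rewrite addnC /a /b.
  by have := C0 (j + i)%N; rewrite -!mulrA; move: (C / _) => z; lra.
have hs : has_sup (range a).
  split; first by exists (a 0%N), 0%N.
  by exists (b 0%N) => _ [k _ <-].
exists (sup (range a)) => k.
have h1 : a k <= sup (range a) by apply: (sup_upper_bound hs); exists k.
have h2 : sup (range a) <= b k by apply: (ge_sup hs.1) => _ [j _ <-].
by move: h1 h2; rewrite /a /b ler_norml; move: (sup _) (2 * C / _) => z w *; lra.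
Qed.

End RealLine.

Section LinearODE.
Context {R : realType}.

(** Proves equality of limits: two quantities both approximated by the [k]-th iterate differ by an
    error of this form for every [k]. *)
Lemma geometric_zero (x C : R) : (forall k, `|x| <= C / 2 ^+ k) -> x = 0.
Proof.
move=> H; apply/eqP; rewrite -normr_eq0; apply/negPn/negP => x0.
have xp : 0 < `|x| by rewrite lt_def x0 normr_ge0.
have C0 : 0 <= C by have := le_trans (normr_ge0 _) (H 0%N); rewrite expr0 divr1.
have /archi_boundP : 0 <= C / `|x| by rewrite divr_ge0.
set k := Num.bound _ => kb.
have : C / `|x| < 2 ^+ k.
  by apply: lt_le_trans kb _; rewrite -natrX ler_nat ltnW// ltn_expl.
have := H k; rewrite ler_pdivlMr ?exprn_gt0// ltr_pdivrMr// mulrC => h1 h2.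
by have := le_lt_trans h1 h2; rewrite ltxx.
Qed.

Lemma norm_sumM N (a b : 'I_N -> R) (M : R) : (forall q, `|a q| <= M) ->
  `|\sum_q a q * b q| <= M * \sum_q `|b q|.
Proof.
move=> aM; apply: le_trans (ler_norm_sum _ _ _) _; rewrite mulr_sumr; apply: ler_sum => q _.
by rewrite normrM ler_wpM2r.
Qed.

Lemma continuous_rsum_at (T : topologicalType) N (F : 'I_N -> T -> R) x :
  (forall q, {for x, continuous (F q)}) -> {for x, continuous (fun t => \sum_q F q t)}.
Proof.
move=> cF; elim: (index_enum _) => [|q s IH].
  have -> : (fun t => \sum_(i <- [::]) F i t) = fun=> 0 by apply/funext => t; rewrite big_nil.
  exact: cst_continuous.
have -> : (fun t => \sum_(i <- q :: s) F i t) = (fun t => F q t + \sum_(i <- s) F i t).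
  by apply/funext => t; rewrite big_cons.
by apply: (@continuousD _ _ _ (F q)); [exact: cF|exact: IH].
Qed.

Lemma lipschitz_of_derive (F f : R -> R) (r L : R) :
  (forall u, `|u| < r -> is_derive u (1 : R) F (f u)) -> (forall u, `|u| < r -> `|f u| <= L) ->
  forall s t, `|s| < r -> `|t| < r -> `|F s - F t| <= L * `|s - t|.
Proof.
move=> dF fL; have H s t : s <= t -> `|s| < r -> `|t| < r -> `|F t - F s| <= L * `|t - s|.
  move=> st sr tr.
  have I u : u \in `[s, t] -> `|u| < r.
    rewrite in_itv/= => /andP[su ut]; move: sr tr; rewrite !ltr_norml => /andP[a1 a2] /andP[b1 b2].
    by rewrite (lt_le_trans a1 su) (le_lt_trans ut b2).
  have [||u ui ->] := @MVT_segment R F f s t st.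
  - by move=> u /subset_itv_oo_cc ui; apply/dF/I.
  - apply: continuous_in_subspaceT => u /set_mem ui; have [d _] := dF u (I u ui).
    exact/differentiable_continuous/derivable1_diffP.
  - by rewrite normrM ler_wpM2r// fL// I.
move=> s t sr tr; have [st|/ltW ts] := leP s t; last exact: H.
by rewrite distrC [`|s - t|]distrC; exact: H.
Qed.

(** Smallness of [r] replaces the exponential: at a maximum of the sum of the [|D q|] the mean value
    theorem bounds this maximum by [N (d + r e)] plus half of itself. *)
Lemma small_gronwall N (D D' : 'I_N -> R -> R) (r L e d : R) :
  0 <= L -> 0 <= e -> 0 <= d -> N%:R * (r * L) <= 2^-1 ->
  (forall p t, `|t| < r -> is_derive t (1 : R) (D p) (D' p t)) ->
  (forall p t, `|t| < r -> `|D' p t| <= L * (\sum_q `|D q t|) + e) ->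
  (forall p, `|D p 0| <= d) ->
  forall p t, `|t| < r -> `|D p t| <= 2 * N%:R * (d + r * e).
Proof.
move=> L0 e0 d0 Lr dD D'le D0 p t tr.
have r0 : 0 < r by exact: le_lt_trans tr.
pose S s := \sum_q `|D q s|.
have cS : {within `[- `|t|, `|t|], continuous S}.
  apply: continuous_in_subspaceT => s /set_mem /=; rewrite in_itv/= -ler_norml => st.
  have sr := le_lt_trans st tr.
  apply: (@continuous_rsum_at R^o N (fun q u => `|D q u|)) => q.
  have [dq _] := dD q s sr.
  have cq : {for s, continuous (D q)} by exact/differentiable_continuous/derivable1_diffP.
  exact: (@cvg_norm _ _ _ (nbhs s) _ (D q) (D q s) cq).
have [s0 s0t Smax] := @EVT_max R S (- `|t|) `|t| (ge0_cp (normr_ge0 t)).2 cS.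
have {}s0t : `|s0| <= `|t| by move: s0t; rewrite in_itv/= -ler_norml.
have bound q s : `|s| <= `|t| -> `|D q s| <= d + r * (L * S s0 + e).
  move=> st; have sr := le_lt_trans st tr.
  have [u us E] := @mvt_symmetric R (D q) (D' q) s (fun u us => dD q u (le_lt_trans us sr)).
  have -> : D q s = D q 0 + D' q u * s by rewrite -E addrC subrK.
  apply: le_trans (ler_normD _ _) _; apply: lerD => //; rewrite normrM mulrC.
  apply: ler_pM => //; first exact: ltW.
  apply: le_trans (D'le q u (le_lt_trans us sr)) _; rewrite lerD2r ler_wpM2l//.
  by apply: Smax; rewrite in_itv/= -ler_norml (le_trans us).
(* The part of the bound proportional to [S s0] has coefficient [N r L], at most 1/2, and is
   absorbed on the left. *)
have S0 : 0 <= S s0 by apply: sumr_ge0.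
have hS : S s0 <= 2 * N%:R * (d + r * e).
  have : S s0 <= N%:R * (d + r * (L * S s0 + e)).
    apply: le_trans (ler_sum _ (fun q _ => bound q s0 s0t)) _.
    by rewrite sumr_const card_ord mulr_natl.
  have := ler_wpM2r S0 Lr.
  move: (N%:R : R) (S s0) => n x h1 h2.
  have E : n * (d + r * (L * x + e)) = n * (d + r * e) + n * (r * L) * x by ring.
  rewrite E in h2; have E' : 2 * n * (d + r * e) = 2 * (n * (d + r * e)) by ring.
  rewrite E'; move: (n * (d + r * e)) (n * (r * L) * x) h1 h2 => a b h1 h2; lra.
apply: le_trans hS; apply: le_trans (Smax t _); last by rewrite in_itv/= -ler_norml lexx.
by rewrite /S (bigD1 p)//= lerDl sumr_ge0.
Qed.

End LinearODE.

(** * Picard iteration for linear systems *)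

Section Picard.
Context {R : realType} {N : nat}.
Variables (A : 'I_N -> 'I_N -> R -> R) (x0 : 'I_N -> R) (M r : R).
Hypotheses (cA : forall p q, continuous (A p q)) (AM : forall p q t, `|A p q t| <= M).
Hypotheses (M0 : 0 <= M) (r0 : 0 < r) (small : N%:R * (r * M) <= 2^-1).

(** Chosen by [xget] to make the iteration a total function; for continuous [g] the choice has the
    listed properties. *)
Definition primitive (g : R -> R) (c : R) : R -> R :=
  xget (fun=> 0) [set F | [/\ continuous F, F 0 = c &
    forall t, `|t| < r -> is_derive t (1 : R) F (g t)]].

Lemma primitiveP g c : continuous g -> [/\ continuous (primitive g c), primitive g c 0 = c &
  forall t, `|t| < r -> is_derive t (1 : R) (primitive g c) (g t)].
Proof.
move=> cg; have [F FP] := antiderivative c r0 cg.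
exact: (@xgetPex _ (fun=> 0) [set F | _] (ex_intro _ F FP)).
Qed.

Definition apply_at (X : 'I_N -> R -> R) (p : 'I_N) (t : R) : R := \sum_q A p q t * X q t.

Fixpoint picard (k : nat) : 'I_N -> R -> R :=
  if k is k'.+1 then fun p => primitive (apply_at (picard k') p) (x0 p)
  else fun p => fun=> x0 p.

Lemma apply_at_continuous X p : (forall q, continuous (X q)) -> continuous (apply_at X p).
Proof.
move=> cX t; apply: (@continuous_rsum_at _ _ _ (fun q t => A p q t * X q t)) => q.
by apply: (@continuousM _ _ (A p q) (X q)); [exact: cA|exact: cX].
Qed.

Lemma picard_continuous k p : continuous (picard k p).
Proof.
elim: k p => [|k IH] p /=; first by move=> t; exact: cst_continuous.
by have [] := primitiveP (x0 p) (apply_at_continuous (p:=p) IH).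
Qed.

Lemma picard0 k p : picard k p 0 = x0 p.
Proof. by case: k => [//|k]; have [] := primitiveP (x0 p) (apply_at_continuous (p:=p) (@picard_continuous k)). Qed.

Lemma picard_derive k p t : `|t| < r -> is_derive t (1 : R) (picard k.+1 p) (apply_at (picard k) p t).
Proof. by have [_ _] := primitiveP (x0 p) (apply_at_continuous (p:=p) (@picard_continuous k)); apply. Qed.

Lemma derive_diff_bound (F G f g : R -> R) (rho L : R) : F 0 = G 0 ->
  (forall t, `|t| < rho -> is_derive t (1 : R) F (f t)) ->
  (forall t, `|t| < rho -> is_derive t (1 : R) G (g t)) ->
  (forall t, `|t| < rho -> `|f t - g t| <= L) ->
  forall t, `|t| < rho -> `|F t - G t| <= rho * L.
Proof.
move=> FG dF dG fgL t tr; have rho0 : 0 < rho by exact: le_lt_trans tr.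
have dFG u : `|u| < rho -> is_derive u (1 : R) (fun t => F t - G t) (f u - g u).
  by move=> ur; exact: is_deriveB (dF u ur) (dG u ur).
have z0 : `|0 : R| < rho by rewrite normr0.
have := lipschitz_of_derive dFG fgL tr z0.
rewrite FG subrr !subr0 => /le_trans; apply; rewrite mulrC.
by apply: ler_pM => //; [exact: le_trans (fgL 0 z0)|exact: ltW].
Qed.

Let S0 := \sum_q `|x0 q|.
(** Bounds the first step of the iteration. *)
Let C := r * (M * S0).

Let S0_ge0 : 0 <= S0. Proof. exact: sumr_ge0. Qed.
Let C_ge0 : 0 <= C. Proof. by rewrite mulr_ge0 ?(ltW r0)// mulr_ge0. Qed.

Lemma apply_at_diff X Y p t D : (forall q, `|X q t - Y q t| <= D) ->
  `|apply_at X p t - apply_at Y p t| <= M * (N%:R * D).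
Proof.
move=> XY; rewrite /apply_at -sumrB.
rewrite (eq_bigr (fun q => A p q t * (X q t - Y q t))) => [|q _]; last by rewrite mulrBr.
apply: le_trans (norm_sumM _ (fun q => AM p q t)) _; rewrite ler_wpM2l//.
apply: le_trans (ler_sum _ (fun q _ => XY q)) _.
by rewrite sumr_const card_ord mulr_natl.
Qed.

(** One integration multiplies the distance between iterates by at most [N r M], hence by at most
    1/2. *)
Lemma picard_step k p t : `|t| < r -> `|picard k.+1 p t - picard k p t| <= C / 2 ^+ k.
Proof.
elim: k p t => [|k IH] p t tr.
  rewrite expr0 divr1.
  have d0 u : `|u| < r -> is_derive u (1 : R) (picard 0 p) 0 by move=> _; exact: is_derive_cst.
  apply: (derive_diff_bound _ (@picard_derive 0 p) d0) tr; first by rewrite !picard0.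
  move=> u _; rewrite subr0; exact: norm_sumM.
have := derive_diff_bound _ (@picard_derive k.+1 p) (@picard_derive k p) _ tr.
move=> /(_ (M * (N%:R * (C / 2 ^+ k)))); rewrite !picard0 => /(_ erefl) H.
apply: le_trans (H _) _ => [u ur|]; first by apply: apply_at_diff => q; exact: IH.
have E : r * (M * (N%:R * (C / 2 ^+ k))) = (N%:R * (r * M)) * (C / 2 ^+ k) by ring.
have E2 : C / 2 ^+ k.+1 = 2^-1 * (C / 2 ^+ k) by rewrite exprS; field; rewrite expf_neq0.
by rewrite E E2 ler_wpM2r// divr_ge0// exprn_ge0.
Qed.

Definition picard_limit (p : 'I_N) (t : R) : R :=
  xget 0 [set x | forall k, `|picard k p t - x| <= 2 * C / 2 ^+ k].

Lemma picard_limitP p t k : `|t| < r -> `|picard k p t - picard_limit p t| <= 2 * C / 2 ^+ k.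
Proof.
move=> tr; have [x xP] := geometric_limit (fun k => picard_step k p tr).
exact: (@xgetPex _ 0 [set x | forall k, _] (ex_intro _ x xP)).
Qed.

Lemma picard_bound k p t : `|t| < r -> `|picard k p t| <= S0 + 4 * C.
Proof.
move=> tr; have h0 := picard_limitP p 0 tr; have hk := picard_limitP p k tr.
have x0S : `|x0 p| <= S0 by rewrite /S0 (bigD1 p)//= lerDl sumr_ge0.
rewrite expr0 divr1 /= in h0.
have hk' : `|picard k p t - picard_limit p t| <= 2 * C.
  apply: le_trans hk _; rewrite ler_pdivrMr ?exprn_gt0//.
  by apply: ler_peMr; [rewrite mulr_ge0|rewrite exprn_ege1// ler1n].
have -> : picard k p t = (picard k p t - picard_limit p t) - (x0 p - picard_limit p t) + x0 p by ring.
apply: le_trans (ler_normD _ _) _; rewrite addrC; apply: lerD => //.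
apply: le_trans (ler_normB _ _) _.
have -> : 4 * C = 2 * C + 2 * C by ring.
exact: lerD.
Qed.

Lemma picard_limit_lipschitz p : exists L, forall s t, `|s| < r -> `|t| < r ->
  `|picard_limit p s - picard_limit p t| <= L * `|s - t|.
Proof.
exists (M * (N%:R * (S0 + 4 * C))) => s t sr tr.
have H k : `|picard k.+1 p s - picard k.+1 p t| <= M * (N%:R * (S0 + 4 * C)) * `|s - t|.
  apply: (lipschitz_of_derive (@picard_derive k p)) => // u ur.
  have -> : apply_at (picard k) p u = apply_at (picard k) p u - apply_at (fun _ _ => 0) p u.
    by rewrite [X in _ - X]big1 ?subr0// => q _; rewrite mulr0.
  by apply: apply_at_diff => q; rewrite subr0; exact: picard_bound.
(* The iterates satisfy the Lipschitz bound, so any excess of the limit over it is at most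
   [2 C / 2^k] for every [k]. *)
rewrite leNgt; apply/negP => hlt.
have XY : 0 < `|picard_limit p s - picard_limit p t| - M * (N%:R * (S0 + 4 * C)) * `|s - t|.
  by rewrite subr_gt0.
suff Z : `|picard_limit p s - picard_limit p t| - M * (N%:R * (S0 + 4 * C)) * `|s - t| = 0.
  by rewrite Z ltxx in XY.
apply: (@geometric_zero _ _ (2 * C)) => k; rewrite gtr0_norm// lerBlDr.
have h1 := picard_limitP p k.+1 sr; have h2 := picard_limitP p k.+1 tr.
have -> : 2 * C / 2 ^+ k = 2 * C / 2 ^+ k.+1 + 2 * C / 2 ^+ k.+1.
  by rewrite exprS; field; rewrite expf_neq0.
have -> : picard_limit p s - picard_limit p t =
   (picard_limit p s - picard k.+1 p s) + (picard k.+1 p t - picard_limit p t)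
   + (picard k.+1 p s - picard k.+1 p t) by ring.
apply: le_trans (ler_normD _ _) _; apply: lerD (H k).
apply: le_trans (ler_normD _ _) _; apply: lerD => //.
by rewrite distrC.
Qed.

(** The limit of the iterates is so far only Lipschitz on [|t| < r]. Clamped at [r / 2] it is
    continuous on the line; the coefficients applied to it are integrated once more, and this
    primitive, differentiable by construction, coincides with the limit. *)
Lemma linear_ode : exists X : 'I_N -> R -> R,
  (forall p, X p 0 = x0 p) /\
  (forall p t, `|t| < r / 2 -> is_derive t (1 : R) (X p) (\sum_q A p q t * X q t)).
Proof.
have r2 : r / 2 < r by rewrite ltr_pdivrMr// ltr_pMr// ltr1n.
have r20 : 0 <= r / 2 by rewrite divr_ge0// ltW.
pose Y p t := picard_limit p (clamp (r / 2) t).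
have cl t : `|clamp (r / 2) t| < r by exact: le_lt_trans (clamp_le t r20) r2.
have cY p : continuous (Y p).
  have [L HL] := picard_limit_lipschitz p.
  move=> t; apply: (@continuous_comp _ _ _ (clamp (r / 2)) (picard_limit p)); first exact: clamp_continuous.
  apply/(@cvgrPdist_lt _ _ _ (nbhs (clamp (r / 2) t))) => e e0.
  have L1 : 0 < `|L| + 1 by rewrite ltr_pwDr.
  have near1 := near_norm_lt (cl t).
  have near2 : \forall s \near clamp (r / 2) t, `|clamp (r / 2) t - s| < e / (`|L| + 1).
    by apply/nbhs_ballP; exists (e / (`|L| + 1)) => //=; rewrite divr_gt0.
  apply: filterS2 near1 near2 => s sr sd.
  apply: le_lt_trans (HL _ _ (cl t) sr) _.
  apply: (@le_lt_trans _ _ ((`|L| + 1) * `|clamp (r / 2) t - s|)).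
    by rewrite ler_wpM2r// (le_trans (ler_norm _))// lerDl.
  by rewrite mulrC -ltr_pdivlMr.
pose X p := primitive (apply_at Y p) (x0 p).
have XP p := primitiveP (x0 p) (apply_at_continuous (p:=p) cY).
(* Both functions are within [C / 2^k] of the iterate of order [k + 1]. *)
have XY p t : `|t| < r / 2 -> X p t = picard_limit p t.
  move=> tr2; have tr := lt_trans tr2 r2; apply/eqP; rewrite -subr_eq0; apply/eqP.
  apply: (@geometric_zero _ _ (2 * C)) => k.
  have h1 := picard_limitP p k.+1 tr.
  have h2 : `|X p t - picard k.+1 p t| <= C / 2 ^+ k.
    have dX u : `|u| < r / 2 -> is_derive u (1 : R) (X p) (apply_at Y p u).
      by move=> /lt_trans /(_ r2); have [_ _] := XP p; apply.
    have dP u : `|u| < r / 2 -> is_derive u (1 : R) (picard k.+1 p) (apply_at (picard k) p u).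
      by move=> /lt_trans /(_ r2); exact: picard_derive.
    have [_ X0 _] := XP p.
    have := derive_diff_bound (etrans X0 (esym (picard0 k.+1 p))) dX dP _ tr2.
    move=> /(_ (M * (N%:R * (2 * C / 2 ^+ k)))) H; apply: le_trans (H _) _ => [u ur|].
      apply: apply_at_diff => q; have -> : Y q u = picard_limit q u by rewrite /Y clamp_id// ltW.
      rewrite distrC.
      exact: (picard_limitP q k (lt_trans ur r2)).
    have -> : r / 2 * (M * (N%:R * (2 * C / 2 ^+ k))) = (N%:R * (r * M)) * (C / 2 ^+ k) by field; rewrite expf_neq0.
    apply: ler_piMl; first by rewrite divr_ge0// exprn_ge0.
    by apply: le_trans small _; rewrite invf_le1// ler1n.
  have -> : X p t - picard_limit p t = (X p t - picard k.+1 p t) + (picard k.+1 p t - picard_limit p t) by ring.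
  apply: le_trans (ler_normD _ _) _.
  have -> : 2 * C / 2 ^+ k = C / 2 ^+ k + 2 * C / 2 ^+ k.+1.
    by rewrite exprS; field; rewrite expf_neq0.
  exact: lerD.
exists X; split=> [p|p t tr2]; first by have [] := XP p.
have [_ _ d] := XP p; apply: (is_derive_eq (d t (lt_trans tr2 r2))).
apply: eq_bigr => q _; rewrite XY// /Y clamp_id//; exact: ltW.
Qed.

End Picard.

(** * Integration of flat linear systems in the plane *)

Section Frobenius.
Context {R : realType} {N : nat}.

Lemma near_bounded (I : finType) n (F : I -> 'rV[R]_n -> R) y :
  (forall i, {for y, continuous (F i)}) ->
  exists2 M : R, 0 <= M & \forall z \near y, forall i, `|F i z| <= M.
Proof.
move=> cF; exists (\sum_i (`|F i y| + 1)); first by apply: sumr_ge0 => i _; rewrite addr_ge0.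
apply: (@filter_forall _ I (fun i z => `|F i z| <= \sum_i (`|F i y| + 1)) (nbhs y)) => i; apply: filterS (proj1 (@rV_continuousP _ _ _ _) (cF i) 1 ltr01) => z zi.
rewrite (bigD1 i)//=; apply: (@le_trans _ _ (`|F i y| + 1)); last first.
  by rewrite lerDl; apply: sumr_ge0 => j _; rewrite addr_ge0.
have -> : F i z = F i y + (F i z - F i y) by ring.
by apply: le_trans (ler_normD _ _) _; rewrite lerD2l ltW.
Qed.

Lemma box_open n (y : 'rV[R]_n) (r : R) : open [set z : 'rV[R]_n | forall i, `|z 0 i - y 0 i| < r].
Proof.
rewrite openE => z Vz; apply: (@filter_forall _ 'I_n (fun i (w : 'rV[R]_n) => `|w 0 i - y 0 i| < r) (nbhs z)) => i.
apply/rV_nbhsP; exists (r - `|z 0 i - y 0 i|); first by rewrite subr_gt0; exact: Vz.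
move=> w /(_ i) wz; have -> : w 0 i - y 0 i = (w 0 i - z 0 i) + (z 0 i - y 0 i) by ring.
by apply: le_lt_trans (ler_normD _ _) _; rewrite -ltrBrDr.
Qed.

Lemma is_derive_of_line n (f : 'rV[R]_n -> R) z v (g : R -> R) t d :
  (forall h : R, f (z + h *: v) = g (t + h)) -> is_derive t (1 : R) g d -> is_derive z v f d.
Proof.
move=> fg [dg <-].
have E : (fun h : R => h^-1 *: ((f \o shift z) (h *: v) - f z)) =
    (fun h => h^-1 *: ((g \o shift t) (h *: (1 : R)) - g t)).
  have fz : f z = g t by have := fg 0; rewrite scale0r !addr0.
  apply/funext => h /=; rewrite [h *: v + z]addrC fg fz.
  by rewrite [h%:A]mulr1 [h + t]addrC.
by split; rewrite /derivable /derive E.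
Qed.

Lemma is_derive_of_bound (g : R -> R) (t d : R) :
  (forall e, 0 < e -> \forall h \near (0 : R), `|g (t + h) - g t - h * d| <= e * `|h|) ->
  is_derive t (1 : R) g d.
Proof.
move=> H; have L : (fun h => h^-1 *: ((g \o shift t) (h *: (1 : R)) - g t)) @ 0^' --> (d : R^o).
  apply/(@cvgrPdist_le _ _ _ (0^')) => e e0.
  have := H e e0; rewrite near_withinE; apply: filterS => h hb h0.
  rewrite /= [h%:A]mulr1 [h + t]addrC.
  have -> : d - h^-1 *: (g (t + h) - g t) = - h^-1 * (g (t + h) - g t - h * d).
    by rewrite /GRing.scale /=; field.
  by rewrite normrM normrN normfV mulrC ler_pdivrMr ?normr_gt0.
by split; [apply/cvg_ex; exists d|exact: cvg_lim].
Qed.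

Lemma generated_sum n (U : set 'rV[R]_n) (B : ('rV[R]_n -> R) -> Prop) (F : 'I_N -> 'rV[R]_n -> R) :
  (forall q, generated U B (F q)) -> generated U B (fun z => \sum_q F q z).
Proof.
move=> gF; elim: (index_enum _) => [|q s IH].
  have -> : (fun z => \sum_(i <- [::]) F i z) = fun=> 0 by apply/funext => z; rewrite big_nil.
  exact: generated_cst.
have -> : (fun z => \sum_(i <- q :: s) F i z) = (fun z => F q z + \sum_(i <- s) F i z).
  by apply/funext => z; rewrite big_cons.
exact: generated_add.
Qed.

Lemma is_derive_bound (g : R -> R) (t d : R) : is_derive t (1 : R) g d ->
  forall e, 0 < e -> \forall h \near (0 : R), `|g (t + h) - g t - h * d| <= e * `|h|.
Proof.
move=> [dg <-] e e0; have := dg; rewrite /derivable -/(derive g t 1) => cg.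
have /(@cvgrPdist_le _ _ _ (0^')) /(_ e e0) : (fun h => h^-1 *: ((g \o shift t) (h *: (1 : R)) - g t)) @ 0^' --> ('D_1 g t : R^o) := cg.
rewrite near_withinE; apply: filterS => h H.
have [->|h0] := eqVneq h 0; first by rewrite addr0 subrr mul0r subrr !normr0 mulr0.
have := H h0; rewrite /= [h%:A]mulr1 [h + t]addrC => {}H.
have -> : g (t + h) - g t - h * 'D_1 g t = - h * ('D_1 g t - h^-1 *: (g (t + h) - g t)).
  by rewrite /GRing.scale /=; field.
by rewrite normrM normrN mulrC ler_wpM2r.
Qed.

Lemma is_derive_sumM (a b : 'I_N -> R -> R) (a' b' : 'I_N -> R) (t : R) :
  (forall q, is_derive t (1 : R) (a q) (a' q)) -> (forall q, is_derive t (1 : R) (b q) (b' q)) ->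
  is_derive t (1 : R) (fun t => \sum_q a q t * b q t) (\sum_q (a' q * b q t + a q t * b' q)).
Proof.
move=> da db; have -> : (fun t => \sum_q a q t * b q t) = \sum_q (a q * b q).
  by apply/funext => u; rewrite fct_sumE.
have H q : is_derive t (1 : R) (a q * b q) (a' q * b q t + a q t * b' q).
  apply: (is_derive_eq (is_deriveM (da q) (db q))).
  by rewrite /GRing.scale /= addrC [b q t * _]mulrC.
exact: is_derive_sum.
Qed.

Lemma sum_assoc (a x : 'I_N -> R) (b : 'I_N -> 'I_N -> R) :
  \sum_q a q * (\sum_s b q s * x s) = \sum_s (\sum_q a q * b q s) * x s.
Proof.
rewrite (eq_bigr (fun q => \sum_s a q * b q s * x s)) => [|q _].
  by rewrite exchange_big/=; apply: eq_bigr => s _; rewrite mulr_suml.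
by rewrite mulr_sumr; apply: eq_bigr => s _; rewrite mulrA.
Qed.

Variables (U : set 'rV[R]_2) (y : 'rV[R]_2) (A : 'I_2 -> 'I_N -> 'I_N -> 'rV[R]_2 -> R).
Hypotheses (oU : open U) (Uy : U y) (sA : forall i p q, smooth_on U (A i p q)).
(** The integrability condition of [partial i X = A i X]: what equality of mixed derivatives demands
    of solutions with arbitrary initial value. *)
Hypothesis flat : forall z p q, U z ->
  partial 1 (A 0 p q) z + \sum_s A 0 p s z * A 1 s q z =
  partial 0 (A 1 p q) z + \sum_s A 1 p s z * A 0 s q z.

Let pt (s t : R) := y + s *: ('e_0 : 'rV[R]_2) + t *: 'e_1.

Lemma plane_coord s t i : `|(pt s t) 0 i - y 0 i| = `|if i == 0 then s else t|.
Proof.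
have cancel (p q u : R) : p + q + u - p = q + u by ring.
rewrite /pt !mxE cancel; elim/ord2P: i; rewrite /= ?mulr1 ?mulr0 ?addr0 ?add0r//.
Qed.

Lemma plane_ptE (z : 'rV[R]_2) : pt (z 0 0 - y 0 0) (z 0 1 - y 0 1) = z.
Proof.
apply/rowP; elim/ord2P; rewrite /pt !mxE /= ?mulr1 ?mulr0 ?addr0 ?add0r addrC subrK//.
Qed.

(** The horizontal derivatives of [A 1] are bounded up to second order for the sake of
    [horizontal_taylor]. *)
Lemma local_bounds : exists2 M : R, 0 <= M & exists2 rho : R, 0 < rho &
  forall s t, `|s| < rho -> `|t| < rho -> let z := pt s t in
  [/\ U z, forall i p q, `|A i p q z| <= M,
    forall p q, `|partial 0 (A 1 p q) z| <= M &
    forall p q, `|partial 0 (partial 0 (A 1 p q)) z| <= M].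
Proof.
have [M1 M10 n1] := @near_bounded ('I_2 * 'I_N * 'I_N)%type 2 (fun u => A u.1.1 u.1.2 u.2) y
  (fun u => smooth_continuous (sA _ _ _) Uy).
have [M2 M20 n2] := @near_bounded ('I_N * 'I_N)%type 2 (fun u => partial 0 (A 1 u.1 u.2)) y
  (fun u => smooth_continuous (smooth_partial 0 (sA _ _ _)) Uy).
have [M3 M30 n3] := @near_bounded ('I_N * 'I_N)%type 2 (fun u => partial 0 (partial 0 (A 1 u.1 u.2))) y
  (fun u => smooth_continuous (smooth_partial 0 (smooth_partial 0 (sA _ _ _))) Uy).
have [rho rho0 H] := proj1 (@rV_nbhsP _ _ _ _) (filterI (open_near oU Uy (fun z Uz => Uz))
  (filterI n1 (filterI n2 n3))).
exists (M1 + M2 + M3); first by rewrite !addr_ge0.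
exists rho => // s t sr tr z.
have [|Uz [h1 [h2 h3]]] := H z.
  by move=> i; rewrite plane_coord; case: ifP.
split=> // [i p q|p q|p q].
- by apply: le_trans (h1 (i, p, q)) _; rewrite -addrA lerDl addr_ge0.
- by apply: le_trans (h2 (p, q)) _; rewrite addrAC lerDr addr_ge0.
- by apply: le_trans (h3 (p, q)) _; rewrite lerDr addr_ge0.
Qed.

Section Transport.
Variables (M r B0 : R) (xi : 'I_N -> R -> R) (X : 'I_N -> R -> R -> R).
Hypotheses (M0 : 0 <= M) (r0 : 0 < r) (B00 : 0 <= B0) (small : N%:R * (r * M) <= 2^-1).
Hypothesis inU : forall s t, `|s| < r -> `|t| < r -> U (pt s t).
Hypothesis AM : forall s t i p q, `|s| < r -> `|t| < r -> `|A i p q (pt s t)| <= M.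
Hypothesis dAM : forall s t p q, `|s| < r -> `|t| < r -> `|partial 0 (A 1 p q) (pt s t)| <= M.
Hypothesis ddAM : forall s t p q, `|s| < r -> `|t| < r ->
  `|partial 0 (partial 0 (A 1 p q)) (pt s t)| <= M.
Hypothesis xiB : forall p, `|xi p 0| <= B0.
Hypothesis dxi : forall p s, `|s| < r ->
  is_derive s (1 : R) (xi p) (\sum_q A 0 p q (pt s 0) * xi q s).
Hypothesis X0 : forall p s, `|s| < r -> X p s 0 = xi p s.
Hypothesis dX : forall p s t, `|s| < r -> `|t| < r ->
  is_derive t (1 : R) (X p s) (\sum_q A 1 p q (pt s t) * X q s t).

Let z0 : `|0 : R| < r. Proof. by rewrite normr0. Qed.
Let B1 := 2 * N%:R * (2 * N%:R * B0).

(** One Gronwall estimate along the horizontal axis and one along the vertical line, each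
    contributing a factor [2 * N%:R]. *)
Lemma transport_bound p s t : `|s| < r -> `|t| < r -> `|X p s t| <= B1.
Proof.
move=> sr tr.
have xb q : `|xi q s| <= 2 * N%:R * B0.
  rewrite -[B0]addr0 -[0 in X in _ <= X](mulr0 r).
  apply: (@small_gronwall _ _ xi (fun p s => \sum_q A 0 p q (pt s 0) * xi q s) r M) => // a u ur.
  by rewrite addr0; apply: norm_sumM => b; exact: AM.
rewrite /B1 -[2 * N%:R * B0]addr0 -[0 in X in _ <= X](mulr0 r).
apply: (@small_gronwall _ _ (fun p => X p s) (fun p t => \sum_q A 1 p q (pt s t) * X q s t) r M) => //.
- by rewrite !mulr_ge0.
- by move=> a u; exact: dX.
- by move=> a u ur; rewrite addr0; apply: norm_sumM => b; exact: AM.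
- by move=> a; rewrite X0.
Qed.

Let pt_line (s t h : R) : pt (s + h) t = pt s t + h *: 'e_0.
Proof. rewrite /pt scalerDl addrA; exact: addrAC. Qed.

(** The mean value theorem for [A 1] and then for its derivative; the remainder [M h^2] lacks the
    factor 1/2 of the Taylor formula but is of the right order. *)
Lemma horizontal_taylor p q s t h : `|s| < r -> `|t| < r -> `|s| + `|h| < r ->
  `|A 1 p q (pt (s + h) t) - A 1 p q (pt s t) - h * partial 0 (A 1 p q) (pt s t)| <= M * `|h| ^+ 2
  /\ `|A 1 p q (pt (s + h) t) - A 1 p q (pt s t)| <= M * `|h|.
Proof.
move=> sr tr shr; have in1 (u : R) : `|u| <= `|h| -> `|s + u| < r.
  by move=> uh; apply: le_lt_trans (ler_normD _ _) _; apply: le_lt_trans shr; rewrite lerD2l.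
have [u uh E] := @mvt_line R 2 (A 1 p q) (pt s t) 'e_0 h (fun u uh =>
  smooth_derivable (sA 1 p q) (eq_ind _ U (inU (in1 u uh) tr) _ (pt_line s t u))).
have [v vu E2] := @mvt_line R 2 (partial 0 (A 1 p q)) (pt s t) 'e_0 u (fun v vu =>
  smooth_derivable (smooth_partial 0 (sA 1 p q))
    (eq_ind _ U (inU (in1 v (le_trans vu uh)) tr) _ (pt_line s t v))).
rewrite -/(partial 0 (A 1 p q) _) -!pt_line in E; rewrite -!pt_line in E2.
split; last by rewrite E normrM ler_wpM2r// dAM// in1.
rewrite E [h * _]mulrC -mulrBl normrM expr2 mulrA ler_wpM2r// E2 normrM.
apply: ler_pM => //.
exact: ddAM (in1 v (le_trans vu uh)) tr.
Qed.

Let AX p s t := \sum_q A 0 p q (pt s t) * X q s t.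

Lemma AX_bound p s t : `|s| < r -> `|t| < r -> `|AX p s t| <= M * (N%:R * B1).
Proof.
move=> sr tr; apply: le_trans (norm_sumM _ (fun q => AM 0 p q sr tr)) _; rewrite ler_wpM2l//.
apply: le_trans (ler_sum _ (fun q _ => transport_bound q sr tr)) _.
by rewrite sumr_const card_ord mulr_natl.
Qed.

(** Half of [e * x] is allotted to the initial error and half to the quadratic one; [n + 1] and
    [rC + 1] keep the denominators positive. *)
Lemma gronwall_error (e n1 x rC n : R) : 0 < e -> 0 <= n -> n1 = n + 1 -> 0 <= rC -> 0 < x ->
  x * (4 * n1 * (rC + 1)) < e -> 2 * n * (e / (4 * n1) * x + rC * x ^+ 2) <= e * x.
Proof.
move=> e0 n0 -> rC0 x0 xe.
have n10 : 0 < n + 1 by rewrite ltr_pwDr.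
have -> : 2 * n * (e / (4 * (n + 1)) * x + rC * x ^+ 2) =
    (e * (n / (n + 1)) / 2 + 2 * n * rC * x) * x by field; rewrite gt_eqF.
rewrite ler_wpM2r ?ltW//.
have h1 : e * (n / (n + 1)) <= e by rewrite ger_pMr// ler_pdivrMr// mul1r lerDl.
have h2 : 0 <= x * n by rewrite mulr_ge0// ltW.
have h3 : 0 <= x * rC by rewrite mulr_ge0// ltW.
lra.
Qed.

(* By flatness, the error [X(s+h,t) - X(s,t) - h A_0(s,t) X(s,t)] solves, in [t],
   the same linear equation as [X] up to a term of order [h^2]; hence it is
   [o(h)], as it is for [t = 0]. *)
Lemma transport_derive p s t : `|s| < r -> `|t| < r ->
  is_derive s (1 : R) (fun s => X p s t) (\sum_q A 0 p q (pt s t) * X q s t).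
Proof.
move=> sr tr; apply: is_derive_of_bound => e e0.
(* The first summand comes from the Taylor remainder of [A 1] acting on [X], the second from the
   first-order change of [A 1] acting on [A 0 X]. *)
pose C := N%:R * (M * B1) + N%:R * (M * (M * (N%:R * B1))).
have B10 : 0 <= B1 by rewrite /B1 !mulr_ge0.
have C0 : 0 <= C by rewrite addr_ge0// !mulr_ge0.
pose n1 : R := N%:R + 1.
have n10 : 0 < n1 by rewrite ltr_pwDr.
have e1 : 0 < e / (4 * n1) by rewrite divr_gt0// mulr_gt0.
have nxi : \forall h \near (0 : R), forall q,
    `|xi q (s + h) - xi q s - h * (\sum_k A 0 q k (pt s 0) * xi k s)| <= e / (4 * n1) * `|h|.
  apply: (@filter_forall _ 'I_N (fun q h => `|xi q (s + h) - xi q s - h * (\sum_k A 0 q k (pt s 0) * xi k s)| <= e / (4 * n1) * `|h|) (nbhs (0 : R))) => q.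
  exact: is_derive_bound (dxi q sr) _ e1.
have rs : `|0 : R| < r - `|s| by rewrite normr0 subr_gt0.
have e2 : `|0 : R| < e / (4 * n1 * (r * C + 1)).
  by rewrite normr0 divr_gt0// !mulr_gt0// ltr_pwDr// mulr_ge0// ltW.
apply: filterS (filterI nxi (filterI (near_norm_lt rs) (near_norm_lt e2))) => h [hxi [hr he]].
have shr : `|s| + `|h| < r by rewrite addrC -ltrBrDr.
have sh : `|s + h| < r by exact: le_lt_trans (ler_normD _ _) shr.
pose D q u := X q (s + h) u - X q s u - h * AX q s u.
pose D' q u := \sum_k A 1 q k (pt (s + h) u) * D k u
  + (\sum_k (A 1 q k (pt (s + h) u) - A 1 q k (pt s u) - h * partial 0 (A 1 q k) (pt s u)) * X k s u
  + h * \sum_k (A 1 q k (pt (s + h) u) - A 1 q k (pt s u)) * AX k s u).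
have dD q u : `|u| < r -> is_derive u (1 : R) (D q) (D' q u).
  move=> ur.
  have dA k : is_derive u (1 : R) (fun u => A 0 q k (pt s u)) (partial 1 (A 0 q k) (pt s u)).
    exact: (is_derive_line (smooth_derivable (sA 0 q k) (inU sr ur))).
  have dAX := is_derive_sumM dA (fun k => dX k sr ur).
  have dD1 := is_deriveB (is_deriveB (dX q sh ur) (dX q sr ur)) (is_deriveZ h dAX).
  (* Flatness enters here: the vertical derivative of [A 0 X] is rewritten with the horizontal
     derivative of [A 1], which then cancels the first-order change of the vertical equation. *)
  have flatsum : \sum_k (partial 1 (A 0 q k) (pt s u) * X k s u + A 0 q k (pt s u) *
       (\sum_v A 1 k v (pt s u) * X v s u)) =
     \sum_k (partial 0 (A 1 q k) (pt s u) * X k s u + A 1 q k (pt s u) * AX k s u).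
    rewrite !big_split/= /AX !sum_assoc -!big_split/=; apply: eq_bigr => k _.
    by rewrite -!mulrDl flat//; exact: inU.
  have alg (a1 a0 d0 x1 x0 ax : 'I_N -> R) :
      \sum_k a1 k * x1 k - \sum_k a0 k * x0 k - h * \sum_k (d0 k * x0 k + a0 k * ax k)
      = \sum_k a1 k * (x1 k - x0 k - h * ax k)
        + (\sum_k (a1 k - a0 k - h * d0 k) * x0 k + h * \sum_k (a1 k - a0 k) * ax k).
    by rewrite !mulr_sumr -!sumrB -!big_split/=; apply: eq_bigr => k _; ring.
  apply: (is_derive_eq dD1); rewrite flatsum; exact: alg.
have D'le q u : `|u| < r -> `|D' q u| <= M * (\sum_k `|D k u|) + C * `|h| ^+ 2.
  move=> ur; apply: le_trans (ler_normD _ _) _; apply: lerD.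
    by apply: norm_sumM => k; exact: AM.
  apply: le_trans (ler_normD _ _) _; rewrite /C mulrDl; apply: lerD.
    have H k := (horizontal_taylor q k sr ur shr).1.
    apply: le_trans (norm_sumM _ H) _.
    have -> : N%:R * (M * B1) * `|h| ^+ 2 = M * `|h| ^+ 2 * (N%:R * B1) by ring.
    rewrite ler_wpM2l ?mulr_ge0 ?exprn_ge0//.
    apply: le_trans (ler_sum _ (fun k _ => transport_bound k sr ur)) _.
    by rewrite sumr_const card_ord mulr_natl.
  rewrite normrM; have H k := (horizontal_taylor q k sr ur shr).2.
  have -> : N%:R * (M * (M * (N%:R * B1))) * `|h| ^+ 2 = `|h| * (M * `|h| * (N%:R * (M * (N%:R * B1)))) by ring.
  rewrite ler_wpM2l//; apply: le_trans (norm_sumM _ H) _; rewrite ler_wpM2l ?mulr_ge0//.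
  apply: le_trans (ler_sum _ (fun k _ => AX_bound k sr ur)) _.
  by rewrite sumr_const card_ord [X in _ <= X]mulr_natl.
have D0 q : `|D q 0| <= e / (4 * n1) * `|h|.
  rewrite /D !X0// /AX; have := hxi q.
  by rewrite (eq_bigr (fun k => A 0 q k (pt s 0) * X k s 0)) => [//|k _]; rewrite X0.
have := @small_gronwall _ _ D D' r M (C * `|h| ^+ 2) (e / (4 * n1) * `|h|) M0 _ _ small dD D'le D0 p t tr.
move=> /(_ _ _)/le_trans; apply; [by rewrite mulr_ge0// exprn_ge0|by rewrite mulr_ge0// ltW|].
have [->|h0] := eqVneq h 0; first by rewrite normr0 expr2 !(mulr0, addr0).
have hp : 0 < `|h| by rewrite normr_gt0.
have rC1 : 0 < r * C + 1 by rewrite ltr_pwDr// mulr_ge0// ltW.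
have he' : `|h| * (4 * n1 * (r * C + 1)) < e by rewrite -ltr_pdivlMr// !mulr_gt0.
rewrite (mulrA r C); apply: (@gronwall_error e n1 `|h| (r * C) N%:R) => //.
by rewrite mulr_ge0// ltW.
Qed.

Let V : set 'rV[R]_2 := [set z | forall i, `|z 0 i - y 0 i| < r].
Let F p (z : 'rV[R]_2) := X p (z 0 0 - y 0 0) (z 0 1 - y 0 1).

Lemma transport_partial p z i : V z -> is_derive z 'e_i (F p) (\sum_q A i p q z * F q z).
Proof.
move=> Vz; have zs : `|z 0 0 - y 0 0| < r by exact: Vz.
have zt : `|z 0 1 - y 0 1| < r by exact: Vz.
have E q : A i p q z * F q z = A i p q (pt (z 0 0 - y 0 0) (z 0 1 - y 0 1)) * F q z.
  by rewrite plane_ptE.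
rewrite (eq_bigr _ (fun q _ => E q)) {E}; elim/ord2P: i.
- apply: is_derive_of_line (transport_derive p zs zt) => h.
  by rewrite /F !mxE /= mulr1 mulr0 addr0 addrAC.
- apply: is_derive_of_line (dX p zs zt) => h.
  by rewrite /F !mxE /= mulr1 mulr0 addr0 [z 0 1 + h - _]addrAC.
Qed.

(** Lipschitz bounds in each variable separately, with constants uniform in the other one. *)
Lemma transport_continuous p z : V z -> {for z, continuous (F p)}.
Proof.
move=> Vz; apply/rV_continuousP => e e0.
pose L := M * (N%:R * B1).
have L1 : 0 < `|L| + 1 by rewrite ltr_pwDr.
have Vnear : \forall w \near z, V w by have := @box_open 2 y r; rewrite openE; apply; exact: Vz.
have enear : \forall w \near z, forall i, `|(w : 'rV[R]_2) 0 i - z 0 i| < e / 2 / (`|L| + 1).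
  by apply/rV_nbhsP; exists (e / 2 / (`|L| + 1)) => //; rewrite !divr_gt0.
apply: filterS (filterI Vnear enear) => w [Vw we].
have L0 a b : `|a| < r -> `|b| < r -> `|X p a (w 0 1 - y 0 1) - X p b (w 0 1 - y 0 1)| <= L * `|a - b|.
  apply: (@lipschitz_of_derive _ (fun s => X p s (w 0 1 - y 0 1)) (fun s => AX p s (w 0 1 - y 0 1)) r L).
    by move=> u ur; apply: transport_derive => //; exact: Vw.
  by move=> u ur; apply: AX_bound => //; exact: Vw.
have L2 a b : `|a| < r -> `|b| < r -> `|X p (z 0 0 - y 0 0) a - X p (z 0 0 - y 0 0) b| <= L * `|a - b|.
  have zs := Vz 0; apply: (@lipschitz_of_derive _ (X p (z 0 0 - y 0 0)) (fun t => \sum_q A 1 p q (pt (z 0 0 - y 0 0) t) * X q (z 0 0 - y 0 0) t) r L).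
    by move=> u ur; exact: dX.
  move=> u ur; apply: le_trans (norm_sumM _ (fun q => AM 1 p q zs ur)) _; rewrite ler_wpM2l//.
  apply: le_trans (ler_sum _ (fun q _ => transport_bound q zs ur)) _.
  by rewrite sumr_const card_ord [X in _ <= X]mulr_natl.
have h0 := L0 _ _ (Vw 0) (Vz 0); have h1 := L2 _ _ (Vw 1) (Vz 1).
have bound (a b : R) : `|a - b| < e / 2 / (`|L| + 1) -> L * `|a - b| < e / 2.
  rewrite ltr_pdivlMr// => ab; apply: le_lt_trans ab; rewrite mulrC ler_wpM2l//.
  by apply: le_trans (ler_norm _) _; rewrite lerDl.
have cancel (a b u : R) : a - u - (b - u) = a - b by ring.
rewrite cancel in h0; rewrite cancel in h1.
have tri (a b c : R) : `|a - b| < e / 2 -> `|b - c| < e / 2 -> `|a - c| < e.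
  move=> ab bc; have -> : a - c = (a - b) + (b - c) by ring.
  by apply: le_lt_trans (ler_normD _ _) _; rewrite [e]splitr; exact: ltrD.
exact: tri (le_lt_trans h0 (bound _ _ (we 0))) (le_lt_trans h1 (bound _ _ (we 1))).
Qed.

(** Bootstrapping: the derivatives of the [F q] are combinations of the smooth coefficients and the
    [F q] themselves, so [generated_smooth] applies. *)
Lemma transport_smooth p : smooth_on V (F p).
Proof.
pose B f := smooth_on V f \/ exists q, f = F q.
apply: (@generated_smooth _ _ V (@box_open 2 y r) B); last by apply: generated_base; right; exists p.
move=> f [sf|[q ->]]; split=> [z Vz|z i Vz|i].
- exact: smooth_continuous Vz.
- exact: smooth_derivable Vz.
- by exists (partial i f) => //; apply: generated_base; left; exact: smooth_partial.
- exact: transport_continuous.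
- by have [] := transport_partial q i Vz.
exists (fun z => \sum_k A i q k z * F k z); last first.
  by move=> z Vz; have [_] := transport_partial q i Vz.
apply: generated_sum => k; apply: generated_mul; apply: generated_base; [left|by right; exists k].
apply: smooth_sub (sA i q k) => z Vz; rewrite -(plane_ptE z); apply: inU; exact: Vz.
Qed.

End Transport.

Lemma pt_continuous (f : 'rV[R]_2 -> R) (a b : R -> R) (t : R) : continuous a -> continuous b ->
  {for pt (a t) (b t), continuous f} -> continuous_at t (fun u : R => f (pt (a u) (b u)) : R).
Proof.
move=> ca cb cf; apply: (proj2 (@cvgrPdistC_lt _ _ _ (nbhs t) (nbhs_filter t) _ _)) => e e0.
have [r r0 H] := proj1 (@rV_nbhsP _ _ _ _) (proj1 (@rV_continuousP _ _ _ _) cf e e0).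
have na : nbhs t [set u | `|a u - a t| < r] := proj1 (@cvgrPdistC_lt _ _ _ (nbhs t) (nbhs_filter t) a (a t)) (ca t) r r0.
have nb : nbhs t [set u | `|b u - b t| < r] := proj1 (@cvgrPdistC_lt _ _ _ (nbhs t) (nbhs_filter t) b (b t)) (cb t) r r0.
change (nbhs t [set u | `|f (pt (a u) (b u)) - f (pt (a t) (b t))| < e]); apply: (@filterS _ _ (nbhs_filter t) _ _ _ (@filterI _ _ (nbhs_filter t) _ _ na nb)) => u [ua ub]; apply: H => i.
have cancel (p q v w x : R) : p + q + v - (p + w + x) = (q - w) + (v - x) by ring.
by rewrite /pt !mxE cancel; elim/ord2P: i; rewrite /= ?mulr1 ?mulr0 ?subrr ?addr0 ?add0r.
Qed.

(** The solution is transported along the horizontal line through [y] and from there along vertical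
    lines. The vertical equation then holds by construction, the horizontal one by
    [transport_derive]. *)
Theorem frobenius (x0 : 'I_N -> R) : exists2 r : R, 0 < r & exists X : 'I_N -> 'rV[R]_2 -> R,
  let V := [set z : 'rV[R]_2 | forall i, `|z 0 i - y 0 i| < r] in
  [/\ V `<=` U, forall p, X p y = x0 p, forall p, smooth_on V (X p) &
    forall p i z, V z -> partial i (X p) z = \sum_q A i p q z * X q z].
Proof.
have [M M0 [rho rho0 H]] := local_bounds.
have Nn : 0 < 2 * (N%:R + 1) * (M + 1) :> R by rewrite !mulr_gt0// ltr_pwDr.
(* Small enough for the box to lie where the bounds hold and for [N r1 M] to be at most 1/2; the
   added ones keep the denominator positive. *)
pose r1 := Num.min (rho / 2) (2 * (N%:R + 1) * (M + 1))^-1.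
have r10 : 0 < r1 by rewrite lt_min divr_gt0//= invr_gt0.
have r1rho : r1 < rho.
  by apply: le_lt_trans (_ : rho / 2 < rho); [rewrite ge_min lexx|rewrite ltr_pdivrMr// ltr_pMr// ltr1n].
have small1 : N%:R * (r1 * M) <= 2^-1.
  have h : r1 * (2 * (N%:R + 1) * (M + 1)) <= 1.
    by rewrite -ler_pdivlMr// mul1r ge_min lexx orbT.
  have h1 : 0 <= r1 * N%:R by rewrite mulr_ge0// ltW.
  have h2 : 0 <= r1 * M by rewrite mulr_ge0// ltW.
  have h3 := ltW r10; have e : N%:R * (r1 * M) = r1 * N%:R * M by ring.
  rewrite e; lra.
have clr t : `|clamp r1 t| < rho by apply: le_lt_trans r1rho; apply: clamp_le; exact: ltW.
have r2 : 0 < r1 / 2 by rewrite divr_gt0.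
have r21 : r1 / 2 < r1 by rewrite ltr_pdivrMr// ltr_pMr// ltr1n.
have z0 (a : R) : 0 < a -> `|0 : R| < a by rewrite normr0.
(* Clamping makes the coefficients continuous and bounded on the whole line, as [linear_ode]
   requires. *)
have [xi [xi0 dxi]] := @linear_ode R N (fun p q t => A 0 p q (pt (clamp r1 t) 0)) x0 M r1
  (fun p q => ltac:(move=> t; apply: (@pt_continuous (A 0 p q) (clamp r1) (fun=> 0));
     [exact: clamp_continuous|move=> ?; exact: cst_continuous|apply: (smooth_continuous (sA 0 p q)); have [//] := H _ _ (clr t) (z0 _ rho0)]))
  (fun p q t => ltac:(have [_ h _ _] := H _ _ (clr t) (z0 _ rho0); exact: h)) M0 r10 small1.
(* The vertical solutions are chosen for each [s] independently, with a dummy value outside the box;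
   their regularity in [s] is established afterwards. *)
have ode1 s : exists X : 'I_N -> R -> R, `|s| < r1 / 2 -> (forall p, X p 0 = xi p s) /\
    (forall p t, `|t| < r1 / 2 -> is_derive t (1 : R) (X p) (\sum_q A 1 p q (pt s (clamp r1 t)) * X q t)).
  have [sr|_] := ltP `|s| (r1 / 2); last by exists (fun _ _ => 0).
  have sr' := lt_trans sr (lt_trans r21 r1rho).
  have [X XP] := @linear_ode R N (fun p q t => A 1 p q (pt s (clamp r1 t))) (fun p => xi p s) M r1
    (fun p q => ltac:(move=> t; apply: (@pt_continuous (A 1 p q) (fun=> s) (clamp r1));
     [move=> ?; exact: cst_continuous|exact: clamp_continuous|apply: (smooth_continuous (sA 1 p q)); have [//] := H _ _ sr' (clr t)]))
    (fun p q t => ltac:(have [_ h _ _] := H _ _ sr' (clr t); exact: h)) M0 r10 small1.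
  by exists X.
have [X XP] := choice ode1.
have cl t : `|t| < r1 / 2 -> clamp r1 t = t by move=> tr; apply/clamp_id/ltW/(lt_trans tr).
have lt_rho (t : R) : `|t| < r1 / 2 -> `|t| < rho by move=> tr; exact: lt_trans tr (lt_trans r21 r1rho).
have small2 : N%:R * (r1 / 2 * M) <= 2^-1.
  apply: le_trans small1; rewrite ler_wpM2l//; rewrite ler_wpM2r//; exact: ltW.
have dxi' p s : `|s| < r1 / 2 -> is_derive s (1 : R) (xi p) (\sum_q A 0 p q (pt s 0) * xi q s).
  by move=> sr; have := dxi p s sr; rewrite cl.
have dX p s t : `|s| < r1 / 2 -> `|t| < r1 / 2 ->
    is_derive t (1 : R) (X s p) (\sum_q A 1 p q (pt s t) * X s q t).
  by move=> sr tr; have := (XP s sr).2 p t tr; rewrite cl.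
have X0 p s : `|s| < r1 / 2 -> X s p 0 = xi p s by move=> sr; exact: (XP s sr).1.
have B0 : 0 <= \sum_p `|x0 p| by apply: sumr_ge0.
have xiB p : `|xi p 0| <= \sum_p `|x0 p|.
  by rewrite xi0 (bigD1 p)//= lerDl sumr_ge0.
have inU s t : `|s| < r1 / 2 -> `|t| < r1 / 2 -> U (pt s t).
  by move=> sr tr; have [] := H s t (lt_rho s sr) (lt_rho t tr).
have AM s t i p q : `|s| < r1 / 2 -> `|t| < r1 / 2 -> `|A i p q (pt s t)| <= M.
  by move=> sr tr; have [_ h _ _] := H s t (lt_rho s sr) (lt_rho t tr); exact: h.
have dAM s t p q : `|s| < r1 / 2 -> `|t| < r1 / 2 -> `|partial 0 (A 1 p q) (pt s t)| <= M.
  by move=> sr tr; have [_ _ h _] := H s t (lt_rho s sr) (lt_rho t tr); exact: h.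
have ddAM s t p q : `|s| < r1 / 2 -> `|t| < r1 / 2 -> `|partial 0 (partial 0 (A 1 p q)) (pt s t)| <= M.
  by move=> sr tr; have [_ _ _ h] := H s t (lt_rho s sr) (lt_rho t tr); exact: h.
exists (r1 / 2) => //; exists (fun p z => X (z 0 0 - y 0 0) p (z 0 1 - y 0 1)) => V.
split.
- by move=> z Vz; rewrite -(plane_ptE z); apply: inU; exact: Vz.
- by move=> p; rewrite !subrr X0 ?xi0// normr0.
- move=> p; exact: (@transport_smooth M (r1 / 2) (\sum_p `|x0 p|) xi (fun p s t => X s p t)).
- move=> p i z Vz.
  by have [_] := @transport_partial M (r1 / 2) (\sum_p `|x0 p|) xi (fun p s t => X s p t) M0 r2 B0 small2 inU AM dAM ddAM xiB dxi' X0 dX p z i Vz.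
Qed.

End Frobenius.

(** * Local conformal flatness *)

Section GradientForm.
Context {R : realType} {n : nat}.
Variables (U : set 'rV[R]_n) (G : 'rV[R]_n -> 'M[R]_n) (mG : smooth_metric U G).
Let oU := smet_open mG.

Lemma gradientE f k z : gradient G z f 0 k = \sum_l invmx (G z) k l * partial l f z.
Proof. by rewrite mxE. Qed.

Lemma partial_gradientE f z i : U z -> partial i f z = \sum_k G z i k * gradient G z f 0 k.
Proof.
move=> Uz; pose w : 'cV[R]_n := \col_l partial l f z.
have : G z *m (invmx (G z) *m w) = w by rewrite mulKVmx// (smet_unit mG).
move/matrixP/(_ i 0); rewrite !mxE => <-; apply: eq_bigr => k _.
by rewrite gradientE mxE; congr (_ * _); apply: eq_bigr => l _; rewrite mxE.
Qed.

Lemma grad_form_gradient f h z :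
  grad_form G f h z = \sum_k partial k f z * gradient G z h 0 k.
Proof.
rewrite /grad_form /pairing; apply: eq_bigr => k _.
by rewrite gradientE mulr_sumr; apply: eq_bigr => l _; rewrite -!mulrA mulrCA.
Qed.

Lemma grad_formC f h z : U z -> grad_form G f h z = grad_form G h f z.
Proof. by move=> Uz; apply/pairingC/invmx_sym/(smet_sym mG). Qed.

Variables (f h : 'rV[R]_n -> R) (sf : smooth_on U f) (sh : smooth_on U h).

Lemma smooth_gradient k : smooth_on U (fun z => gradient G z f 0 k).
Proof.
apply: (smooth_eq oU (f := fun z => \sum_l invmx (G z) k l * partial l f z)).
  by move=> z _; rewrite gradientE.
apply: smooth_sum => // l; apply: smoothM => //; last exact: smooth_partial.
by apply: smooth_invmx => //; [exact: smet_smooth mG|exact: smet_unit mG].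
Qed.

Lemma smooth_hessian i j : smooth_on U (fun z => hessian G z f i j).
Proof.
apply: (smooth_eq oU (f := fun z => partial i (partial j f) z
  - \sum_k christoffel G k i j z * partial k f z)) => [z _|]; first by rewrite mxE.
apply: smoothB => //; first by do 2 apply: smooth_partial.
apply: smooth_sum => // k; apply: smoothM => //; [exact: smooth_christoffel|exact: smooth_partial].
Qed.

End GradientForm.

Section GradientFormDerivative.
Context {R : realType} {n : nat}.
Variables (U : set 'rV[R]_n) (G : 'rV[R]_n -> 'M[R]_n) (mG : smooth_metric U G).
Variables (f h : 'rV[R]_n -> R) (sf : smooth_on U f) (sh : smooth_on U h).
Let oU := smet_open mG.

Lemma smooth_grad_form : smooth_on U (grad_form G f h).
Proof.
apply: (smooth_eq oU (f := fun z => \sum_k partial k f z * gradient G z h 0 k)).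
  by move=> z _; rewrite grad_form_gradient.
by apply: smooth_sum => // k; apply: smoothM => //; [exact: smooth_partial|exact: smooth_gradient].
Qed.

(** The product rule for the Levi-Civita connection: the derivative of the metric supplies the
    Christoffel terms of both Hessians. *)
Lemma partial_grad_form i y : U y ->
  partial i (grad_form G f h) y =
  \sum_p hessian G y f i p * gradient G y h 0 p + \sum_p hessian G y h i p * gradient G y f 0 p.
Proof.
move=> Uy; pose v k z := gradient G z h 0 k; pose u k := gradient G y f 0 k.
have sv k : smooth_on U (v k) by exact: smooth_gradient.
have sG j k := smet_smooth mG j k.
have dv k := smooth_derivable (i := i) (sv k) Uy.
have dG j k := smooth_derivable (i := i) (sG j k) Uy.
have df k := smooth_derivable (i := i) (smooth_partial k sf) Uy.
have E1 : partial i (grad_form G f h) y =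
    \sum_k partial i (partial k f) y * v k y + \sum_k partial k f y * partial i (v k) y.
  rewrite (@partial_eq_near _ _ (grad_form G f h) (fun z => \sum_k partial k f z * v k z)).
    rewrite partial_sum; first by rewrite -big_split; apply: eq_bigr => k _; rewrite partialM.
    by move=> k; apply: derivableM.
  by apply: (open_near oU Uy) => z Uz; rewrite grad_form_gradient.
(* The relation [dh = G grad h] is differentiated, rather than its inverse, so that no derivative of
   the inverse metric appears. *)
have E2 k : partial i (partial k h) y =
    \sum_l partial i (fun z => G z k l) y * v l y + \sum_l G y k l * partial i (v l) y.
  rewrite (@partial_eq_near _ _ (partial k h) (fun z => \sum_l G z k l * v l z)).
    rewrite partial_sum; first by rewrite -big_split; apply: eq_bigr => l _; rewrite partialM.
    by move=> l; apply: derivableM.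
  by apply: (open_near oU Uy) => z Uz; rewrite (partial_gradientE mG).
have E3 : \sum_k partial k f y * partial i (v k) y = \sum_k (\sum_l G y k l * partial i (v l) y) * u k.
  rewrite (eq_bigr (fun k => \sum_l G y k l * u l * partial i (v k) y)) => [|k _]; last first.
    by rewrite (partial_gradientE mG _ _ Uy) mulr_suml.
  rewrite exchange_big/=; apply: eq_bigr => l _; rewrite mulr_suml; apply: eq_bigr => k _.
  by rewrite (metric_symE mG k l Uy) mulrAC.
have E4 : \sum_k (\sum_l partial i (fun z => G z k l) y * v l y) * u k =
    \sum_k (\sum_m christoffel1 G m i k y * v m y) * u k
    + \sum_k (\sum_m christoffel1 G m i k y * u m) * v k y.
  rewrite [X in _ = _ + X](eq_bigr (fun k => \sum_m christoffel1 G m i k y * u m * v k y)) => [|k _]; last by rewrite mulr_suml.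
  rewrite exchange_big/= -big_split/=; apply: eq_bigr => k _.
  rewrite [X in _ = _ + X](eq_bigr (fun l => christoffel1 G k i l y * v l y * u k)) => [|l _]; last by rewrite mulrAC.
  rewrite -mulr_suml -mulrDl -big_split/=; congr (_ * _); apply: eq_bigr => l _.
  by rewrite (partial_metric mG _ _ _ Uy) mulrDl addrC.
have christoffel_gradient (F : 'rV[R]_n -> R) p :
    hessian G y F i p = partial i (partial p F) y - \sum_m christoffel1 G m i p y * gradient G y F 0 m.
  rewrite (hessian_grad_form mG _ _ _ Uy); congr (_ - _); apply: eq_bigr => m _.
  by rewrite gradientE mulr_sumr; apply: eq_bigr => q _; rewrite mulrAC mulrC.
have E5 : \sum_p hessian G y f i p * v p y = \sum_p partial i (partial p f) y * v p y -
    \sum_k (\sum_m christoffel1 G m i k y * u m) * v k y.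
  by rewrite -sumrB; apply: eq_bigr => p _; rewrite christoffel_gradient mulrBl.
have E6 : \sum_p hessian G y h i p * u p = \sum_k (\sum_l partial i (fun z => G z k l) y * v l y) * u k
    + \sum_k (\sum_l G y k l * partial i (v l) y) * u k -
    \sum_k (\sum_m christoffel1 G m i k y * v m y) * u k.
  rewrite -big_split -sumrB; apply: eq_bigr => p _; rewrite christoffel_gradient mulrBl E2 mulrDl.
  by [].
have fin (a b c d e : R) : c = d + e -> a + b = a - e + (c + b - d) by move=> ->; ring.
rewrite E1 E3 E5 E6; exact: fin E4.
Qed.

End GradientFormDerivative.

Section HyperbolicFunction.
Context {R : realType}.
Variables (U : set 'rV[R]_2) (G : 'rV[R]_2 -> 'M[R]_2) (mG : smooth_metric U G).
Variables (c : R) (y : 'rV[R]_2).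
Hypotheses (c0 : 0 <= c) (Uy : U y) (pG : posdef (G y)).
Hypothesis curv : forall z, U z -> gauss_curvature G z = - c.
Let oU := smet_open mG.

(* The equations [d f = w], [nabla w = c f g] for the pair [X = (f, w)]. *)
Definition hessian_system (i : 'I_2) (p q : 'I_(1 + 2)) (z : 'rV[R]_2) : R :=
  match fintype.split p, fintype.split q with
  | inl _, inl _ => 0
  | inl _, inr k => (i == k)%:R
  | inr j, inl _ => c * G z i j
  | inr j, inr k => christoffel G k i j z
  end.

Lemma hessian_system00 i a b : hessian_system i (lshift 2 a) (lshift 2 b) = fun=> 0.
Proof. by apply/funext => z; rewrite /hessian_system !(unsplitK (inl _)). Qed.

Lemma hessian_system0S i a k : hessian_system i (lshift 2 a) (rshift 1 k) = fun=> (i == k)%:R.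
Proof. by apply/funext => z; rewrite /hessian_system (unsplitK (inl _)) (unsplitK (inr _)). Qed.

Lemma hessian_systemS0 i j b : hessian_system i (rshift 1 j) (lshift 2 b) = fun z => c * G z i j.
Proof. by apply/funext => z; rewrite /hessian_system (unsplitK (inl _)) (unsplitK (inr _)). Qed.

Lemma hessian_systemSS i j k : hessian_system i (rshift 1 j) (rshift 1 k) = christoffel G k i j.
Proof. by apply/funext => z; rewrite /hessian_system !(unsplitK (inr _)). Qed.

Definition hessian_systemE :=
  (hessian_system00, hessian_system0S, hessian_systemS0, hessian_systemSS).

Lemma smooth_hessian_system i p q : smooth_on U (hessian_system i p q).
Proof.
case: (split_ordP p) => p' ->; case: (split_ordP q) => q' ->; rewrite hessian_systemE.
- exact: smooth_cst.
- exact: smooth_cst.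
- by apply: smoothM (smooth_cst _ _) (smet_smooth mG _ _).
- exact: smooth_christoffel.
Qed.

(** Curvature equal to [- c], with one index raised, is the integrability condition in the covector
    components of the system. *)
Lemma flat_christoffel z j k : U z ->
  partial 1 (christoffel G k 0 j) z + (c * G z 0 j * (1 == k :> 'I_2)%:R + \sum_s christoffel G s 0 j z * christoffel G k 1 s z) =
  partial 0 (christoffel G k 1 j) z + (c * G z 1 j * (0 == k :> 'I_2)%:R + \sum_s christoffel G s 1 j z * christoffel G k 0 s z).
Proof.
move=> Uz; pose rho k := partial 0 (christoffel G k 1 j) z - partial 1 (christoffel G k 0 j) z
  + \sum_p (christoffel G k 0 p z * christoffel G p 1 j z - christoffel G k 1 p z * christoffel G p 0 j z).
pose sig (k : 'I_2) := c * G z 0 j * (1 == k)%:R - c * G z 1 j * (0 == k)%:R.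
(* The curvature is known with all indices lowered; the metric is cancelled in the next step. *)
have lower m : \sum_k G z m k * rho k = \sum_k G z m k * sig k.
  have := riemann_surface mG Uz 0 1 m j; rewrite curv// /riemann => ->.
  rewrite !sum2E /sig (metric_symE mG m 0 Uz) (metric_symE mG m 1 Uz) eqxx.
  have -> : (1 == 0 :> 'I_2) = false by []. have -> : (0 == 1 :> 'I_2) = false by [].
  rewrite eqxx; generalize (G z 0 m) (G z 0 j) (G z 1 m) (G z 1 j) => a b d e.
  by rewrite !mulr1 !mulr0; ring.
have rs : rho k = sig k.
  pose r : 'cV[R]_2 := \col_k rho k; pose s : 'cV[R]_2 := \col_k sig k.
  have : G z *m r = G z *m s.
    apply/matrixP => i i'; rewrite !mxE; have := lower i.
    by rewrite (eq_bigr (fun k => G z i k * r k i')) => [->|? _]; [apply: eq_bigr => ? _; rewrite mxE|rewrite mxE].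
  move/(congr1 (mulmx (invmx (G z)))); rewrite !mulKmx ?(smet_unit mG)//.
  by move/matrixP/(_ k 0); rewrite !mxE.
have fin (a b u v x w : R) : b - a + (x - w) = u - v -> a + (u + w) = b + (v + x).
  move=> h; have -> : b = b - a + (x - w) + a - (x - w) by ring.
  by rewrite h; ring.
have comm a b : \sum_s christoffel G s a j z * christoffel G k b s z =
    \sum_s christoffel G k b s z * christoffel G s a j z by apply: eq_bigr => s _; rewrite mulrC.
rewrite !comm; apply: fin; rewrite -sumrB; exact: rs.
Qed.

(** The four blocks express, in this order, the symmetry of the metric, the vanishing of torsion,
    compatibility with the metric and the value [- c] of the curvature. *)
Lemma flat_hessian_system z p q : U z ->
  partial 1 (hessian_system 0 p q) z + \sum_s hessian_system 0 p s z * hessian_system 1 s q z =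
  partial 0 (hessian_system 1 p q) z + \sum_s hessian_system 1 p s z * hessian_system 0 s q z.
Proof.
move=> Uz; rewrite !big_split_ord !big_ord1 /= !sum2E.
case: (split_ordP p) => p' ->; case: (split_ordP q) => q' ->; rewrite !hessian_systemE.
- rewrite !partial_cst /= !(mul0r, mul1r, add0r, addr0) /=; congr (_ * _).
  exact: (metric_symE mG).
- rewrite !partial_cst /= !(mul0r, mul1r, add0r, addr0) /=.
  exact: (christoffelC mG).
- rewrite !partialZ; [|exact: smooth_derivable (smet_smooth mG _ _) Uz..].
  rewrite /= !mulr0 !add0r.
  have l0 := lower_christoffel mG 1 0 p' Uz; have l1 := lower_christoffel mG 0 1 p' Uz.
  rewrite sum2E in l0; rewrite sum2E in l1.
  rewrite (partial_metric mG 1 0 p' Uz) (partial_metric mG 0 1 p' Uz).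
  rewrite (christoffel1C mG p' 1 0 Uz) -l0 -l1.
  generalize (christoffel1 G p' 0 1 z) (christoffel G 0 0 p' z) (christoffel G 1 0 p' z)
    (christoffel G 0 1 p' z) (christoffel G 1 1 p' z) (G z 1 0) (G z 1 1) (G z 0 0) (G z 0 1) => *; ring.
- have := flat_christoffel p' q' Uz; rewrite !sum2E; exact.
Qed.

Lemma covector_of_norm : exists w : 'I_2 -> R, pairing (invmx (G y)) w w = c.
Proof.
have [b ub Gb] := cholesky2 (smet_sym mG Uy) pG.
(* The columns of the Cholesky factor are an orthonormal coframe; this is where [0 <= c] is used. *)
exists (fun i => Num.sqrt c * b i 0).
rewrite pairingZl pairingZr mulrA -expr2 sqr_sqrtr//.
suff -> : pairing (invmx (G y)) (b^~ 0) (b^~ 0) = 1 by rewrite mulr1.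
have : b^T *m invmx (G y) *m b = 1%:M.
  have -> : b^T = invmx b *m G y by rewrite Gb mulmxA mulVmx// mul1mx.
  by rewrite mulmxK ?(smet_unit mG)// mulVmx.
move/matrixP/(_ 0 0) => h; transitivity ((b^T *m invmx (G y) *m b) 0 0); last by rewrite h mxE.
rewrite mxE /pairing exchange_big/=; apply: eq_bigr => q _; rewrite mxE mulr_suml.
by apply: eq_bigr => p _; rewrite mxE [b p 0 * _]mulrC.
Qed.

(** Used to propagate a first integral from [y] to the box, along a horizontal and then a vertical
    segment. *)
Lemma zero_of_partial (D : 'rV[R]_2 -> R) (r : R) :
  let V := [set z : 'rV[R]_2 | forall i, `|z 0 i - y 0 i| < r] in
  0 < r -> smooth_on V D -> (forall i z, V z -> partial i D z = 0) -> D y = 0 ->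
  forall z, V z -> D z = 0.
Proof.
move=> V' r0 sD dD Dy z Vz.
have step i w h : (forall s, `|s| <= `|h| -> V' (w + s *: 'e_i)) -> D (w + h *: 'e_i) = D w.
  move=> Vw; have [s sh] := @mvt_line _ _ D w 'e_i h (fun s sh => smooth_derivable sD (Vw s sh)).
  have -> : 'D_('e_i) D (w + s *: 'e_i) = 0 by apply: dD; exact: Vw.
  by rewrite mul0r => /eqP; rewrite subr_eq0 => /eqP.
have zE : z = y + (z 0 0 - y 0 0) *: 'e_0 + (z 0 1 - y 0 1) *: 'e_1.
  by rewrite plane_ptE.
rewrite zE !step// => s sz; elim/ord2P.
- have -> : (y + s *: 'e_0) 0 0 - y 0 0 = s by rewrite !mxE /= mulr1 addrC addKr.
  exact: le_lt_trans sz (Vz 0).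
- have -> : (y + s *: 'e_0) 0 1 - y 0 1 = 0 by rewrite !mxE /= mulr0 addr0 subrr.
  by rewrite normr0.
- have -> : (y + (z 0 0 - y 0 0) *: 'e_0 + s *: 'e_1) 0 0 - y 0 0 = z 0 0 - y 0 0.
    by rewrite !mxE /= mulr0 mulr1 addr0 addrC addKr.
  exact: Vz 0.
- have -> : (y + (z 0 0 - y 0 0) *: 'e_0 + s *: 'e_1) 0 1 - y 0 1 = s.
    by rewrite !mxE /= mulr0 mulr1 addr0 addrC addKr.
  exact: le_lt_trans sz (Vz 1).
Qed.

(* For [c = 1] one may take [f = 1 / y] in the Poincare half-plane; [g / f^2] is
   flat, and so is [(g + h) / f^2] when [h] has curvature [c]. *)
Lemma hyperbolic_function : exists (V : set 'rV[R]_2) (f : 'rV[R]_2 -> R),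
  [/\ open V, V y, V `<=` U & smooth_on V f] /\
  forall z, V z -> [/\ 0 < f z, forall i j, hessian G z f i j = c * f z * G z i j &
    grad_form G f f z = c * f z ^+ 2].
Proof.
have [w wc] := covector_of_norm.
(* The initial value is [f = 1] with [df] of squared length [c], so that [|df|^2 = c f^2] holds at
   [y]. *)
pose x0 (p : 'I_(1 + 2)) := match fintype.split p with inl _ => 1 | inr j => w j end.
have [r r0 [X [VU X0 sX dX]]] := @frobenius R (1 + 2)%N U y hessian_system oU Uy smooth_hessian_system
  (fun z p q Uz => flat_hessian_system p q Uz) x0.
pose V := [set z : 'rV[R]_2 | forall i, `|z 0 i - y 0 i| < r].
have oV : open V by exact: box_open.
have Vy : V y by move=> i; rewrite subrr normr0.
pose f := X (lshift 2 0); pose om j := X (rshift 1 j).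
have fE i z : V z -> partial i f z = om i z.
  move=> Vz; rewrite /f dX// big_split_ord big_ord1/= hessian_systemE mul0r add0r.
  rewrite (bigD1 i)//= hessian_systemE eqxx mul1r big1 ?addr0// => k ki.
  by rewrite hessian_systemE eq_sym (negbTE ki) mul0r.
have omE i j z : V z -> partial i (om j) z = c * G z i j * f z + \sum_k christoffel G k i j z * om k z.
  move=> Vz; rewrite /om dX// big_split_ord big_ord1/= hessian_systemE; congr (_ + _).
  by apply: eq_bigr => k _; rewrite hessian_systemE.
have H z i j : V z -> hessian G z f i j = c * f z * G z i j.
  move=> Vz; rewrite mxE (@partial_eq_near _ _ (partial j f) (om j)); last first.
    by apply: (open_near oV Vz) => u Vu; rewrite fE.
  have -> : \sum_k christoffel G k i j z * partial k f z = \sum_k christoffel G k i j z * om k z.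
    by apply: eq_bigr => k _; rewrite fE.
  rewrite omE//.
  by rewrite addrK mulrAC.
have mGV : smooth_metric V G.
  split=> //.
  - by move=> i j; apply: smooth_sub (smet_smooth mG i j).
  - by move=> z /VU; exact: smet_sym mG z.
  - by move=> z /VU; exact: smet_unit mG z.
have sf : smooth_on V f by exact: sX.
(* A first integral: its differential is twice the Hessian on the gradient minus [2 c f df], hence
   zero. *)
pose D z := grad_form G f f z - c * f z ^+ 2.
have sQ := smooth_grad_form mGV sf sf.
have sf2 : smooth_on V (fun z => f z ^+ 2) by exact: smoothX.
have scf2 : smooth_on V (fun z => c * f z ^+ 2) by apply: smoothM => //; exact: smooth_cst.
have sD : smooth_on V D by exact: smoothB.
have D0 z : V z -> D z = 0.
  apply: (zero_of_partial r0 sD); last first.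
    rewrite /D /grad_form; have -> : f y = 1 by rewrite /f X0 /x0 (unsplitK (inl _)).
    have -> : partial^~ f^~ y = w.
      by apply/funext => j; rewrite fE// /om X0 /x0 (unsplitK (inr _)).
    by rewrite wc expr1n mulr1 subrr.
  move=> i u Vu; rewrite /D partialB; [|exact: smooth_derivable sQ Vu|exact: smooth_derivable scf2 Vu].
  rewrite (partial_grad_form mGV sf sf i Vu) partialZ; last exact: smooth_derivable sf2 Vu.
  rewrite (partial_sqr sf i Vu) (partial_gradientE mGV _ _ Vu).
  rewrite (eq_bigr (fun p => c * f u * (G u i p * gradient G u f 0 p))) => [|p _]; last by rewrite H// mulrA.
  rewrite -mulr_sumr; have alg (a b : R) : c * b * a + c * b * a - c * (2 * b * a) = 0 by ring.
  exact: alg.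
have fy : f y = 1 by rewrite /f X0 /x0 (unsplitK (inl _)).
have fpos : \forall z \near y, 0 < f z.
  have := proj1 (@rV_continuousP _ _ _ _) (smooth_continuous sf Vy) 1 ltr01.
  by apply: filterS => z; rewrite fy ltr_norml => /andP[]; rewrite ltrBrDr addNr.
have [r' r'0 pos] := proj1 (@rV_nbhsP _ _ _ _) fpos.
exists (V `&` [set z | forall i, `|z 0 i - y 0 i| < r']), f.
split; [split|].
- by apply: openI => //; exact: box_open.
- by split=> // i; rewrite subrr normr0.
- by move=> z [/VU].
- by apply: smooth_sub sf => z [].
- move=> z [Vz /pos fz]; split=> //; first by move=> i j; exact: H.
  by apply/eqP; rewrite -subr_eq0; apply/eqP; exact: D0.
Qed.

End HyperbolicFunction.

Section FlatConformal.
Context {R : realType} {n : nat}.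
Variables (U : set 'rV[R]_n) (G : 'rV[R]_n -> 'M[R]_n) (mG : smooth_metric U G).
Variables (F : 'rV[R]_n -> R) (sF : smooth_on U F) (F0 : forall y, U y -> F y != 0).

(** With [G = S + T] the three contributions have coefficients [-1 + 2 - 1] on the part in [S]
    alone, [1 - 1] on the mixed part and [1 - 1] on the part in [T] alone. *)
Lemma flat_conformal c (S T : 'M[R]_n) y : U y -> (forall i j, G y i j = S i j + T i j) ->
  (forall i j k l, riemann G y i j k l =
    - c * (S i k * S j l - S i l * S j k) + c * (T i k * T j l - T i l * T j k)) ->
  (forall i j, hessian G y F i j = c * F y * S i j) -> grad_form G F F y = c * F y ^+ 2 ->
  forall i j k l, riemann (fun z => (F z ^+ 2)^-1 *: G z) y i j k l = 0.
Proof.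
move=> Uy GST RST HS QF i j k l.
rewrite (riemann_conformal_sqr mG sF F0 _ _ _ _ Uy) RST !HS QF !GST.
have := F0 Uy; move: (F y) => r r0.
move: (S i k) (S j l) (S i l) (S j k) (T i k) (T j l) (T i l) (T j k) => s1 s2 s3 s4 t1 t2 t3 t4.
by field.
Qed.

End FlatConformal.

Section LocallyFlatProduct.
Context {R : realType}.
Variables (U1 : set 'rV[R]_2) (G1 : 'rV[R]_2 -> 'M[R]_2) (mG1 : smooth_metric U1 G1).
Variables (U2 : set 'rV[R]_2) (G2 : 'rV[R]_2 -> 'M[R]_2) (mG2 : smooth_metric U2 G2).
Variables (c : R) (y : 'rV[R]_(2 + 2)).
Hypotheses (Uy : product_set U1 U2 y).
Hypotheses (p1 : posdef (G1 (lsubmx y))) (p2 : posdef (G2 (rsubmx y))).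
Hypothesis curv1 : forall z, U1 z -> gauss_curvature G1 z = - c.
Hypothesis curv2 : forall z, U2 z -> gauss_curvature G2 z = c.

Lemma smooth_metric_sub n (U V : set 'rV[R]_n) G : open V -> V `<=` U ->
  smooth_metric U G -> smooth_metric V G.
Proof.
move=> oV VU mG; split=> //.
- by move=> i j; apply: smooth_sub (smet_smooth mG i j).
- by move=> z /VU; exact: smet_sym mG z.
- by move=> z /VU; exact: smet_unit mG z.
Qed.

Let flat_on (V : set 'rV[R]_(2 + 2)) (u : 'rV[R]_(2 + 2) -> R) :=
  [/\ open V, V y & V `<=` product_set U1 U2] /\
  [/\ smooth_on V u, forall z, V z -> 0 < u z & forall z, V z -> forall i j k l,
    riemann (fun w => u w *: product_metric G1 G2 w) z i j k l = 0].

Lemma block_sum (A D : 'M[R]_2) i j :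
  block_mx A 0 0 D i j = block_mx A 0 0 0 i j + block_mx 0 0 0 D i j.
Proof. by rewrite !block_diagE; case: fintype.split => a; case: fintype.split => b; rewrite ?mxE ?addr0 ?add0r. Qed.

Lemma riemann_opposite_curvatures z : product_set U1 U2 z ->
  let S := block_mx (G1 (lsubmx z)) 0 0 0 in
  let T := block_mx 0 0 0 (G2 (rsubmx z)) in
  forall i j k l, riemann (product_metric G1 G2) z i j k l =
    - c * (S i k * S j l - S i l * S j k) + c * (T i k * T j l - T i l * T j k).
Proof.
move=> Uz S T; apply: (riemann_product_metric mG1 mG2 (K1 := - c) (K2 := c) Uz).
  by move=> i j k l; rewrite (riemann_surface mG1 Uz.1) curv1//; exact: Uz.1.
by move=> i j k l; rewrite (riemann_surface mG2 Uz.2) curv2//; exact: Uz.2.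
Qed.

Lemma locally_flat_product : exists V u, flat_on V u.
Proof.
have [c0|c0] := leP 0 c.
- have [V [f [[oV Vy VU sf] H]]] := hyperbolic_function mG1 c0 Uy.1 p1 curv1.
  have mV := smooth_metric_sub oV VU mG1.
  have mP := smooth_product_metric mV mG2.
  have sub : product_set V U2 `<=` product_set U1 U2 by move=> z [/VU ? ?].
  have sF : smooth_on (product_set V U2) (fun z => f (lsubmx z)).
    by apply: smooth_sub (smooth_lsubmx sf) => z [].
  have f0 z : product_set V U2 z -> f (lsubmx z) != 0.
    by move=> [/H[fz _ _] _]; rewrite gt_eqF.
  exists (product_set V U2), (fun z => (f (lsubmx z) ^+ 2)^-1); split; split.
  + exact: smet_open mP.
  + by split=> //; exact: Uy.2.
  + exact: sub.
  + exact: (smooth_inv_sqr mP sF f0).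
  + by move=> z Vz; rewrite invr_gt0 exprn_even_gt0//= f0.
  + move=> z Vz; apply: (flat_conformal mP sF f0 Vz _ (riemann_opposite_curvatures (sub _ Vz))).
    * by move=> i j; rewrite /product_metric block_sum.
    * move=> i j; rewrite (hessian_product_l mV mG2)//; have [_ h _] := H _ Vz.1.
      by rewrite !block_diagE; case: fintype.split => a; case: fintype.split => b; rewrite ?h ?mxE ?mulr0.
    * by rewrite (grad_form_product_l mV mG2)//; have [] := H _ Vz.1.
(* For negative [c] the second factor is the one of curvature [- - c], and the auxiliary function
   lives there. *)
- have c0' : 0 <= - c by rewrite oppr_ge0 ltW.
  have curv2' z : U2 z -> gauss_curvature G2 z = - - c by rewrite opprK; exact: curv2.
  have [V [f [[oV Vy VU sf] H]]] := hyperbolic_function mG2 c0' Uy.2 p2 curv2'.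
  have mV := smooth_metric_sub oV VU mG2.
  have mP := smooth_product_metric mG1 mV.
  have sub : product_set U1 V `<=` product_set U1 U2 by move=> z [? /VU ?].
  have sF : smooth_on (product_set U1 V) (fun z => f (rsubmx z)).
    by apply: smooth_sub (smooth_rsubmx sf) => z [].
  have f0 z : product_set U1 V z -> f (rsubmx z) != 0.
    by move=> [_ /H[fz _ _]]; rewrite gt_eqF.
  exists (product_set U1 V), (fun z => (f (rsubmx z) ^+ 2)^-1); split; split.
  + exact: smet_open mP.
  + by split=> //; exact: Uy.1.
  + exact: sub.
  + exact: (smooth_inv_sqr mP sF f0).
  + by move=> z Vz; rewrite invr_gt0 exprn_even_gt0//= f0.
  + move=> z Vz; apply: (flat_conformal mP sF f0 (c := - c)
      (S := block_mx 0 0 0 (G2 (rsubmx z))) (T := block_mx (G1 (lsubmx z)) 0 0 0) Vz).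
    * by move=> i j; rewrite /product_metric block_sum addrC.
    * by move=> i j k l; rewrite (riemann_opposite_curvatures (sub _ Vz)) opprK addrC.
    * move=> i j; rewrite (hessian_product_r mG1 mV)//; have [_ h _] := H _ Vz.2.
      by rewrite !block_diagE; case: fintype.split => a; case: fintype.split => b; rewrite ?h ?mxE ?mulr0.
    * by rewrite (grad_form_product_r mG1 mV)//; have [] := H _ Vz.2.
Qed.

End LocallyFlatProduct.

Section WeylKulkarni.
Context {R : realType} {n : nat}.
Variables (G : 'rV[R]_n -> 'M[R]_n) (y : 'rV[R]_n) (A : 'M[R]_n).
Hypotheses (uG : G y \in unitmx) (sG : (G y)^T = G y) (sA : A^T = A).
Hypotheses (n1 : n%:R - 1 != 0 :> R) (n2 : n%:R - 2 != 0 :> R).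
Hypothesis RA : forall i j k l, riemann G y i j k l =
  G y i k * A j l + G y j l * A i k - G y i l * A j k - G y j k * A i l.

Let P := invmx (G y).
Let tr := \sum_p \sum_q P p q * A p q.

Lemma metric_trace : \sum_p \sum_q P p q * G y p q = n%:R.
Proof.
rewrite -[n in RHS]card_ord -sum1_card natr_sum; apply: eq_bigr => p _.
have /matrixP/(_ p p) := mulVmx uG; rewrite !mxE eqxx => <-.
by apply: eq_bigr => q _; congr (_ * _); rewrite -{1}sG mxE.
Qed.

Lemma contract_right (b : 'I_n -> R) i : \sum_p \sum_q P p q * (G y i q * b p) = b i.
Proof.
rewrite -(pairing_metric b i uG sG) /pairing exchange_big/=; apply: eq_bigr => p _.
apply: eq_bigr => q _; rewrite mulrA; congr (_ * _ * _).
by rewrite /P -{1}(invmx_sym sG) mxE.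
Qed.

Lemma kulkarni_ricci i j : ricci G y i j = tr * G y i j + (n%:R - 2) * A i j.
Proof.
have SA a b : A a b = A b a by rewrite -{1}sA mxE.
have SG a b : G y a b = G y b a by rewrite -{1}sG mxE.
rewrite mxE (eq_bigr (fun p => \sum_q (P p q * A p q) * G y i j + \sum_q (P p q * G y p q) * A i j
    - (\sum_q P p q * (G y i q * A p j)) - \sum_q P p q * (G y j p * A i q))) => [|p _]; last first.
  rewrite -big_split/= -!sumrB; apply: eq_bigr => q _; rewrite RA (SG p j) -/P.
  move: (P p q) (G y i j) (A p q) (G y p q) (A i j) (G y i q) (A p j) (G y j p) (A i q) => *; ring.
rewrite !sumrB big_split/=.
have -> : \sum_p \sum_q P p q * A p q * G y i j = tr * G y i j.
  by rewrite mulr_suml; apply: eq_bigr => p _; rewrite mulr_suml.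
have -> : \sum_p \sum_q P p q * G y p q * A i j = n%:R * A i j.
  by rewrite -metric_trace mulr_suml; apply: eq_bigr => p _; rewrite mulr_suml.
rewrite contract_right (eq_bigr (fun p => \sum_q P p q * G y j p * A i q)) => [|p _]; last first.
  by apply: eq_bigr => q _; rewrite mulrA.
have := pairing_metric (fun q => A i q) j uG sG; rewrite /pairing => ->.
move: (tr) (G y i j) (A i j) n%:R => *; ring.
Qed.

Lemma kulkarni_scalar : scalar_curvature G y = (2 * n%:R - 2) * tr.
Proof.
rewrite /scalar_curvature (eq_bigr (fun p => \sum_q (tr * (P p q * G y p q) + (n%:R - 2) * (P p q * A p q)))) => [|p _]; last first.
  apply: eq_bigr => q _; rewrite kulkarni_ricci -/P.
  move: (tr) (G y p q) (A p q) (P p q) n%:R => *; ring.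
rewrite (eq_bigr (fun p => tr * (\sum_q P p q * G y p q) + (n%:R - 2) * \sum_q P p q * A p q)) => [|p _]; last first.
  by rewrite big_split/= -!mulr_sumr.
rewrite big_split/= -!mulr_sumr metric_trace -/tr; move: (tr) n%:R => *; ring.
Qed.

(** The Ricci tensor computed above identifies [A] as the Schouten tensor, and the Weyl tensor
    subtracts exactly its product with the metric. *)
Lemma weyl_kulkarni i j k l : weyl G y i j k l = 0.
Proof.
rewrite /weyl RA kulkarni_scalar !kulkarni_ricci; move: n1 n2.
move: (tr) n%:R (G y i k) (A j l) (G y j l) (A i k) (G y i l) (A j k) (G y j k) (A i l) => t m *; by field; apply/andP.
Qed.

End WeylKulkarni.

Section LocallyConformallyFlat.
Context {R : realType}.
Variables (U : set 'rV[R]_4) (G : 'rV[R]_4 -> 'M[R]_4) (mG : smooth_metric U G).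
Variables (u : 'rV[R]_4 -> R) (su : smooth_on U u) (u0 : forall y, U y -> u y != 0).

Lemma conformal_term_sym y : U y -> (conformal_term G u y)^T = conformal_term G u y.
Proof.
move=> Uy; rewrite /conformal_term !linearD/= !linearN/= !linearZ/= (smet_sym mG Uy) (hessian_sym mG su Uy).
congr (_ + _ *: _ + _); apply/matrixP => i j; rewrite !mxE; exact: mulrC.
Qed.

Lemma weyl_locally_flat y : U y ->
  (forall i j k l, riemann (fun z => u z *: G z) y i j k l = 0) ->
  forall i j k l, weyl G y i j k l = 0.
Proof.
move=> Uy flat; have r0 := u0 Uy.
apply: (@weyl_kulkarni _ _ G y (- (u y)^-1 *: conformal_term G u y)).
- exact: (smet_unit mG Uy).
- exact: (smet_sym mG Uy).
- by rewrite linearZ/= conformal_term_sym.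
- by have -> : 4%:R - 1 = 3 :> R by ring.
- by have -> : 4%:R - 2 = 2 :> R by ring.
- have alg (s g1 g2 g3 g4 a1 a2 a3 a4 x : R) : s != 0 ->
      s * x + (g1 * a1 + g2 * a2 - g3 * a3 - g4 * a4) = 0 ->
      x = g1 * (- s^-1 * a1) + g2 * (- s^-1 * a2) - g3 * (- s^-1 * a3) - g4 * (- s^-1 * a4).
    move=> s0 h; apply: (mulfI s0).
    have -> : s * (g1 * (- s^-1 * a1) + g2 * (- s^-1 * a2) - g3 * (- s^-1 * a3) - g4 * (- s^-1 * a4)) =
      - (g1 * a1 + g2 * a2 - g3 * a3 - g4 * a4) by field.
    by apply/eqP; rewrite -subr_eq0 opprK h.
  have scaleE i j : (- (u y)^-1 *: conformal_term G u y) i j = - (u y)^-1 * conformal_term G u y i j.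
    by rewrite mxE.
  move=> i j k l; have := flat i j k l; rewrite (riemann_conformal mG su u0 _ _ _ _ Uy) !scaleE.
  exact: alg.
Qed.

End LocallyConformallyFlat.

(** * Independence of the chart *)

Section IteratedGradForm.
Context {R : realType} {n : nat}.
Variables (U : set 'rV[R]_n) (G : 'rV[R]_n -> 'M[R]_n) (mG : smooth_metric U G).
Variables (f h m : 'rV[R]_n -> R).
Hypotheses (sf : smooth_on U f) (sm : smooth_on U m).

Lemma grad_form_grad_form y : U y ->
  grad_form G h (grad_form G f m) y =
  pairing (hessian G y f) (gradient G y h 0) (gradient G y m 0)
  + pairing (hessian G y m) (gradient G y h 0) (gradient G y f 0).
Proof.
move=> Uy; rewrite (grad_formC mG _ _ Uy) grad_form_gradient /pairing -big_split/=.
apply: eq_bigr => k _; rewrite (partial_grad_form mG sf sm _ Uy) mulrDl !mulr_suml; congr (_ + _);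
  by apply: eq_bigr => q _; rewrite mulrAC.
Qed.

End IteratedGradForm.

Section KoszulFormula.
Context {R : realType} {n : nat}.
Variables (U : set 'rV[R]_n) (G : 'rV[R]_n -> 'M[R]_n) (mG : smooth_metric U G).
Variables (f h m : 'rV[R]_n -> R).
Hypotheses (sf : smooth_on U f) (sh : smooth_on U h) (sm : smooth_on U m).

(* This expresses the Hessian through iterated inner products of gradients, so
   that its tensoriality reduces to that of the inner product and no
   transformation law of the Christoffel symbols is needed. *)
Lemma koszul y : U y ->
  2 * pairing (hessian G y f) (gradient G y h 0) (gradient G y m 0) =
  grad_form G h (grad_form G f m) y + grad_form G m (grad_form G f h) y
  - grad_form G f (grad_form G h m) y.
Proof.
move=> Uy; have g1 := grad_form_grad_form mG h sf sm Uy.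
have g2 := grad_form_grad_form mG m sf sh Uy; have g3 := grad_form_grad_form mG f sh sm Uy.
have c1 := pairingC (gradient G y m 0) (gradient G y h 0) (hessian_sym mG sf Uy).
have c2 := pairingC (gradient G y m 0) (gradient G y f 0) (hessian_sym mG sh Uy).
have c3 := pairingC (gradient G y f 0) (gradient G y h 0) (hessian_sym mG sm Uy).
have alg (a a' b b' c c' x1 x2 x3 : R) : a' = a -> b = b' -> c = c' -> x1 = a + c' -> x2 = a' + b ->
    x3 = b' + c -> 2 * a = x1 + x2 - x3.
  by move=> -> -> -> -> -> ->; ring.
exact: alg c1 c2 c3 g1 g2 g3.
Qed.

End KoszulFormula.

Lemma congruence_eq (R : realType) n (V V' H H' : 'M[R]_n) :
  (forall k l, pairing H (V k) (V l) = pairing H' (V' k) (V' l)) ->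
  V *m H *m V^T = V' *m H' *m V'^T.
Proof.
have entry (A B : 'M[R]_n) k l : (A *m B *m A^T) k l = pairing B (A k) (A l).
  rewrite mxE /pairing exchange_big/=; apply: eq_bigr => q _; rewrite mxE [A^T _ _]mxE mulr_suml.
  by apply: eq_bigr => p _; rewrite [A k p * _]mulrC.
by move=> H1; apply/matrixP => k l; rewrite !entry.
Qed.

Lemma congruence_cancel (R : comUnitRingType) n (V J A B : 'M[R]_n) : V \in unitmx ->
  V *m A *m V^T = (V *m J) *m B *m (V *m J)^T -> A = J *m B *m J^T.
Proof.
move=> uV; have uVT : V^T \in unitmx by rewrite unitmx_tr.
rewrite trmx_mul => E; apply: (can_inj (mulKmx uV)); apply: (can_inj (mulmxK uVT)).
by rewrite E !mulmxA.
Qed.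

Section ChangeOfCoordinates.
Context {R : realType}.

Lemma is_derive_coordinate i k z :
  is_derive z 'e_i (fun z : 'rV[R]_2 => z 0 k : R) ((i == k)%:R : R).
Proof.
apply: (@is_derive_of_line _ 2 _ z 'e_i (fun s => z 0 k + s * (i == k)%:R) 0).
  by move=> s; rewrite !mxE add0r eqxx eq_sym.
apply: is_derive_of_bound => e e0; apply: (@filterS _ _ (nbhs_filter (0 : R)) _ _ _ (@filterT _ _ (nbhs_filter (0 : R)))) => s _.
have cancel (a b c : R) : a + (0 + b) * c - (a + 0 * c) - b * c = 0 by ring.
by rewrite cancel normr0 mulr_ge0// ltW.
Qed.

Lemma partial_coordinate i k z : partial i (fun z : 'rV[R]_2 => z 0 k) z = (i == k)%:R.
Proof. by have [_] := is_derive_coordinate i k z. Qed.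

Lemma smooth_coordinate (V : set 'rV[R]_2) k : smooth_on V (fun z => z 0 k).
Proof.
apply: smooth_intro => [z _|z i _|i].
- exact: coord_continuous.
- by have [] := is_derive_coordinate i k z.
- have -> : partial i (fun z : 'rV[R]_2 => z 0 k) = fun=> (i == k)%:R.
    by apply/funext => z; exact: partial_coordinate.
  exact: smooth_cst.
Qed.

Variables (U : set 'rV[R]_2) (Ga : 'rV[R]_2 -> 'M[R]_2) (mGa : smooth_metric U Ga).
Variables (W : set 'rV[R]_2) (Gb : 'rV[R]_2 -> 'M[R]_2) (mGb : smooth_metric W Gb).
Variables (t : 'rV[R]_2 -> 'rV[R]_2).
Hypotheses (st : forall k, smooth_on U (fun z => t z 0 k)) (tW : forall z, U z -> W (t z)).
Hypothesis compat : forall z, U z -> Ga z = 'J t z *m Gb (t z) *m ('J t z)^T.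
Let oU := smet_open mGa.
Let oW := smet_open mGb.

Lemma jacobian_unit z : U z -> 'J t z \in unitmx.
Proof.
by move=> Uz; have := smet_unit mGa Uz; rewrite compat// !unitmx_mul => /andP[/andP[]].
Qed.

Lemma gradient_comp (F : 'rV[R]_2 -> R) z : smooth_on W F -> U z ->
  gradient Gb (t z) F = gradient Ga z (fun w => F (t w)) *m 'J t z.
Proof.
move=> sF Uz; have Wz := tW Uz; have uJ := jacobian_unit Uz.
pose db : 'cV[R]_2 := \col_k partial k F (t z).
pose da : 'cV[R]_2 := \col_k partial k (fun w => F (t w)) z.
have dE : da = 'J t z *m db.
  apply/colP => i; rewrite [LHS]mxE [RHS]mxE (partial_comp oU Uz st _ oW sF Wz).
  by apply: eq_bigr => k _; congr (_ * _); rewrite mxE.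
have gE (G : 'rV[R]_2 -> 'M[R]_2) (H : 'rV[R]_2 -> R) w :
    gradient G w H = (invmx (G w) *m \col_k partial k H w)^T.
  by apply/rowP => i; rewrite !mxE; apply: eq_bigr => k _; rewrite mxE.
rewrite !gE -/da -/db dE; apply: trmx_inj; rewrite trmxK trmx_mul trmxK.
apply: (can_inj (mulKmx (smet_unit mGb Wz))); rewrite mulKVmx ?(smet_unit mGb Wz)//.
apply: (can_inj (mulKmx uJ)); rewrite !mulmxA -compat//.
by rewrite mulmxV ?(smet_unit mGa Uz)// mul1mx.
Qed.

Lemma grad_form_comp (F H : 'rV[R]_2 -> R) z : smooth_on W F -> smooth_on W H -> U z ->
  grad_form Ga (fun w => F (t w)) (fun w => H (t w)) z = grad_form Gb F H (t z).
Proof.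
move=> sF sH Uz; rewrite !grad_form_gradient (gradient_comp sH Uz).
rewrite (eq_bigr (fun i => \sum_k 'J t z i k * partial k F (t z) * gradient Ga z (fun w => H (t w)) 0 i)) => [|i _]; last first.
  by rewrite (partial_comp oU Uz st _ oW sF (tW Uz)) mulr_suml.
rewrite exchange_big/=; apply: eq_bigr => k _; rewrite [X in _ = _ * X]mxE mulr_sumr.
have alg (a b c : R) : a * b * c = b * (c * a) by ring.
by apply: eq_bigr => i _; exact: alg.
Qed.

(** By the chain rule, derivatives of compositions are combinations of smooth functions and
    compositions, so [generated_smooth] yields all orders at once. *)
Lemma smooth_comp (F : 'rV[R]_2 -> R) : smooth_on W F -> smooth_on U (fun w => F (t w)).
Proof.
move=> sF; pose B (g : 'rV[R]_2 -> R) := smooth_on U g \/ exists2 H, smooth_on W H & g = fun w => H (t w).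
apply: (generated_smooth oU (B := B)); last by apply: generated_base; right; exists F.
move=> g [sg|[H sH ->]].
  split=> [z Uz|z i Uz|i]; [exact: smooth_continuous sg Uz|exact: smooth_derivable sg Uz|].
  by exists (partial i g) => //; apply: generated_base; left; exact: smooth_partial.
split=> [z Uz|z i Uz|i].
- have dt := smooth_map_differentiable oU Uz st.
  apply: (@continuous_comp _ _ _ t H); first exact: differentiable_continuous.
  exact: smooth_continuous sH (tW Uz).
- have dt := smooth_map_differentiable oU Uz st.
  have dH : differentiable H (t z) by case: (smooth_is_diff oW sH (tW Uz)).
  apply: diff_derivable; exact: differentiable_comp.
- exists (fun z => \sum_k partial i (fun w => t w 0 k) z * partial k H (t z)); last first.
    move=> z Uz; rewrite (partial_comp oU Uz st _ oW sH (tW Uz)) (jacobianE oU Uz st).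
    by apply: eq_bigr => k _; rewrite mxE.
  apply: generated_sum => k; apply: generated_mul; apply: generated_base.
    by left; exact: smooth_partial.
  by right; exists (partial k H) => //; exact: smooth_partial.
Qed.

Lemma grad_form_near (G : 'rV[R]_2 -> 'M[R]_2) (F H H' : 'rV[R]_2 -> R) z :
  (\forall w \near z, H w = H' w) -> grad_form G F H z = grad_form G F H' z.
Proof.
move=> HH; rewrite !grad_form_gradient; apply: eq_bigr => k _; rewrite !gradientE.
by congr (_ * _); apply: eq_bigr => l _; rewrite (partial_eq_near l HH).
Qed.

(** The Hessian is tested on the gradients of the target coordinates. By [koszul] each value
    consists of iterated inner products of gradients, unaffected by the change of coordinates. *)
Lemma hessian_comp (F : 'rV[R]_2 -> R) z : smooth_on W F -> U z ->
  hessian Ga z (fun w => F (t w)) = 'J t z *m hessian Gb (t z) F *m ('J t z)^T.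
Proof.
move=> sF Uz; have Wz := tW Uz; have uJ := jacobian_unit Uz.
pose x k (w : 'rV[R]_2) := w 0 k; have sx k : smooth_on W (x k) by exact: smooth_coordinate.
pose xt k (w : 'rV[R]_2) := t w 0 k.
pose Va : 'M[R]_2 := \matrix_(k, i) gradient Ga z (xt k) 0 i.
pose Vb : 'M[R]_2 := \matrix_(k, i) gradient Gb (t z) (x k) 0 i.
have VJ : Va *m 'J t z = Vb.
  apply/row_matrixP => k; rewrite row_mul.
  have rowE' (A : 'I_2 -> 'rV[R]_2) i : row i (\matrix_(k, l) A k 0 l) = A i.
    by apply/rowP => l; rewrite !mxE.
  by rewrite /Va /Vb !rowE' (gradient_comp (sx k) Uz).
(* The gradients of the coordinates are the rows of the inverse metric, hence a basis. *)
have VbE : Vb = (invmx (Gb (t z)))^T.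
  apply/matrixP => k i; rewrite /Vb mxE gradientE [RHS]mxE (bigD1 k)//= big1 => [|l lk].
    by rewrite partial_coordinate eqxx mulr1 addr0.
  by rewrite partial_coordinate (negbTE lk) mulr0.
have uVb : Vb \in unitmx by rewrite VbE unitmx_tr unitmx_inv (smet_unit mGb).
have uVa : Va \in unitmx by move: uVb; rewrite -VJ unitmx_mul => /andP[].
(* Invariance is used twice: near [z] for the inner product as a function, then at [z] for its
   gradient. *)
have inv (A B C : 'rV[R]_2 -> R) : smooth_on W A -> smooth_on W B -> smooth_on W C ->
    grad_form Ga (fun w => A (t w)) (grad_form Ga (fun w => B (t w)) (fun w => C (t w))) z =
    grad_form Gb A (grad_form Gb B C) (t z).
  move=> sA sB sC; rewrite -(grad_form_comp sA (smooth_grad_form mGb sB sC) Uz).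
  by apply/grad_form_near/(open_near oU Uz) => w Uw; exact: grad_form_comp.
have two : 2 != 0 :> R by [].
have VaE k : gradient Ga z (xt k) 0 = Va k by apply/funext => i; rewrite [RHS]mxE.
have VbE' k : gradient Gb (t z) (x k) 0 = Vb k by apply/funext => i; rewrite [RHS]mxE.
have E k l : pairing (hessian Ga z (fun w => F (t w))) (Va k) (Va l) =
    pairing (hessian Gb (t z) F) (Vb k) (Vb l).
  have k1 := koszul mGa (smooth_comp sF) (st k) (st l) Uz.
  have k2 := koszul mGb sF (sx k) (sx l) Wz.
  have e1 := inv _ _ _ (sx k) sF (sx l); have e2 := inv _ _ _ (sx l) sF (sx k).
  have e3 := inv _ _ _ sF (sx k) (sx l).
  have alg (p p' a b c a' b' c' : R) : 2 * p = a + b - c -> 2 * p' = a' + b' - c' ->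
      a = a' -> b = b' -> c = c' -> p = p'.
    by move=> h1 h2 aE bE cE; apply: (mulfI two); rewrite h1 h2 aE bE cE.
  rewrite -!VaE -!VbE'; exact: alg k1 k2 e1 e2 e3.
apply: (congruence_cancel uVa); rewrite VJ; exact: congruence_eq.
Qed.

Definition hessian_det (G : 'rV[R]_2 -> 'M[R]_2) (F : 'rV[R]_2 -> R) z : R :=
  \det (hessian G z F) / \det (G z).

Lemma hessian_det_comp (F : 'rV[R]_2 -> R) z : smooth_on W F -> U z ->
  hessian_det Ga (fun w => F (t w)) z = hessian_det Gb F (t z).
Proof.
move=> sF Uz; rewrite /hessian_det hessian_comp// compat// !det_mulmx det_tr.
have : \det ('J t z) != 0 by have := jacobian_unit Uz; rewrite unitmxE unitfE.
have : \det (Gb (t z)) != 0 by have := smet_unit mGb (tW Uz); rewrite unitmxE unitfE.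
move: (\det ('J t z)) (\det (Gb (t z))) (\det (hessian Gb (t z) F)) => a b d b0 a0.
by field; apply/andP.
Qed.

End ChangeOfCoordinates.

Section Charts.
Context {R : realType} {M : topologicalType} {n : nat}.
Variables (A : @atlas R M n) (mfd : connected_manifold A).
Implicit Types (a b : aidx A) (p : M).

Lemma cimg_cmap a p : cdom (A a) p -> cimg (A a) (cmap (A a) p).
Proof. by move=> ap; exists p. Qed.

Lemma cinvP a y : cimg (A a) y -> cdom (A a) (cinv (A a) y) /\ cmap (A a) (cinv (A a) y) = y.
Proof.
have [_ _ cK _ _] := mfd_charts mfd a.
by move=> [p ap <-]; rewrite cK.
Qed.

Lemma cmapK a p : cdom (A a) p -> cinv (A a) (cmap (A a) p) = p.
Proof. by have [_ _ cK _ _] := mfd_charts mfd a; exact: cK. Qed.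

Lemma open_cimg a : open (cimg (A a)).
Proof. by have [] := mfd_charts mfd a. Qed.

Lemma open_overlap a b : open (overlap (A a) (A b)).
Proof.
have [_ oI _ _ cc] := mfd_charts mfd a; have [ob _ _ _ _] := mfd_charts mfd b.
rewrite openE => y [ay yb]; apply: filterI; first exact: open_nbhs_nbhs.
exact: (cc y ay _ (open_nbhs_nbhs (conj ob yb))).
Qed.

Lemma overlap_cmap a b p : cdom (A a) p -> cdom (A b) p -> overlap (A a) (A b) (cmap (A a) p).
Proof. by move=> ap bp; split; [exact: cimg_cmap|rewrite /= cmapK]. Qed.

Lemma transition_cimg a b y : overlap (A a) (A b) y -> cimg (A b) (transition (A a) (A b) y).
Proof. by move=> [_ yb]; exact: cimg_cmap. Qed.

Lemma cinv_transition a b y : overlap (A a) (A b) y ->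
  cinv (A b) (transition (A a) (A b) y) = cinv (A a) y.
Proof. by move=> [_ yb]; rewrite /transition/= cmapK. Qed.

Lemma smooth_fun_local (w : M -> R) (W : aidx A -> 'rV[R]_n -> R) :
  (forall a, smooth_on (cimg (A a)) (W a)) ->
  (forall a p, cdom (A a) p -> w p = W a (cmap (A a) p)) -> smooth_fun A w.
Proof.
move=> sW wW a; apply: smooth_eq (sW a); first exact: open_cimg.
by move=> y ay; have [d e] := cinvP ay; rewrite /= (wW a)// e.
Qed.

Variables (g : metric A) (riem : riemannian g).

Lemma metric_posdef a y : cimg (A a) y -> posdef (g a y).
Proof. by move=> ay v v0; exact: (metric_pos riem ay v0). Qed.

Lemma posdef_unit (G : 'M[R]_n) : posdef G -> G \in unitmx.
Proof.
move=> pG; rewrite unitmxE unitfE; apply/det0P => -[v v0 vG].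
by have := pG v v0; rewrite vG mul0mx mxE ltxx.
Qed.

Lemma chart_smooth_metric a : smooth_metric (cimg (A a)) (g a).
Proof.
split; first exact: open_cimg.
- exact: metric_smooth riem a.
- by move=> y ay; exact: (Defs.metric_sym riem ay).
- by move=> y ay; exact/posdef_unit/metric_posdef.
Qed.

End Charts.

Section Locality.
Context {R : realType} {n : nat}.
Variables (V : set 'rV[R]_n) (oV : open V) (G : 'rV[R]_n -> 'M[R]_n).
Variables (F F' : 'rV[R]_n -> R) (FF : forall z, V z -> F z = F' z).

Lemma partial_local i z : V z -> partial i F z = partial i F' z.
Proof. by move=> Vz; apply/partial_eq_near/(open_near oV Vz). Qed.

Lemma hessian_local z : V z -> hessian G z F = hessian G z F'.
Proof.
move=> Vz; apply/matrixP => i j; rewrite [LHS]mxE [RHS]mxE; apply: (congr2 (fun a b => a - b)).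
  by apply: partial_eq_near; apply: (open_near oV Vz) => w Vw; exact: partial_local.
by apply: eq_bigr => k _; rewrite partial_local.
Qed.

Lemma grad_form_local z : V z -> grad_form G F F z = grad_form G F' F' z.
Proof.
by move=> Vz; have -> : grad_form G F F z = pairing (invmx (G z)) (partial ^~ F' ^~ z) (partial ^~ F' ^~ z)
  by rewrite /grad_form; have -> : partial ^~ F ^~ z = partial ^~ F' ^~ z
    by apply/funext => i; exact: partial_local.
Qed.

Lemma inner_gradient z : G z \in unitmx -> (G z)^T = G z ->
  inner G z (gradient G z F) (gradient G z F) = grad_form G F F z.
Proof.
move=> uG sG; pose d : 'cV[R]_n := \col_l partial l F z.
have vE : gradient G z F = (invmx (G z) *m d)^T.
  by apply/rowP => i; rewrite !mxE; apply: eq_bigr => l _; rewrite mxE.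
rewrite /inner {2}vE trmxK mulmxA mulmxK// mxE grad_form_gradient; apply: eq_bigr => k _.
by rewrite mulrC [d _ _]mxE.
Qed.

End Locality.

Section ChartInvariance.
Context {R : realType} {M : topologicalType}.
Variables (A : @atlas R M 2) (mfd : connected_manifold A) (g : metric A) (riem : riemannian g).
Variables (f : M -> R) (sf : smooth_fun A f).
Implicit Types (a b : aidx A) (p : M).

Definition chart_at p : aidx A := projT1 (cid (mfd_cover mfd p)).

Lemma chart_atP p : cdom (A (chart_at p)) p.
Proof. exact: projT2 (cid (mfd_cover mfd p)). Qed.

Let local_grad a := grad_form (g a) (f \o cinv (A a)) (f \o cinv (A a)).
Let local_det a := hessian_det (g a) (f \o cinv (A a)).

Lemma chart_change a b p : cdom (A a) p -> cdom (A b) p ->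
  local_grad a (cmap (A a) p) = local_grad b (cmap (A b) p) /\
  local_det a (cmap (A a) p) = local_det b (cmap (A b) p).
Proof.
move=> ap bp; have oO : open (overlap (A a) (A b)) by exact: open_overlap.
 have Op := overlap_cmap mfd ap bp.
pose t := transition (A a) (A b).
have tp : t (cmap (A a) p) = cmap (A b) p by rewrite /t /transition /= (cmapK mfd).
have mO : smooth_metric (overlap (A a) (A b)) (g a).
  by apply: smooth_metric_sub (chart_smooth_metric mfd riem a) => // y [].
have mb := chart_smooth_metric mfd riem b.
have compat z (Oz : overlap (A a) (A b) z) := metric_compat riem Oz.
have tW z (Oz : overlap (A a) (A b) z) := transition_cimg Oz.
have st := mfd_smooth mfd a b.
have ft z : overlap (A a) (A b) z -> (f \o cinv (A a)) z = (f \o cinv (A b)) (t z).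
  by move=> Oz; rewrite /= (cinv_transition mfd Oz).
split.
- rewrite /local_grad (grad_form_local oO _ ft Op).
  by rewrite (grad_form_comp mO mb st tW compat (sf b) (sf b) Op) -/t tp.
- rewrite /local_det -tp -(hessian_det_comp mO mb st tW compat (sf b) Op).
  by rewrite /hessian_det (hessian_local oO _ ft Op).
Qed.

(** Read in a chart chosen at each point; since all charts give the same value, the arbitrary choice
    does not spoil smoothness. *)
Definition grad_norm p : R := local_grad (chart_at p) (cmap (A (chart_at p)) p).
Definition hess_det p : R := local_det (chart_at p) (cmap (A (chart_at p)) p).

Lemma grad_normE a p : cdom (A a) p ->
  grad_norm p = grad_form (g a) (f \o cinv (A a)) (f \o cinv (A a)) (cmap (A a) p).
Proof. by move=> ap; have [] := chart_change (chart_atP p) ap. Qed.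

Lemma hess_detE a p : cdom (A a) p ->
  hess_det p = hessian_det (g a) (f \o cinv (A a)) (cmap (A a) p).
Proof. by move=> ap; have [] := chart_change (chart_atP p) ap. Qed.

Lemma grad_sqE a p : cdom (A a) p ->
  grad_sq g f a p = grad_form (g a) (f \o cinv (A a)) (f \o cinv (A a)) (cmap (A a) p).
Proof.
move=> ap; have mG := chart_smooth_metric mfd riem a; have ip := cimg_cmap ap.
by rewrite /grad_sq inner_gradient ?(smet_unit mG) ?(smet_sym mG).
Qed.

Lemma smooth_grad_norm : smooth_fun A grad_norm.
Proof.
apply: (smooth_fun_local mfd (W := local_grad)); last exact: grad_normE.
by move=> a; apply: smooth_grad_form (sf a) (sf a); exact: chart_smooth_metric.
Qed.

Lemma smooth_hess_det : smooth_fun A hess_det.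
Proof.
apply: (smooth_fun_local mfd (W := local_det)); last exact: hess_detE.
move=> a; have mG := chart_smooth_metric mfd riem a.
have dG : smooth_on (cimg (A a)) (fun z => (\det (g a z))^-1).
  apply: smoothV; [exact: (open_cimg mfd)|apply: smooth_det; [exact: (open_cimg mfd)|exact: smet_smooth mG]|].
  by move=> y ay; have := smet_unit mG ay; rewrite unitmxE unitfE.
apply: smoothM => //; first exact: (open_cimg mfd).
apply: smooth_det; first exact: (open_cimg mfd).
move=> i j; exact: smooth_hessian mG _ (sf a) i j.
Qed.

End ChartInvariance.

(** * The warped product *)

Section WarpedProduct.
Context {R : realType} {Sigma Pi : topologicalType}.
Variables (AS : @atlas R Sigma 2) (AP : @atlas R Pi 2) (g : metric AS) (h : metric AP).
Variables (phi K : Sigma -> R) (c : R).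
Hypotheses (mfdS : connected_manifold AS) (mfdP : connected_manifold AP).
Hypotheses (riemg : riemannian g) (riemh : riemannian h).
Hypotheses (curvg : gaussian_curvature g K) (curvh : gaussian_curvature h (fun=> c)).
Hypotheses (phi_smooth : smooth_fun AS phi) (phi_neq0 : forall p, phi p != 0).

Let gbar : metric (prod_atlas AS AP) :=
  rescale (fun z => (phi z.1 ^+ 2)^-1) (prod_metric g h).
Let f a := phi \o cinv (AS a).

Lemma gbarE a b : gbar (a, b) = warped_metric (g a) (h b) (f a).
Proof. by []. Qed.

Let mS a : smooth_metric (cimg (AS a)) (g a) := chart_smooth_metric mfdS riemg a.
Let mP b : smooth_metric (cimg (AP b)) (h b) := chart_smooth_metric mfdP riemh b.
Let f0 a z : cimg (AS a) z -> f a z != 0. Proof. by move=> _; exact: phi_neq0. Qed.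

Lemma product_chart_point a b p q : cdom (AS a) p -> cdom (AP b) q ->
  product_set (cimg (AS a)) (cimg (AP b)) (row_mx (cmap (AS a) p) (cmap (AP b) q)).
Proof. by move=> ap bq; split; rewrite ?row_mxKl ?row_mxKr; exact: cimg_cmap. Qed.

Lemma cimg_prod_chart a b : cimg (prod_chart (AS a) (AP b)) = product_set (cimg (AS a)) (cimg (AP b)).
Proof.
apply/seteqP; split=> [_ [[p q] [/= ap bq] <-]|y [[p ap py] [q bq qy]]].
  exact: product_chart_point.
by exists (p, q); rewrite //= py qy hsubmxK.
Qed.

Lemma smooth_gbar a b : smooth_metric (product_set (cimg (AS a)) (cimg (AP b))) (gbar (a, b)).
Proof.
have mG := smooth_product_metric (mS a) (mP b).
have sF : smooth_on (product_set (cimg (AS a)) (cimg (AP b))) (fun z => f a (lsubmx z)).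
  by apply: smooth_sub (smooth_lsubmx (phi_smooth a)) => z [].
have F0 z : product_set (cimg (AS a)) (cimg (AP b)) z -> f a (lsubmx z) != 0 by case=> /f0.
have v0 z : product_set (cimg (AS a)) (cimg (AP b)) z -> (f a (lsubmx z) ^+ 2)^-1 != 0.
  by move=> /F0 z0; rewrite invr_neq0// expf_neq0.
exact: (smooth_metric_scale mG (smooth_inv_sqr mG sF F0) v0).
Qed.

Section AtPoint.
Variables (a : aidx AS) (b : aidx AP) (p : Sigma) (q : Pi).
Hypotheses (ap : cdom (AS a) p) (bq : cdom (AP b) q).
Let y : 'rV[R]_4 := cmap (prod_atlas AS AP (a, b)) (p, q).
Let Q := grad_sq g phi a p.

(** [p0] and [p1] are the eigenvalues of the Hessian of [phi] relative to [g]; nothing is claimed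
    about how they vary with the point. *)
Lemma frame_at : exists (E B : 'M[R]_4) (p0 p1 : R),
  [/\ E *m B = 1%:M, gbar (a, b) y = B *m B^T,
    forall i j k l, riemann (gbar (a, b)) y i j k l =
      pure_tensor B (product_kappa (phi p ^+ 2 * K p) (phi p ^+ 2 * c)
        (phi p * p0) (phi p * p1) Q) i j k l,
    laplacian (g a) (cmap (AS a) p) (f a) = p0 + p1 /\ hessian_det (g a) (f a) (cmap (AS a) p) = p0 * p1 &
    hessian_pure g phi a p <-> p0 = p1].
Proof.
have yl : lsubmx (y : 'rV_(2 + 2)) = cmap (AS a) p by exact: row_mxKl.
have yr : rsubmx (y : 'rV_(2 + 2)) = cmap (AP b) q by exact: row_mxKr.
have py : posdef (g a (lsubmx (y : 'rV_(2 + 2)))) by rewrite yl; apply: (metric_posdef riemg); exact: cimg_cmap.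
have qy : posdef (h b (rsubmx (y : 'rV_(2 + 2)))) by rewrite yr; apply: (metric_posdef riemh); exact: cimg_cmap.
have [E [B [p0 [p1 [EB GB RB LD HP]]]]] := warped_frame (mS a) (mP b) (phi_smooth a) (@f0 a)
  (product_chart_point ap bq) py qy.
exists E, B, p0, p1; split=> //.
- move=> i j k l; rewrite gbarE RB yl yr -(curvg ap) -(curvh bq) /f /= (cmapK mfdS ap).
  by rewrite /Q (grad_sqE mfdS riemg).
- by move: LD; rewrite /hessian_det yl.
- by move: HP; rewrite yl.
Qed.

Lemma case_i_weights p0 p1 : case_i g phi K c ->
  laplacian (g a) (cmap (AS a) p) (f a) = p0 + p1 ->
  phi p * p0 + phi p * p1 = 2 * Q /\ 2 * Q = phi p ^+ 2 * c - phi p ^+ 2 * K p.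
Proof.
move=> H L; have [L0 QE] := H a p ap.
have L1 : laplacian (g a) (cmap (AS a) p) (fun z => (f a z)^-1) = 0 by exact: L0.
move: L1; rewrite (laplacian_inv (mS a) (phi_smooth a) (@f0 a) (cimg_cmap ap)) L.
rewrite -(grad_sqE mfdS riemg phi ap) /f /= (cmapK mfdS ap) -/Q.
have := phi_neq0 p; move: QE; rewrite -/Q; move: (phi p) Q (K p) => r s k QE r0 E.
(* The formula for the Laplacian of [1 / phi], multiplied by [- phi^3]. *)
have E2 : r * (p0 + p1) - 2 * s = - r ^+ 3 * (- r ^- 2 * (p0 + p1) + 2 * r ^- 3 * s) by field.
rewrite E mulr0 in E2; split; last by rewrite QE; ring.
by rewrite -mulrDr; apply/eqP; rewrite -subr_eq0 E2.
Qed.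

Lemma case_ii_weights p0 p1 : case_ii g phi K c ->
  laplacian (g a) (cmap (AS a) p) (f a) = p0 + p1 -> (hessian_pure g phi a p <-> p0 = p1) ->
  phi p * p0 = phi p * p1 /\ phi p ^+ 2 * K p + phi p ^+ 2 * c + phi p * p0 + phi p * p1 = 2 * Q.
Proof.
move=> H L HP; have [/HP pE QE] := H a p ap; rewrite pE; split=> //.
rewrite -QE L pE; move: (phi p) (K p) => r k; ring.
Qed.

Let G := gbar (a, b).
Let sc := scalar_curvature G y.

Lemma einstein_case_i : case_i g phi K c -> einstein_tensor G y = 0 <-> hessian_pure g phi a p.
Proof.
move=> H; have [E [B [p0 [p1 [EB GB RB [L _] HP]]]]] := frame_at.
have [h1 h2] := case_i_weights H L.
rewrite (case_one_einstein EB GB RB h1 h2) HP; split=> [|->//].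
by apply: mulfI.
Qed.

Lemma einstein_case_ii : case_ii g phi K c ->
  einstein_tensor G y = 0 <-> grad_sq g phi a p = c * phi p ^+ 2.
Proof.
move=> H; have [E [B [p0 [p1 [EB GB RB [L _] HP]]]]] := frame_at.
have [h1 h2] := case_ii_weights H L HP.
by rewrite (case_two_einstein EB GB RB h1 h2) [c * _]mulrC.
Qed.

Lemma weyl_vanishes : (forall i j k l, weyl G y i j k l = 0) <-> K p = - c.
Proof.
have [E [B [p0 [p1 [EB GB RB _ _]]]]] := frame_at.
rewrite (weyl_eq0_weight EB GB RB) -mulrDr; split=> [/eqP|->]; last by rewrite addNr mulr0.
by rewrite mulf_eq0 expf_eq0/= (negbTE (phi_neq0 p))/= addr_eq0 => /eqP.
Qed.

Lemma weight_neq0 : ~ (forall i j k l, weyl G y i j k l = 0) ->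
  phi p ^+ 2 * K p + phi p ^+ 2 * c != 0.
Proof.
move=> nW; apply/eqP => e; apply: nW; apply/weyl_vanishes/eqP.
rewrite -addr_eq0; apply/eqP; apply: (mulfI (expf_neq0 2 (phi_neq0 p))).
by rewrite mulrDr e mulr0.
Qed.

Lemma scalar_neq0 : case_i g phi K c \/ case_ii g phi K c ->
  ~ (forall i j k l, weyl G y i j k l = 0) -> sc != 0.
Proof.
move=> cases /weight_neq0 w0; have [E [B [p0 [p1 [EB GB RB [L _] HP]]]]] := frame_at.
case: cases => H.
  have [h1 h2] := case_i_weights H L.
  by rewrite /sc (case_one_scalar EB GB RB h1 h2) mulf_neq0.
have [h1 h2] := case_ii_weights H L HP.
by rewrite /sc (case_two_scalar EB GB RB h1 h2) mulf_neq0// oppr_eq0.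
Qed.

Lemma invariant_case_i o : case_i g phi K c -> einstein_tensor G y <> 0 ->
  exists2 lambda : R, lambda != 0 & homothety_invariant G y o sc [:: - lambda; 0; 0; lambda]
    [:: - sc / 12; - sc / 12; sc / 6] [:: - sc / 12; - sc / 12; sc / 6].
Proof.
move=> H nE; have [E [B [p0 [p1 [EB GB RB [L _] HP]]]]] := frame_at.
have [h1 h2] := case_i_weights H L.
exists (phi p * p1 - phi p * p0); last exact: case_one_homothety EB GB RB h1 h2 o.
apply/eqP => e; apply: nE; apply/(case_one_einstein EB GB RB h1 h2).
by apply/esym/eqP; rewrite -subr_eq0 e.
Qed.

Lemma invariant_case_ii o : case_ii g phi K c -> einstein_tensor G y <> 0 ->
  exists2 lambda : R, lambda != 0 & homothety_invariant G y o sc [:: - lambda; - lambda; lambda; lambda]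
    [:: - sc / 12; sc / 24; sc / 24] [:: - sc / 12; sc / 24; sc / 24].
Proof.
move=> H nE; have [E [B [p0 [p1 [EB GB RB [L _] HP]]]]] := frame_at.
have [h1 h2] := case_ii_weights H L HP.
exists (phi p ^+ 2 * c - Q); last exact: case_two_homothety EB GB RB h1 h2 o.
apply/eqP => e; apply: nE; apply/(case_two_einstein EB GB RB h1 h2).
by apply/esym/eqP; rewrite -subr_eq0 e.
Qed.

(* In case (i) the eigenvalues of the Hessian of [phi] are not functions of [K] and
   [phi], but their product is [det (Hess phi) / det g], which does not depend on
   the chart and is smooth. *)
Lemma einstein_square i j : case_i g phi K c \/ case_ii g phi K c ->
  forall e : R,
  (case_i g phi K c -> e = Q ^+ 2 - phi p ^+ 2 * hessian_det (g a) (f a) (cmap (AS a) p)) ->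
  (~ case_i g phi K c -> e = (phi p ^+ 2 * (K p + c) / 2) ^+ 2) ->
  \sum_k \sum_l \sum_m riemann G y i k l m * riemann_up G y j k l m =
  (2 * (phi p ^+ 2 * c - Q) ^+ 2 + 4 * e) * G y i j.
Proof.
move=> cases e e1 e2; have [E [B [p0 [p1 [EB GB RB [L D] HP]]]]] := frame_at.
(* The two cases may hold together; case (i) then takes precedence, in agreement with the
   assumptions on [e]. *)
have [H|nH] := pselect (case_i g phi K c).
  have [h1 h2] := case_i_weights H L.
  have c1 : (phi p * p0 - Q) ^+ 2 = (phi p * p1 - Q) ^+ 2.
    have -> : phi p * p1 = 2 * Q - phi p * p0 by rewrite -h1 addrC addKr.
    ring.
  have c2 : (phi p ^+ 2 * K p + phi p * p0 + phi p * p1 - Q) ^+ 2 = (phi p ^+ 2 * c - Q) ^+ 2.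
    by rewrite -[_ + phi p * p0 + _]addrA h1 h2; ring.
  rewrite (weakly_einstein_case EB GB RB c1 c2) e1// D.
  have -> // : (phi p * p0 - Q) ^+ 2 = Q ^+ 2 - phi p ^+ 2 * (p0 * p1).
  have -> : phi p ^+ 2 * (p0 * p1) = phi p * p0 * (phi p * p1) by ring.
  have -> : phi p * p1 = 2 * Q - phi p * p0 by rewrite -h1 addrC addKr.
  ring.
have H : case_ii g phi K c by case: cases.
have [h1 h2] := case_ii_weights H L HP.
have c1 : (phi p * p0 - Q) ^+ 2 = (phi p * p1 - Q) ^+ 2 by rewrite h1.
have c2 : (phi p ^+ 2 * K p + phi p * p0 + phi p * p1 - Q) ^+ 2 = (phi p ^+ 2 * c - Q) ^+ 2.
  have -> : phi p ^+ 2 * K p = 2 * Q - phi p ^+ 2 * c - phi p * p0 - phi p * p1 by rewrite -h2; ring.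
  ring.
rewrite (weakly_einstein_case EB GB RB c1 c2) e2//.
have -> // : (phi p * p0 - Q) ^+ 2 = (phi p ^+ 2 * (K p + c) / 2) ^+ 2.
(* With [P = q] the relation of case (ii) reads [P - Q = - (k + l) / 2]. *)
have -> : phi p ^+ 2 * (K p + c) = 2 * Q - phi p * p0 - phi p * p1 by rewrite -h2; ring.
by rewrite -h1; field.
Qed.

End AtPoint.

(** Smoothness is read off the second equation of case (ii), which expresses this function through
    [phi], its gradient and its Laplacian. *)
Lemma smooth_cases_weight : ~ case_i g phi K c -> case_i g phi K c \/ case_ii g phi K c ->
  smooth_fun AS (fun p => phi p ^+ 2 * (K p + c)).
Proof.
move=> nH cases; have H : case_ii g phi K c by case: cases.
apply: (smooth_fun_local mfdS (W := fun a z => 2 * grad_form (g a) (f a) (f a) z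
  - f a z * \sum_i \sum_j invmx (g a z) i j * hessian (g a) z (f a) i j)) => [a|a p ap].
  have oU : open (cimg (AS a)) by exact: open_cimg.
  have mG := mS a; have sf := phi_smooth a.
  apply: smoothB => //; first by apply: smoothM => //; [exact: smooth_cst|exact (smooth_grad_form mG sf sf)].
  apply: smoothM => //; do 2 (apply: smooth_sum => // ?); apply: smoothM => //.
    by apply: smooth_invmx => //; [exact: smet_smooth mG|exact: smet_unit mG].
  exact: smooth_hessian mG _ sf _ _.
have [_ e] := H a p ap; move: e; rewrite (grad_sqE mfdS riemg phi ap).
have -> : f a (cmap (AS a) p) = phi p by rewrite /f /= (cmapK mfdS ap).
rewrite -/(f a) /laplacian => <-; ring.
Qed.

Lemma weakly_einstein_gbar : case_i g phi K c \/ case_ii g phi K c -> weakly_einstein gbar.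
Proof.
move=> cases; pose Qn := grad_norm mfdS g phi; pose D := hess_det mfdS g phi.
have oI a : open (cimg (AS a)) by exact: open_cimg.
have sQ : smooth_fun AS Qn by exact: smooth_grad_norm.
have sD : smooth_fun AS D by exact: smooth_hess_det.
(* [e] is [(P - Q)^2] as a function on [Sigma], given by the formula of the case at hand. *)
have [e [se e1 e2]] : exists e : Sigma -> R, [/\ smooth_fun AS e,
    case_i g phi K c -> forall p, e p = Qn p ^+ 2 - phi p ^+ 2 * D p &
    ~ case_i g phi K c -> forall p, e p = (phi p ^+ 2 * (K p + c) / 2) ^+ 2].
  have [H|nH] := pselect (case_i g phi K c).
    exists (fun p => Qn p ^+ 2 - phi p ^+ 2 * D p); split=> // a.
    apply: (smoothB (oI a) (f := fun z => Qn (cinv (AS a) z) ^+ 2)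
      (g := fun z => phi (cinv (AS a) z) ^+ 2 * D (cinv (AS a) z))).
      exact: (smoothX (oI a) 2 (sQ a)).
    exact: (smoothM (oI a) (smoothX (oI a) 2 (phi_smooth a)) (sD a)).
  exists (fun p => (phi p ^+ 2 * (K p + c) / 2) ^+ 2); split=> // a.
  have sw := smooth_cases_weight nH cases a.
  exact: (smoothX (oI a) 2 (smoothM (oI a) sw (smooth_cst _ 2^-1))).
pose w p : R := 2 * (phi p ^+ 2 * c - Qn p) ^+ 2 + 4 * e p.
have sw : smooth_fun AS w.
  move=> a; have s1 := smoothM (oI a) (smoothX (oI a) 2 (phi_smooth a)) (smooth_cst (cimg (AS a)) c).
  have s2 := smoothX (oI a) 2 (smoothB (oI a) s1 (sQ a)).
  have s3 := smoothM (oI a) (smooth_cst (cimg (AS a)) 2) s2.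
  exact: (smoothD (oI a) s3 (smoothM (oI a) (smooth_cst (cimg (AS a)) 4) (se a))).
exists (fun z => w z.1).
  move=> [a b]; have := smooth_lsubmx (n := 2) (sw a).
  by apply: smooth_sub => y; rewrite /= cimg_prod_chart => -[].
move=> [a b] [p q] [/= ap bq] i j.
rewrite (einstein_square ap bq i j cases (e := e p)).
- by rewrite /w /Qn (grad_normE mfdS riemg phi_smooth ap) (grad_sqE mfdS riemg phi ap).
- move=> H; rewrite e1// /Qn /D (grad_normE mfdS riemg phi_smooth ap) (grad_sqE mfdS riemg phi ap).
  by rewrite (hess_detE mfdS riemg phi_smooth ap).
- by move=> nH; rewrite e2.
Qed.

Lemma conformally_flat_gbar : conformally_flat gbar <-> forall p, K p = - c.
Proof.
split=> [H p|H [p q]].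
  have [q _] := mfd_nonempty mfdP.
  have [[a b] [U [u [[[ap bq] oU Uy UI] [su u0 flat]]]]] := H (p, q).
  have UP : U `<=` product_set (cimg (AS a)) (cimg (AP b)) by rewrite -cimg_prod_chart.
  have mG := smooth_metric_sub oU UP (smooth_gbar a b).
  have un z : U z -> u z != 0 by move=> /u0 z0; rewrite gt_eqF.
  apply/(weyl_vanishes ap bq).
  exact: (weyl_locally_flat mG su un Uy (flat _ Uy)).
have [[a ap] [b bq]] := (mfd_cover mfdS p, mfd_cover mfdP q).
have yP := product_chart_point ap bq.
have [//|//|||V [u [[oV Vy VP] [su u0 flat]]]] := locally_flat_product (mS a) (mP b) (c := c) yP.
- by rewrite row_mxKl; apply: (metric_posdef riemg); exact: cimg_cmap.
- by rewrite row_mxKr; apply: (metric_posdef riemh); exact: cimg_cmap.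
- by move=> z /(cinvP mfdS)[d e]; rewrite -{1}e -curvg.
- by move=> z /(cinvP mfdP)[d e]; rewrite -{1}e -curvh.
have sF : smooth_on V (fun z => f a (lsubmx z)).
  by apply: smooth_sub (smooth_lsubmx (phi_smooth a)) => z /VP[].
(* The factor [phi^2] undoes the division in [gbar], leaving the factor that flattens the product
   metric. *)
exists (a, b), V, (fun z => u z * f a (lsubmx z) ^+ 2); split; split=> //.
- by rewrite cimg_prod_chart.
- exact: (smoothM oV su (smoothX oV 2 sF)).
- by move=> z Vz; rewrite mulr_gt0 ?u0// exprn_even_gt0//= phi_neq0.
- move=> z Vz i j k l; rewrite -[RHS](flat z Vz i j k l).
  have -> // : (fun z => (u z * f a (lsubmx z) ^+ 2) *: gbar (a, b) z) =
    (fun z => u z *: product_metric (g a) (h b) z).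
  apply/funext => w; rewrite gbarE /warped_metric scalerA mulfK//.
  by rewrite expf_neq0//; exact: phi_neq0.
Qed.

End WarpedProduct.

Theorem theorem9p1 (R : realType) (Sigma Pi : topologicalType)
  (AS : @atlas R Sigma 2) (AP : @atlas R Pi 2)
  (g : metric AS) (h : metric AP)
  (phi K : Sigma -> R) (c : R)
  (mfdS : connected_manifold AS) (mfdP : connected_manifold AP)
  (riemg : riemannian g) (riemh : riemannian h)
  (curvg : gaussian_curvature g K) (curvh : gaussian_curvature h (fun=> c))
  (phi_smooth : smooth_fun AS phi) (phi_neq0 : forall p, phi p != 0)
  (cases : case_i g phi K c \/ case_ii g phi K c) :
  let gbar : metric (prod_atlas AS AP) :=
    rescale (fun z => (phi z.1 ^+ 2)^-1) (prod_metric g h) in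
  weakly_einstein gbar /\
  (case_i g phi K c ->
    (einstein gbar <->
     forall a p, cdom (AS a) p -> hessian_pure g phi a p)) /\
  (case_ii g phi K c ->
    (einstein gbar <->
     forall a p, cdom (AS a) p -> grad_sq g phi a p = c * phi p ^+ 2)) /\
  (conformally_flat gbar <-> forall p, K p = - c) /\
  (forall (a : aidx AS) (b : aidx AP) p q,
    cdom (AS a) p -> cdom (AP b) q ->
    let G : 'rV[R]_4 -> 'M[R]_4 := gbar (a, b) in
    let y : 'rV[R]_4 := cmap (prod_atlas AS AP (a, b)) (p, q) in
    let s := scalar_curvature G y in
    let E_vanishes := einstein_tensor G y = 0 in
    let W_vanishes := forall i j k l, weyl G y i j k l = 0 in
    (case_i g phi K c -> (E_vanishes <-> hessian_pure g phi a p)) /\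
    (case_ii g phi K c ->
      (E_vanishes <-> grad_sq g phi a p = c * phi p ^+ 2)) /\
    (W_vanishes <-> K p = - c) /\
    (~ E_vanishes -> ~ W_vanishes ->
      s != 0 /\
      (case_i g phi K c -> forall o : bool, exists2 lambda : R, lambda != 0 &
        homothety_invariant G y o s
          [:: - lambda; 0; 0; lambda]
          [:: - s / 12; - s / 12; s / 6]
          [:: - s / 12; - s / 12; s / 6]) /\
      (case_ii g phi K c -> forall o : bool, exists2 lambda : R, lambda != 0 &
        homothety_invariant G y o s
          [:: - lambda; - lambda; lambda; lambda]
          [:: - s / 12; s / 24; s / 24]
          [:: - s / 12; s / 24; s / 24]))).
Proof.
move=> gbar; split; first exact: weakly_einstein_gbar mfdS mfdP riemg riemh curvg curvh phi_smooth phi_neq0 cases.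
have eI := einstein_case_i mfdS mfdP riemg riemh curvg curvh phi_smooth phi_neq0.
have eII := einstein_case_ii mfdS mfdP riemg riemh curvg curvh phi_smooth phi_neq0.
(* The conditions in (iii) and (iv) concern [Sigma] alone; a point of [Pi] is fixed to reach them
   from the product. *)
have [q0 _] := mfd_nonempty mfdP; have [b0 bq0] := mfd_cover mfdP q0.
split=> [H|].
  split=> [E a p ap|E [a b] [p q] [/= ap bq]].
    by apply/(eI a b0 p q0 ap bq0 H); exact: (E (a, b0) (p, q0)).
  exact/(eI a b p q ap bq H)/E.
split=> [H|].
  split=> [E a p ap|E [a b] [p q] [/= ap bq]].
    by apply/(eII a b0 p q0 ap bq0 H); exact: (E (a, b0) (p, q0)).
  exact/(eII a b p q ap bq H)/E.
split; first exact: conformally_flat_gbar mfdS mfdP riemg riemh curvg curvh phi_smooth phi_neq0.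
move=> a b p q ap bq G y s E_vanishes W_vanishes.
split; first by move=> H; exact: (eI a b p q ap bq H).
split; first by move=> H; exact: (eII a b p q ap bq H).
split; first exact: (weyl_vanishes mfdS mfdP riemg riemh curvg curvh phi_smooth phi_neq0 ap bq).
move=> nE nW; split.
  exact: (scalar_neq0 mfdS mfdP riemg riemh curvg curvh phi_smooth phi_neq0 ap bq cases nW).
split=> H o.
  exact: (invariant_case_i mfdS mfdP riemg riemh curvg curvh phi_smooth phi_neq0 ap bq o H nE).
exact: (invariant_case_ii mfdS mfdP riemg riemh curvg curvh phi_smooth phi_neq0 ap bq o H nE).
Qed.
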